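(* Let $a\in L^1(\mathbf{T})$ satisfy $a\ge0$ almost everywhere on $\mathbf{T}$ and $\log a\in L^1(\mathbf{T})$. Let $m_0\ge1$, let $E_{11},E_{12},E_{21},E_{22}$ be fixed complex $m_0\times m_0$ matrices, and for $n\ge2m_0$ let $E_n$ be the $n\times n$ matrix with these blocks in its four corners and zeros elsewhere. Put $$S_{11}=\frac1{c_1}\begin{pmatrix}c_1&&\\ \vdots&\ddots&\\ c_{m_0}&\ldots&c_1\end{pmatrix}\begin{pmatrix}\overline{c}_1&\ldots&\overline{c}_{m_0}\\ &\ddots&\vdots\\ &&\overline{c}_1\end{pmatrix}\quad\text{with}\quad c_j=\frac1{G(a)}(a_+^{-1})_{j-1},$$ where the two factors are the $m_0\times m_0$ lower-triangular Toeplitz matrix with first column $(c_1,\ldots,c_{m_0})^\top$ and the $m_0\times m_0$ upper-triangular Toeplitz matrix with first row $(\overline{c}_1,\ldots,\overline{c}_{m_0})$. Then $$\lim_{n\to\infty}\frac{\det(T_n(a)+E_n)}{\det T_n(a)}=\det\left[\begin{pmatrix}I&0\\ 0&I\end{pmatrix}+\begin{pmatrix}S_{11}&0\\ 0&\widetilde{S}_{11}^{\top}\end{pmatrix}\begin{pmatrix}E_{11}&E_{12}\\ E_{21}&E_{22}\end{pmatrix}\right].$$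
   Context: $\mathbf{T}$ is the complex unit circle. For $f\in L^1(\mathbf{T})$ the Fourier coefficients are $f_k=\frac1{2\pi}\int_{-\pi}^{\pi}f(e^{i\theta})e^{-ik\theta}\,d\theta$, $k\in\mathbf{Z}$, and $T_n(f)=(f_{j-k})_{j,k=1}^n$. Under the hypotheses on $a$, $T_n(a)$ is a positive definite Hermitian matrix for every $n\ge1$. $G(a)=\exp\left(\frac1{2\pi}\int_{-\pi}^{\pi}\log a(e^{i\theta})\,d\theta\right)$, which is a finite strictly positive number. With $(\log a)_k$ the $k$th Fourier coefficient of $\log a$, one defines for $|z|<1$ $$a_+^{-1}(z)=\exp\left(-\sum_{k=1}^\infty(\log a)_kz^k\right)=\sum_{k=0}^\infty(a_+^{-1})_kz^k,$$ so $(a_+^{-1})_k$ denotes the $k$th Taylor coefficient at $0$ of this analytic function. The matrix $E_n$ is $$E_n=\begin{pmatrix}E_{11}&0&E_{12}\\ 0&0&0\\ E_{21}&0&E_{22}\end{pmatrix}.$$ $W_m$ denotes the $m\times m$ counter-identity matrix (ones on the counter-diagonal, zeros elsewhere). For an $m\times m$ matrix $B$, $\widetilde{B}:=W_mBW_m$; $B^\top$ is the transpose (without conjugation), and $\widetilde{S}_{11}^{\top}=(\widetilde{S}_{11})^\top$. $I$ is the $m_0\times m_0$ identity matrix, and the bar denotes complex conjugation. *)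

(* Defs.v *)
From HB Require Import structures.
From mathcomp Require Import all_boot all_order all_algebra.
From mathcomp Require Import complex.
From mathcomp Require Import all_classical all_reals all_analysis.

Set Implicit Arguments.
Unset Strict Implicit.
Unset Printing Implicit Defensive.

Import Order.TTheory GRing.Theory Num.Theory.
Import numFieldNormedType.Exports.

Local Open Scope classical_set_scope.
Local Open Scope ring_scope.
Local Open Scope complex_scope.

Section Circle.
Context {R : realType}.

Definition expC (z : R[i]) : R[i] :=
  (expR (complex.Re z))%:C * (cos (complex.Im z) +i* sin (complex.Im z)).

Definition expi (t : R) : R[i] := cos t +i* sin t.

(* A function on the unit circle is given by a function on all of R[i], of
   which only the values at the points expi t are ever used. The values are
   extended reals so that the logarithm of a function with zeros is covered
   too (lne 0 = -oo, whereas ln 0 = 0). *)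
Definition L1_circle (f : R[i] -> \bar R) : Prop :=
  lebesgue_measure.-integrable `[- pi, pi]%classic (f \o expi).

Definition circle_mean (f : R[i] -> \bar R) (w : R -> R) : R :=
  (2 * pi)^-1 *
  fine (\int[lebesgue_measure]_(t in `[(- pi)%R, pi%R]) (f (expi t) * (w t)%:E))%E.

(* e^{-ikt} = cos (kt) - i sin (kt), integrated by real and imaginary parts. *)
Definition fourier_coef (f : R[i] -> \bar R) (k : int) : R[i] :=
  circle_mean f (fun t => cos (k%:~R * t)) -i*
  circle_mean f (fun t => sin (k%:~R * t)).

Definition toeplitz (f : R[i] -> \bar R) (n : nat) : 'M[R[i]]_n :=
  \matrix_(j, k) fourier_coef f ((j : nat)%:Z - (k : nat)%:Z).

Definition log_circle (a : R[i] -> R) (z : R[i]) : \bar R := lne (a z)%:E.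

Definition geom_mean (a : R[i] -> R) : R :=
  expR (circle_mean (log_circle a) (fun=> 1)).

(* Meaningful for |z| < 1, where the series converges. *)
Definition a_plus_inv (a : R[i] -> R) (z : R[i]) : R[i]^o :=
  expC (- lim ([series fourier_coef (log_circle a) j.+1%:Z * z ^+ j.+1 : R[i]^o]_j @ \oo)).

Definition taylor_coef (f : R[i] -> R[i]^o) (k : nat) : R[i] :=
  (f^`(k))%classic 0 / k`!%:R.

End Circle.

Section Matrices.
Context {R : realType}.

(* c_seq a j is c_{j+1}: indices start at 0. *)
Definition c_seq (a : R[i] -> R) (j : nat) : R[i] :=
  ((geom_mean a)^-1)%:C * taylor_coef (a_plus_inv a) j.

Definition lower_toeplitz (c : nat -> R[i]) (m : nat) : 'M[R[i]]_m :=
  \matrix_(i, j) if (j <= i)%N then c (i - j)%N else 0.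

Definition upper_toeplitz (c : nat -> R[i]) (m : nat) : 'M[R[i]]_m :=
  \matrix_(i, j) if (i <= j)%N then c (j - i)%N else 0.

Definition S11 (a : R[i] -> R) (m : nat) : 'M[R[i]]_m :=
  (c_seq a 0)^-1 *:
    (lower_toeplitz (c_seq a) m *m upper_toeplitz (fun j => (c_seq a j)^*) m).

Definition counter_id (m : nat) : 'M[R[i]]_m :=
  \matrix_(i, j) (j == rev_ord i)%:R.

Definition flip_mx (m : nat) (B : 'M[R[i]]_m) : 'M[R[i]]_m :=
  counter_id m *m B *m counter_id m.

(* The n x n matrix E_n with n = m + (k + m): the sizes n >= 2m are exactly
   those of this form, with k = n - 2m. *)
Definition corner_mx (m k : nat) (E11 E12 E21 E22 : 'M[R[i]]_m) :
    'M[R[i]]_(m + (k + m)) :=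
  col_mx (row_mx E11 (row_mx 0 E12))
 (col_mx (row_mx 0   (row_mx 0 0))
         (row_mx E21 (row_mx 0 E22))).

End Matrices.

(* Main.v *)
Require Import Defs.
From HB Require Import structures.
From mathcomp Require Import all_boot all_order all_algebra.
From mathcomp Require Import complex.
From mathcomp Require Import all_classical all_reals all_analysis.
From mathcomp Require Import measurable_realfun.
From mathcomp Require Import ring lra zify.

Set Implicit Arguments.
Unset Strict Implicit.
Unset Printing Implicit Defensive.

Import Order.TTheory GRing.Theory Num.Theory.
Import numFieldNormedType.Exports.

Local Open Scope classical_set_scope.
Local Open Scope ring_scope.
Local Open Scope complex_scope.

(* Let T = T_n(a), X = T^-1. As det(T + E_n) / det T = det(1 + X E_n), and by
   Sylvester's identity only the corners of X matter, it is enough to find the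
   limits of the entries of X near its corners.  With p(y) the polynomial with
   coefficient vector y, y^* T y is the mean of a |p(y)|^2 over the circle.

   Lower bound (Szego): with l_k = (log a)_k and h = exp(sum_(k >= 1) l_k z^k),
   the mean of a |p|^2 is at least G(a) times the sum of the squared moduli of
   any initial segment of the coefficients of p h, because |h|^2 G(a) = a.
   Upper bound: the polynomials approximating q / h, for a fixed polynomial q,
   have mean of a |p|^2 at most about G(a) |q|^2.  To avoid boundary values, log a
   is replaced by its Fejer means (Jensen's inequality keeps exp of the mean of
   log a below the mean of a) and exp P by (1 + P / N)^N, so that everything
   reduces to trigonometric polynomials; in the upper bound log a is truncated
   from below, and the density of continuous functions in L^1 is used.

   The lower bound gives |y_k|^2 <= S_kk y^* T y for the candidate limit S of
   the upper left corner, and, T being invariant under reversal composed with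
   conjugation, the same for y_(n-1-k).  The upper bound provides p of fixed degree
   with first coefficients close to column j of S and mean of a |p|^2 close to S_jj,
   and then y = X e_j - p has y^* T y small: so X_ij is close to S_ij, and the
   entries of X e_j at the far end are close to those of p, that is 0.

   Differentiating a_+^(-1) = exp(-F) repeatedly shows that its Taylor coefficients
   satisfy the recursion (n + 1) e_(n+1) = - sum_(i <= n) (i + 1) l_(i+1) e_(n-i)
   of formal exponentials, which the coefficients of (1 - P / N)^N satisfy in the
   limit. *)

(** * Limits of complex sequences *)

Section ComplexSequences.
Context {R : realType}.
Local Notation C := R[i].

(** The squared modulus as an element of [R]: quadratic estimates then take place in the real field
    and need no square roots. *)
Definition sqn (z : C) : R := complex.Re z ^+ 2 + complex.Im z ^+ 2.

Definition ccvg (u : nat -> C) (l : C) : Prop := (u : nat -> C^o) @ \oo --> (l : C^o).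

Lemma sqnE (z : C) : z * conjc z = (sqn z)%:C.
Proof. by case: z => x y; rewrite /sqn; simpc; congr Complex; ring. Qed.

Lemma sqn_ge0 (z : C) : 0 <= sqn z.
Proof. by rewrite addr_ge0 // sqr_ge0. Qed.

Lemma sqnM (z w : C) : sqn (z * w) = sqn z * sqn w.
Proof. by case: z => x y; case: w => u v; rewrite /sqn /=; ring. Qed.

Lemma sqnX (z : C) n : sqn (z ^+ n) = sqn z ^+ n.
Proof. by elim: n => [|n ih]; rewrite ?exprS ?sqnM ?ih // /sqn /=; ring. Qed.

Lemma sqnJ (z : C) : sqn z^* = sqn z.
Proof. by case: z => x y; rewrite /sqn /= sqrrN. Qed.

Lemma sqn0 : sqn (0 : C) = 0.
Proof. by rewrite /sqn /= expr0n addr0. Qed.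

Lemma sqn_eq0 (z : C) : (sqn z == 0) = (z == 0).
Proof.
by case: z => x y; rewrite /sqn paddr_eq0 ?sqr_ge0 // !sqrf_eq0 eq_complex.
Qed.

Lemma conjcM (z w : C) : conjc (z * w) = conjc z * conjc w.
Proof. exact: rmorphM. Qed.

Lemma conjc_sum I (r : seq I) (P : pred I) (F : I -> C) :
  (\sum_(i <- r | P i) F i)^* = \sum_(i <- r | P i) conjc (F i).
Proof. exact: rmorph_sum. Qed.

Lemma ReD (z w : C) : complex.Re (z + w) = complex.Re z + complex.Re w.
Proof. by case: z; case: w. Qed.

Lemma ImD (z w : C) : complex.Im (z + w) = complex.Im z + complex.Im w.
Proof. by case: z; case: w. Qed.

Lemma Re_sum I (r : seq I) (P : pred I) (F : I -> C) :
  complex.Re (\sum_(i <- r | P i) F i) = \sum_(i <- r | P i) complex.Re (F i).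
Proof. exact: (big_morph _ ReD). Qed.

Lemma Im_sum I (r : seq I) (P : pred I) (F : I -> C) :
  complex.Im (\sum_(i <- r | P i) F i) = \sum_(i <- r | P i) complex.Im (F i).
Proof. exact: (big_morph _ ImD). Qed.

Lemma ler_normRe (z : C) : (`|complex.Re z|%:C <= `|z| :> C).
Proof. exact: normc_ge_Re. Qed.

Lemma ler_normIm (z : C) : (`|complex.Im z|%:C <= `|z| :> C).
Proof.
rewrite normc_def lecR -[leLHS]sqrtr_sqr ler_wsqrtr // lerDr; exact: sqr_ge0.
Qed.

Lemma normC_le (z : C) : (`|z| <= (`|complex.Re z| + `|complex.Im z|)%:C :> C).
Proof.
case: z => x y; rewrite normc_def lecR /= -[leRHS]ger0_norm ?addr_ge0 //.
rewrite -[leRHS]sqrtr_sqr ler_wsqrtr // sqrrD !real_normK ?num_real //.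
by rewrite -addrA (addrC (_ *+ 2)) addrA lerDl mulrn_wge0 // mulr_ge0.
Qed.

Lemma ccvgP (u : nat -> C) l : ccvg u l <->
  (complex.Re (u n) @[n --> \oo] --> complex.Re l) /\
  (complex.Im (u n) @[n --> \oo] --> complex.Im l).
Proof.
split=> [/cvgrPdist_lt h|[/cvgrPdist_lt hr /cvgrPdist_lt hi]].
  split; apply/cvgrPdist_lt => e e0;
    (have e0' : (0 : C) < e%:C by rewrite ltcR);
    near=> n; rewrite -ltcR.
  - apply: le_lt_trans (_ : `|l - u n| < _); last by near: n; exact: h.
    by have := ler_normRe (l - u n); case: (l) (u n) => ? ? [].
  - apply: le_lt_trans (_ : `|l - u n| < _); last by near: n; exact: h.
    by have := ler_normIm (l - u n); case: (l) (u n) => ? ? [].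
apply/cvgrPdist_lt => -[e e'] e0.
(* A positive element of [R[i]] is real, since the order only compares numbers with equal imaginary
   parts. *)
have e'0 : e' = 0 by move: e0; rewrite ltcE /= => /andP[/eqP].
have {e0} e0 : 0 < e by move: e0; rewrite ltcE /= => /andP[].
rewrite e'0.
have e20 : 0 < e / 2 by rewrite divr_gt0.
near=> n; apply: (le_lt_trans (normC_le _)).
have -> : e +i* 0 = (e / 2 + e / 2)%:C by congr Complex; field.
have h1 : `|complex.Re l - complex.Re (u n)| < e / 2 by near: n; exact: hr.
have h2 : `|complex.Im l - complex.Im (u n)| < e / 2 by near: n; exact: hi.
by move: h1 h2; case: (l) (u n) => ? ? [? ?] h1 h2; rewrite ltcR ltrD.
Unshelve. all: by end_near. Qed.

Lemma ccvg_Re (u : nat -> C) l : ccvg u l -> complex.Re (u n) @[n --> \oo] --> complex.Re l.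
Proof. by case/ccvgP. Qed.

Lemma ccvgD (u v : nat -> C) a b : ccvg u a -> ccvg v b -> ccvg (fun n => u n + v n) (a + b).
Proof. by move=> hu hv; exact: (cvgD hu hv). Qed.

Lemma ccvgM (u v : nat -> C) a b : ccvg u a -> ccvg v b -> ccvg (fun n => u n * v n) (a * b).
Proof. by move=> hu hv; exact: (cvgM hu hv). Qed.

Lemma ccvgN (u : nat -> C) a : ccvg u a -> ccvg (fun n => - u n) (- a).
Proof. by move=> hu; exact: (cvgN hu). Qed.

Lemma ccvg_cst (a : C) : ccvg (fun=> a) a.
Proof. exact: cvg_cst. Qed.

Lemma ccvg_sum I (r : seq I) (P : pred I) (F : I -> nat -> C) (l : I -> C) :
  (forall i, P i -> ccvg (F i) (l i)) ->
  ccvg (fun n => \sum_(i <- r | P i) F i n) (\sum_(i <- r | P i) l i).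
Proof.
move=> h; elim: r => [|i r ih].
  by under [X in ccvg X]funext do rewrite big_nil; rewrite big_nil; exact: ccvg_cst.
under [X in ccvg X]funext do rewrite big_cons; rewrite big_cons.
by case: ifP => [Pi|_]; [exact: (ccvgD (h i Pi) ih)|exact: ih].
Qed.

Lemma ccvg_prod I (r : seq I) (P : pred I) (F : I -> nat -> C) (l : I -> C) :
  (forall i, P i -> ccvg (F i) (l i)) ->
  ccvg (fun n => \prod_(i <- r | P i) F i n) (\prod_(i <- r | P i) l i).
Proof.
move=> h; elim: r => [|i r ih].
  by under [X in ccvg X]funext do rewrite big_nil; rewrite big_nil; exact: ccvg_cst.
under [X in ccvg X]funext do rewrite big_cons; rewrite big_cons.
by case: ifP => [Pi|_]; [exact: (ccvgM (h i Pi) ih)|exact: ih].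
Qed.

Lemma ccvg_eq (u v : nat -> C) l : (\forall n \near \oo, u n = v n) -> ccvg u l -> ccvg v l.
Proof.
move=> h hu; apply: cvg_trans hu; apply: near_eq_cvg.
by apply: filterS h => n ->.
Qed.

Lemma ccvg_real (u : nat -> R) (l : R) : u @ \oo --> l -> ccvg (fun n => (u n)%:C) l%:C.
Proof. by move=> h; apply/ccvgP; split => //=; exact: cvg_cst. Qed.

Lemma ccvg_sqn (u : nat -> C) l : ccvg u l -> sqn (u n) @[n --> \oo] --> sqn l.
Proof.
by case/ccvgP=> hr hi; apply: cvgD; [exact: (cvgM hr hr)|exact: (cvgM hi hi)].
Qed.

Lemma ccvg_cvg (u : nat -> C) l : ccvg u l -> (u : nat -> C^o) @ \oo --> (l : C^o).
Proof. by []. Qed.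

Lemma ccvg_lim (u : nat -> C) l : ccvg u l -> lim ((u : nat -> C^o) @ \oo) = l.
Proof. by move=> h; exact: (cvg_lim (@norm_hausdorff _ _) h). Qed.

End ComplexSequences.

(* Keeps unification from comparing limits by unfolding the topology of R[i]. *)
#[global] Opaque ccvg.

(** * Formal exponentials *)

Section FormalExponential.
Context {R : realType}.
Local Notation C := R[i].

(** The recursion is $H' = l' H$ read coefficientwise. Coefficient $n+1$ involves all the earlier
    ones, so the whole list of coefficients is carried along. *)
Fixpoint fexp_seq (l : nat -> C) (n : nat) : seq C :=
  if n is m.+1 then
    let s := fexp_seq l m in
    rcons s (m.+1%:R^-1 * \sum_(i < m.+1) i.+1%:R * l i.+1 * s`_(m - i))
  else [:: 1].

(* Coefficients of the formal power series exp (\sum_(k >= 1) l k z^k); the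
   value l 0 is ignored. *)
Definition fexp (l : nat -> C) (n : nat) : C := (fexp_seq l n)`_n.

Lemma size_fexp_seq l n : size (fexp_seq l n) = n.+1.
Proof. by elim: n => //= n ih; rewrite size_rcons ih. Qed.

Lemma nth_fexp_seq l n i : (i <= n)%N -> (fexp_seq l n)`_i = fexp l i.
Proof.
elim: n => [|n ih]; first by rewrite leqn0 => /eqP ->.
rewrite leq_eqVlt => /predU1P[->//|]; rewrite ltnS => le_in.
by rewrite /= nth_rcons size_fexp_seq ltnS le_in ih.
Qed.

Lemma fexp0 l : fexp l 0 = 1.
Proof. by []. Qed.

Lemma fexpS l n :
  n.+1%:R * fexp l n.+1 = \sum_(i < n.+1) i.+1%:R * l i.+1 * fexp l (n - i).
Proof.
rewrite {1}/fexp /= nth_rcons size_fexp_seq ltnn eqxx mulrA divff ?mul1r ?pnatr_eq0 //.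
by apply: eq_bigr => i _; rewrite nth_fexp_seq // leq_subr.
Qed.

Lemma fexp_unique l (e : nat -> C) : e 0%N = 1 ->
  (forall n, n.+1%:R * e n.+1 = \sum_(i < n.+1) i.+1%:R * l i.+1 * e (n - i)%N) ->
  e =1 fexp l.
Proof.
move=> e0 eS n; elim/ltn_ind: n => -[_|n ih]; first by rewrite e0.
have n1 : n.+1%:R != 0 :> C by rewrite pnatr_eq0.
apply: (mulfI n1); rewrite eS fexpS; apply: eq_bigr => i _.
by rewrite ih // ltnS leq_subr.
Qed.

(** Coefficient $k+1$ is a finite combination of earlier ones, so limits pass through the recursion
    by strong induction. The weights [v] may differ from their limits, which covers both a varying
    exponent and the Euler approximation. *)
Lemma ccvg_fexp_of_rec (l : nat -> C) (u : nat -> nat -> C) (v : nat -> nat -> nat -> C) :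
  (forall n, u n 0%N = 1) ->
  (forall n k, k.+1%:R * u n k.+1 = \sum_(i < k.+1) v n k i * u n (k - i)%N) ->
  (forall k i, (i <= k)%N -> ccvg (fun n => v n k i) (i.+1%:R * l i.+1)) ->
  forall k, ccvg (fun n => u n k) (fexp l k).
Proof.
move=> u0 uS hv k; elim/ltn_ind: k => -[_|k ih].
  by under [X in ccvg X]funext do rewrite u0; exact: ccvg_cst.
have k1 : k.+1%:R != 0 :> C by rewrite pnatr_eq0.
have -> : fexp l k.+1 = k.+1%:R^-1 * \sum_(i < k.+1) i.+1%:R * l i.+1 * fexp l (k - i).
  by apply: (mulfI k1); rewrite fexpS mulrA divff // mul1r.
have -> : (fun n => u n k.+1) = (fun n => k.+1%:R^-1 * \sum_(i < k.+1) v n k i * u n (k - i)%N).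
  by apply/funext => n; apply: (mulfI k1); rewrite uS mulrA divff // mul1r.
apply: ccvgM; first exact: ccvg_cst.
apply: ccvg_sum => i _; apply: ccvgM.
  by apply: hv; rewrite -ltnS.
by apply: ih; rewrite ltnS leq_subr.
Qed.

Lemma ccvg_fexp (l : nat -> C) (L : nat -> nat -> C) :
  (forall k, ccvg (fun n => L n k) (l k)) ->
  forall k, ccvg (fun n => fexp (L n) k) (fexp l k).
Proof.
move=> hL; apply: (@ccvg_fexp_of_rec _ _ (fun n _ i => i.+1%:R * L n i.+1)).
    by move=> n; rewrite fexp0.
  by move=> n k; rewrite fexpS.
by move=> k i _; apply: ccvgM; [exact: ccvg_cst|exact: hL].
Qed.

(* The Euler approximation H = (1 + W / N)^N satisfies (1 + W / N) H' = W' H,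
   which tends to the differential equation of the exponential. *)
Lemma ccvg_euler_coef (l : nat -> C) (W : nat -> {poly C}) (N : nat -> nat) :
  (forall n, (0 < N n)%N) -> ccvg (fun n => (N n)%:R^-1) (0 : C) ->
  (forall n, (W n)`_0 = 0) -> (forall k, ccvg (fun n => (W n)`_k) (l k)) ->
  forall k, ccvg (fun n => ((1 + (N n)%:R^-1 *: W n) ^+ N n)`_k) (fexp l k).
Proof.
move=> N0 hN W0 hW.
apply: (@ccvg_fexp_of_rec _ (fun n k => ((1 + (N n)%:R^-1 *: W n) ^+ N n)`_k)
  (fun n k i => i.+1%:R * (W n)`_i.+1
   - (if (i < k)%N then (N n)%:R^-1 * (W n)`_i.+1 * (k - i)%:R else 0))).
- move=> n; rewrite -horner_coef0 horner_exp hornerD hornerZ !horner_coef0 W0.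
  by rewrite coefC mulr0 addr0 expr1n.
- move=> n k; set H := _ ^+ _; set c := (N n)%:R^-1.
  have Nn0 : (N n)%:R != 0 :> C by rewrite pnatr_eq0 -lt0n.
  have ode : (1 + c *: W n) * H^`() = (W n)^`() * H.
    rewrite /H; case: (N n) (N0 n) @c Nn0 {H} => // m _ c m0.
    rewrite deriv_exp derivD derivZ -[1]/(1%:P) derivC add0r exprS -!mul_polyC.
    rewrite -mulr_natl /=; set B := _ + _.
    have cm : c%:P * m.+1%:R = 1 :> {poly C} by rewrite -polyC_natr -polyCM mulVf.
    rewrite -/c; rewrite -[RHS]mul1r -[in RHS]cm.
    move: B (B ^+ m) (c%:P) (_%:R) (W n)^`() => x1 x2 x3 x4 x5.
    ring.
  have /(congr1 (fun p : {poly C} => p`_k)) := ode.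
  rewrite mulrDl mul1r coefD -scalerAl coefZ !coefM coef_deriv mulr_natl => /eqP.
  rewrite -subr_eq0 -addrA addr_eq0 => /eqP ->; rewrite opprB.
  under [RHS]eq_bigr do rewrite mulrBl.
  rewrite sumrB; congr (_ - _).
    by apply: eq_bigr => i _; rewrite coef_deriv mulr_natl.
  (* The first term of the product vanishes because [W n] has no constant term. Shifting the index
     leaves only $i < k$, whence the cutoff in the correction term of the recursion. *)
  rewrite big_ord_recl W0 mul0r add0r [RHS]big_ord_recr /= ltnn mul0r addr0 mulr_sumr.
  apply: eq_bigr => i _; rewrite ltn_ord coef_deriv /bump leq0n add1n.
  by rewrite subnSK ?ltn_ord // -mulr_natr -/c; ring.
- move=> k i le_ik.
  rewrite -[X in ccvg _ X]subr0; apply: ccvgD.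
    by apply: ccvgM; [exact: ccvg_cst|exact: hW].
  apply: ccvgN; case: (i < k)%N; last exact: ccvg_cst.
  suff : ccvg (fun n => (N n)%:R^-1 * (W n)`_i.+1 * (k - i)%:R) (0 * l i.+1 * (k - i)%:R).
    by rewrite !mul0r.
  apply: ccvgM; last exact: ccvg_cst.
  exact: (ccvgM hN (hW i.+1)).
Qed.

Lemma fexp_0 n : fexp (fun=> 0) n = (n == 0%N)%:R.
Proof.
suff /(_ n) <- : (fun n => (n == 0%N)%:R : C) =1 fexp (fun=> 0) by [].
apply: fexp_unique => // {}n; rewrite mulr0 big1 // => i _.
by rewrite mulr0 mul0r.
Qed.

Lemma ccvg_unique (u : nat -> C) a b : ccvg u a -> ccvg u b -> a = b.
Proof.
move=> /ccvgP[ra ia] /ccvgP[rb ib].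
have er := cvg_unique _ ra rb; have ei := cvg_unique _ ia ib.
case: a b er ei {ra rb ia ib} => [? ?] [? ?] /= er ei.
by congr Complex; [exact: er|exact: ei].
Qed.

Lemma ccvg_invn : ccvg (fun n => n.+1%:R^-1) (0 : C).
Proof.
have := ccvg_real (@cvg_harmonic R); congr ccvg; apply/funext => n.
by rewrite /= fmorphV rmorph_nat.
Qed.

(** This is $\exp(l)\exp(-l) = 1$, obtained as a limit of $(1+P/N)^N(1-P/N)^N = (1+W/N)^N$ with $W =
    -P^2/N$. As the coefficients of $W$ tend to 0, the right side tends to the formal exponential of
    0. Here $P$ is a truncation of $l$ and $N = m+1$. *)
Lemma fexpVM l n :
  \sum_(i < n.+1) fexp l i * fexp (fun k => - l k) (n - i) = (n == 0%N)%:R.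
Proof.
pose P m : {poly C} := \poly_(i < m.+1) (if i is 0%N then 0 else l i).
pose l' i := if i is 0%N then 0 else l i.
have P0 m : (P m)`_0 = 0 by rewrite coef_poly.
have cP k : ccvg (fun m => (P m)`_k) (l' k).
  apply: (@ccvg_eq _ (fun=> l' k)); last exact: ccvg_cst.
  near=> m.
  rewrite coef_poly ltnS; have -> : (k <= m)%N by near: m; exact: nbhs_infty_ge.
  by [].
have fl : fexp l' =1 fexp l by apply: fexp_unique => // m; rewrite fexpS.
have flN : fexp (fun k => - l' k) =1 fexp (fun k => - l k).
  by apply: fexp_unique => // m; rewrite fexpS.
have h1 := ccvg_euler_coef (fun=> ltn0Sn _) ccvg_invn P0 cP.
have h2 := @ccvg_euler_coef _ (fun m => - P m) succn (fun=> ltn0Sn _) ccvg_invn _ _.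
have {}h2 := h2 (fun k => - l' k).
have PN0 m : (- P m)`_0 = 0 by rewrite coefN P0 oppr0.
have cPN k : ccvg (fun m => (- P m)`_k) (- l' k).
  by under [X in ccvg X]funext do rewrite coefN; apply: ccvgN.
have {}h2 := h2 PN0 cPN.
pose W m : {poly C} := - (m.+1%:R^-1 *: P m ^+ 2).
have W0 m : (W m)`_0 = 0.
  by rewrite coefN coefZ coefM big_ord_recl big_ord0 P0 !mul0r addr0 mulr0 oppr0.
have cW k : ccvg (fun m => (W m)`_k) 0.
  under [X in ccvg X]funext do rewrite coefN coefZ coefM.
  suff : ccvg (fun m => - (m.+1%:R^-1 * \sum_(j < k.+1) (P m)`_j * (P m)`_(k - j)))
    (- (0 * \sum_(j < k.+1) l' j * l' (k - j)%N)) by rewrite mul0r oppr0.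
  apply: ccvgN; apply: (ccvgM ccvg_invn); apply: ccvg_sum => j _.
  exact: (ccvgM (cP _) (cP _)).
have := @ccvg_euler_coef (fun=> 0) W succn (fun=> ltn0Sn _) ccvg_invn W0 cW n.
rewrite fexp_0.
move=> h3; refine (ccvg_unique _ h3).
have -> : (fun m => ((1 + m.+1%:R^-1 *: W m) ^+ m.+1)`_n) = (fun m =>
   \sum_(i < n.+1) ((1 + m.+1%:R^-1 *: P m) ^+ m.+1)`_i *
    ((1 + m.+1%:R^-1 *: - P m) ^+ m.+1)`_(n - i)).
  apply/funext => m; rewrite -coefM -exprMn; congr (nth _ (polyseq (_ ^+ _)) n).
  by rewrite /W -!mul_polyC; move: (_%:P) (P m) => x y; ring.
apply: ccvg_sum => i _; rewrite -fl -flN.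
exact: (ccvgM (h1 _) (h2 _)).
Unshelve. all: by end_near. Qed.

End FormalExponential.

(** * Means over the circle *)

Section CircleMean.
Context {R : realType}.
Local Notation C := R[i].
Local Notation mu := (@lebesgue_measure R).
Local Notation T := (`[- pi, pi]%classic : set R).
Implicit Types (f g h : R -> R) (F G : R -> C).

Definition integ f : Prop := mu.-integrable T (EFin \o f).

Definition mean f : R := (2 * pi)^-1 * \int[mu]_(t in T) f t.

Definition bdd_meas f : Prop :=
  measurable_fun T f /\ exists M, forall t, `|f t| <= M.

Lemma measurable_circle : measurable (T : set (measurableTypeR R)).
Proof. exact: measurable_itv. Qed.
Hint Resolve measurable_circle : core.

Lemma pi2_gt0 : 0 < 2 * pi :> R.
Proof. by rewrite mulr_gt0 // pi_gt0. Qed.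

Lemma lebesgue_circle : mu T = (2 * pi)%:E.
Proof.
rewrite lebesgue_measure_itv /= lte_fin ifT; last first.
  by rewrite (@lt_trans _ _ 0) ?oppr_lt0 ?pi_gt0.
by rewrite -EFinB; congr (_%:E); ring.
Qed.

Lemma bdd_integ f : bdd_meas f -> integ f.
Proof.
move=> [mf [M bf]]; apply: measurable_bounded_integrable => //.
  by rewrite [X in (X < _)%E]lebesgue_circle ltry.
exists M; split; first exact: num_real.
by move=> x Mx y _ /=; apply: le_trans (bf y) (ltW Mx).
Qed.

Lemma integM f g : integ f -> bdd_meas g -> integ (fun t => f t * g t).
Proof.
move=> fi [mg [M bg]].
have := integrableMl measurable_circle fi mg; apply.
exists M; split; first exact: num_real.
by move=> x Mx y _ /=; apply: le_trans (bg y) (ltW Mx).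
Qed.

Lemma integD f g : integ f -> integ g -> integ (fun t => f t + g t).
Proof. by move=> fi gi; have := integrableD measurable_circle fi gi. Qed.

Lemma integZ c f : integ f -> integ (fun t => c * f t).
Proof. by move=> fi; have := integrableZl measurable_circle c fi. Qed.

Lemma integN f : integ f -> integ (fun t => - f t).
Proof.
by move=> /(integZ (-1)); congr integ; apply/funext => t; rewrite mulN1r.
Qed.

Lemma integB f g : integ f -> integ g -> integ (fun t => f t - g t).
Proof. by move=> fi /integN; exact: integD. Qed.

Lemma integ_abs f : integ f -> integ (fun t => `|f t|).
Proof. by move=> fi; have := integrable_abse fi. Qed.

Lemma integ_measurable f : integ f -> measurable_fun T f.
Proof. by move=> /measurable_int/measurable_EFinP. Qed.

Lemma bdd_cst c : bdd_meas (fun=> c).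
Proof. by split; [exact: measurable_cst|exists `|c|]. Qed.

Lemma integ_cst c : integ (fun=> c).
Proof. exact/bdd_integ/bdd_cst. Qed.

Lemma bddD f g : bdd_meas f -> bdd_meas g -> bdd_meas (fun t => f t + g t).
Proof.
move=> [mf [M bf]] [mg [N bg]]; split; first exact: measurable_funD.
by exists (M + N) => t; rewrite (le_trans (ler_normD _ _)) ?lerD.
Qed.

Lemma bddM f g : bdd_meas f -> bdd_meas g -> bdd_meas (fun t => f t * g t).
Proof.
move=> [mf [M bf]] [mg [N bg]]; split; first exact: measurable_funM.
by exists (M * N) => t; rewrite normrM ler_pM.
Qed.

Lemma bddZ c f : bdd_meas f -> bdd_meas (fun t => c * f t).
Proof. by apply: bddM; exact: bdd_cst. Qed.

Lemma bddN f : bdd_meas f -> bdd_meas (fun t => - f t).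
Proof.
by move=> /(bddZ (-1)); congr bdd_meas; apply/funext => t; rewrite mulN1r.
Qed.

Lemma continuous_bdd f M : continuous f -> (forall t, `|f t| <= M) -> bdd_meas f.
Proof.
move=> cf bf; split; last by exists M.
apply: measurable_funTS; exact: continuous_measurable_fun.
Qed.

Lemma meanD f g : integ f -> integ g -> mean (fun t => f t + g t) = mean f + mean g.
Proof. by move=> fi gi; rewrite /mean RintegralD // mulrDr. Qed.

Lemma meanZ c f : integ f -> mean (fun t => c * f t) = c * mean f.
Proof. by move=> fi; rewrite /mean RintegralZl // mulrCA. Qed.

Lemma meanN f : integ f -> mean (fun t => - f t) = - mean f.
Proof.
move=> fi; rewrite -mulN1r -meanZ //; congr mean.
by apply/funext => t; rewrite mulN1r.
Qed.

Lemma meanB f g : integ f -> integ g -> mean (fun t => f t - g t) = mean f - mean g.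
Proof. by move=> fi gi; rewrite meanD ?meanN //; exact: integN. Qed.

Lemma mean_cst c : mean (fun=> c) = c.
Proof.
rewrite /mean Rintegral_cst //.
have /= -> := congr1 fine lebesgue_circle.
rewrite mulrCA mulVf ?mulr1 //.
by rewrite gt_eqF // pi2_gt0.
Qed.

Lemma ae_imp (P Q : R -> Prop) : (forall t, P t -> Q t) ->
  {ae mu, forall t, P t} -> {ae mu, forall t, Q t}.
Proof. exact: (@filterS _ _ (ae_filter_ringOfSetsType mu)). Qed.

Lemma ae_eq_mean f g : integ f -> integ g ->
  {ae mu, forall t, T t -> f t = g t} -> mean f = mean g.
Proof.
move=> fi gi fg; congr (_ * fine _); apply: ae_eq_integral => //.
- by apply/measurable_EFinP; exact: integ_measurable.
- by apply/measurable_EFinP; exact: integ_measurable.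
- by move: fg; apply: ae_imp => t h Tt; rewrite h.
Qed.

Lemma mean_ge0 f : (forall t, T t -> 0 <= f t) -> 0 <= mean f.
Proof.
move=> f0; rewrite mulr_ge0 ?invr_ge0 ?(ltW pi2_gt0) //.
exact: Rintegral_ge0.
Qed.

Lemma ler_mean f g : integ f -> integ g -> (forall t, T t -> f t <= g t) ->
  mean f <= mean g.
Proof.
move=> fi gi fg; rewrite -subr_ge0 -meanB //; apply: mean_ge0 => t Tt.
by rewrite subr_ge0 fg.
Qed.

(** The difference agrees almost everywhere with its absolute value, which is nonnegative
    everywhere. *)
Lemma ae_ler_mean f g : integ f -> integ g ->
  {ae mu, forall t, T t -> f t <= g t} -> mean f <= mean g.
Proof.
move=> fi gi fg; rewrite -subr_ge0 -meanB //.
have di := integB gi fi.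
rewrite (@ae_eq_mean _ (fun t => `|g t - f t|)) //.
- by apply: mean_ge0 => t _; exact: normr_ge0.
- exact: integ_abs.
- by move: fg; apply: ae_imp => t h /h ht; rewrite ger0_norm // subr_ge0.
Qed.

Lemma normr_mean f : integ f -> `|mean f| <= mean (fun t => `|f t|).
Proof.
move=> fi; rewrite /mean normrM ger0_norm ?invr_ge0 ?(ltW pi2_gt0) //.
by rewrite ler_pM2l ?invr_gt0 ?pi2_gt0 // le_normr_Rintegral.
Qed.

End CircleMean.

#[global] Hint Resolve measurable_circle : core.

(** * Complex-valued means and the characters of the circle *)

Section ComplexMean.
Context {R : realType}.
Local Notation C := R[i].
Local Notation T := (`[- pi, pi]%classic : set R).
Implicit Types (f g : R -> R) (F G : R -> C).

Definition cinteg F : Prop :=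
  integ (fun t => complex.Re (F t)) /\ integ (fun t => complex.Im (F t)).

Definition cbdd F : Prop :=
  bdd_meas (fun t => complex.Re (F t)) /\ bdd_meas (fun t => complex.Im (F t)).

Definition cmean F : C :=
  mean (fun t => complex.Re (F t)) +i* mean (fun t => complex.Im (F t)).

Lemma cintegM F G : cinteg F -> cbdd G -> cinteg (fun t => F t * G t).
Proof.
move=> [rF iF] [rG iG]; split.
  have := integB (integM rF rG) (integM iF iG); congr integ; apply/funext => t.
  by case: (F t) (G t) => ? ? [].
have := integD (integM rF iG) (integM iF rG); congr integ; apply/funext => t.
by case: (F t) (G t) => ? ? [].
Qed.

Lemma cbddM F G : cbdd F -> cbdd G -> cbdd (fun t => F t * G t).
Proof.
move=> [rF iF] [rG iG]; split.
  have := bddD (bddM rF rG) (bddN (bddM iF iG)); congr bdd_meas; apply/funext => t.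
  by case: (F t) (G t) => ? ? [].
have := bddD (bddM rF iG) (bddM iF rG); congr bdd_meas; apply/funext => t.
by case: (F t) (G t) => ? ? [].
Qed.

Lemma cbdd_cinteg F : cbdd F -> cinteg F.
Proof. by case=> rF iF; split; exact: bdd_integ. Qed.

Lemma cbdd_cst (c : C) : cbdd (fun=> c).
Proof. by split; exact: bdd_cst. Qed.

Lemma cintegD F G : cinteg F -> cinteg G -> cinteg (fun t => F t + G t).
Proof.
move=> [rF iF] [rG iG]; split.
  have := integD rF rG; congr integ; apply/funext => t.
  by case: (F t) (G t) => ? ? [].
have := integD iF iG; congr integ; apply/funext => t.
by case: (F t) (G t) => ? ? [].
Qed.

Lemma cbddD F G : cbdd F -> cbdd G -> cbdd (fun t => F t + G t).
Proof.
move=> [rF iF] [rG iG]; split.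
  have := bddD rF rG; congr bdd_meas; apply/funext => t.
  by case: (F t) (G t) => ? ? [].
have := bddD iF iG; congr bdd_meas; apply/funext => t.
by case: (F t) (G t) => ? ? [].
Qed.

Lemma cintegZ (c : C) F : cinteg F -> cinteg (fun t => c * F t).
Proof.
move=> Fi; have := cintegM Fi (cbdd_cst c); congr cinteg.
by apply/funext => t; rewrite mulrC.
Qed.

Lemma cbdd_sum I (r : seq I) (P : pred I) (F : I -> R -> C) :
  (forall i, P i -> cbdd (F i)) -> cbdd (fun t => \sum_(i <- r | P i) F i t).
Proof.
move=> h; elim: r => [|i r ih].
  by under [X in cbdd X]funext do rewrite big_nil; exact: cbdd_cst.
under [X in cbdd X]funext do rewrite big_cons.
by case: (boolP (P i)) => [Pi|_ //]; apply: cbddD; [exact: h|exact: ih].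
Qed.

Lemma cinteg_sum I (r : seq I) (P : pred I) (F : I -> R -> C) :
  (forall i, P i -> cinteg (F i)) -> cinteg (fun t => \sum_(i <- r | P i) F i t).
Proof.
move=> h; elim: r => [|i r ih].
  by under [X in cinteg X]funext do rewrite big_nil; exact/cbdd_cinteg/cbdd_cst.
under [X in cinteg X]funext do rewrite big_cons.
by case: (boolP (P i)) => [Pi|_ //]; apply: cintegD; [exact: h|exact: ih].
Qed.

Lemma cinteg_real f : integ f -> cinteg (fun t => (f t)%:C).
Proof. by move=> fi; split => //=; exact: integ_cst. Qed.

Lemma cbdd_real f : bdd_meas f -> cbdd (fun t => (f t)%:C).
Proof. by move=> fi; split => //=; exact: bdd_cst. Qed.

Lemma cbdd_sqn F : cbdd F -> bdd_meas (fun t => sqn (F t)).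
Proof.
move=> [rF iF]; have := bddD (bddM rF rF) (bddM iF iF); congr bdd_meas.
Qed.

Lemma cmean_real f : cmean (fun t => (f t)%:C) = (mean f)%:C.
Proof. by congr Complex; exact: mean_cst. Qed.

Lemma cmean_cst (c : C) : cmean (fun=> c) = c.
Proof. by case: c => x y; congr Complex; exact: mean_cst. Qed.

Lemma cmeanD F G : cinteg F -> cinteg G -> cmean (fun t => F t + G t) = cmean F + cmean G.
Proof.
move=> [rF iF] [rG iG]; apply/eqP; rewrite eq_complex /= -!meanD //.
by apply/andP; split; apply/eqP; congr mean; apply/funext => t; case: (F t) (G t) => ? ? [].
Qed.

Lemma cmeanZ (c : C) F : cinteg F -> cmean (fun t => c * F t) = c * cmean F.
Proof.
move=> [rF iF]; case: c => x y; apply/eqP; rewrite eq_complex /= -!meanZ //.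
rewrite -meanB -?meanD; try exact: integZ.
by apply/andP; split; apply/eqP; congr mean; apply/funext => t; case: (F t).
Qed.

Lemma cmean_sum I (r : seq I) (P : pred I) (F : I -> R -> C) :
  (forall i, P i -> cinteg (F i)) ->
  cmean (fun t => \sum_(i <- r | P i) F i t) = \sum_(i <- r | P i) cmean (F i).
Proof.
move=> h; elim: r => [|i r ih].
  by under [X in cmean X]funext do rewrite big_nil; rewrite big_nil; exact: cmean_cst.
under [X in cmean X]funext do rewrite big_cons; rewrite big_cons.
by case: ifP => [Pi|_ //]; rewrite cmeanD ?ih //; [exact: h|exact: cinteg_sum].
Qed.

Definition expik (k : int) (t : R) : C := expi (k%:~R * t).

Lemma expikD k l t : expik (k + l) t = expik k t * expik l t.
Proof.
rewrite /expik /expi rmorphD /= mulrDl cosD sinD; simpc.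
by congr Complex; rewrite addrC.
Qed.

Lemma expik0 t : expik 0 t = 1.
Proof. by rewrite /expik /expi mul0r cos0 sin0. Qed.

Lemma expikJ k t : (expik k t)^* = expik (- k) t.
Proof. by rewrite /expik /expi rmorphN /= mulNr cosN sinN. Qed.

Lemma expikX (n : nat) t : expik n t = expik 1 t ^+ n.
Proof.
elim: n => [|n ih]; first by rewrite expik0 expr0.
by rewrite -addn1 PoszD expikD ih addn1 exprSr.
Qed.

Lemma is_derive_scale (c t : R) : is_derive t 1 ( *%R c) c.
Proof.
have := @is_deriveZ _ _ _ id c t 1 1 (is_derive_id t 1).
by rewrite /GRing.scale /= mulr1.
Qed.

Lemma is_derive_cos_scale (c t : R) :
  is_derive t 1 (fun x => cos (c * x)) (- sin (c * t) * c).
Proof. exact: (is_derive1_comp (is_derive_cos _) (is_derive_scale c t)). Qed.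

Lemma is_derive_sin_scale (c t : R) :
  is_derive t 1 (fun x => sin (c * x)) (cos (c * t) * c).
Proof. exact: (is_derive1_comp (is_derive_sin _) (is_derive_scale c t)). Qed.

Lemma is_derive_continuous (f df : R -> R) :
  (forall t : R, is_derive t 1 f (df t)) -> continuous f.
Proof.
move=> h t; apply: differentiable_continuous.
by apply/derivable1_diffP; case: (h t).
Qed.

Lemma continuous_cos_scale (c : R) : continuous (fun x => cos (c * x)).
Proof. exact: is_derive_continuous (is_derive_cos_scale c). Qed.

Lemma continuous_sin_scale (c : R) : continuous (fun x => sin (c * x)).
Proof. exact: is_derive_continuous (is_derive_sin_scale c). Qed.

Lemma cbdd_expik k : cbdd (expik k).
Proof.
split; apply: (@continuous_bdd _ _ 1) => /= [|t]; rewrite ?cos_max ?sin_max //.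
  exact: continuous_cos_scale.
exact: continuous_sin_scale.
Qed.

Lemma sin_int_pi (k : int) : sin (k%:~R * pi) = 0 :> R.
Proof.
have nat0 (n : nat) : sin (n%:R * pi) = 0 :> R.
  elim: n => [|n ih]; first by rewrite mul0r sin0.
  by rewrite -natr1 mulrDl mul1r sinDpi ih oppr0.
case: (intP k) => [|n|n]; first exact: (nat0 0%N).
  exact: (nat0 n.+1).
by rewrite rmorphN /= mulNr sinN (nat0 n.+1) oppr0.
Qed.

Lemma mean_derive f (F : R -> R) : continuous f -> (forall t : R, is_derive t 1 F (f t)) ->
  mean f = (2 * pi)^-1 * (F pi - F (- pi)).
Proof.
move=> cf dF.
have Fc := is_derive_continuous dF.
rewrite /mean /Rintegral (@continuous_FTC2 _ _ F) //.
- by rewrite (@lt_trans _ _ 0) ?oppr_lt0 ?pi_gt0.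
- by apply: continuous_subspaceT.
- split.
  + by move=> x _; case: (dF x).
  + exact: cvg_at_right_filter (Fc _).
  + exact: cvg_at_left_filter (Fc _).
- by move=> x _; rewrite derive1E; case: (dF x).
Qed.

(** For $k \neq 0$ the real and imaginary parts have antiderivatives $\sin(kt)/k$ and $-\cos(kt)/k$,
    each taking equal values at $\pm\pi$. *)
Lemma cmean_expik k : cmean (expik k) = (k == 0)%:R.
Proof.
have [->|k0] := eqVneq k 0.
  rewrite -[RHS](cmean_cst 1); congr cmean; apply/funext => t; exact: expik0.
have kR0 : k%:~R != 0 :> R by rewrite intr_eq0.
have dF1 (t : R) : is_derive t 1 (fun t => k%:~R^-1 * sin (k%:~R * t)) (cos (k%:~R * t)).
  have := @is_deriveZ _ _ _ _ k%:~R^-1 t 1 _ (is_derive_sin_scale k%:~R t).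
  by rewrite /GRing.scale /= mulrCA mulVf // mulr1.
have dF2 (t : R) : is_derive t 1 (fun t => - k%:~R^-1 * cos (k%:~R * t)) (sin (k%:~R * t)).
  have := @is_deriveZ _ _ _ _ (- k%:~R^-1) t 1 _ (is_derive_cos_scale k%:~R t).
  by rewrite /GRing.scale /= mulNr mulNr mulrN opprK mulrCA mulVf // mulr1.
apply/eqP; rewrite eq_complex /=.
have -> := mean_derive (@continuous_cos_scale k%:~R) dF1.
have -> := mean_derive (@continuous_sin_scale k%:~R) dF2.
by rewrite !mulrN cosN sinN mulrN opprK sin_int_pi !mulr0 addr0 subrr mulr0 eqxx.
Qed.

End ComplexMean.

(** * Fejer means *)

Section FejerKernel.
Context {R : realType}.
Local Notation C := R[i].
Local Notation T := (`[- pi, pi]%classic : set R).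
Local Notation mu := (@lebesgue_measure R).
Implicit Types (f g : R -> R).

Definition fcoef f (k : int) : C := cmean (fun t => (f t)%:C * expik (- k) t).

(* A finite sum of products of a function of t and a function of s: exchanging
   the integrals over t and s needs no Fubini theorem. *)
Definition fejer (M : nat) (t s : R) : R :=
  M%:R^-1 * sqn (\sum_(j < M) expik (j : nat) t * expik (- (j : nat)%:Z) s).

Definition fejer_mean (M : nat) f (t : R) : R := mean (fun s => f s * fejer M t s).

Lemma fejer_ge0 M t s : 0 <= fejer M t s.
Proof. by rewrite mulr_ge0 ?invr_ge0 ?sqn_ge0. Qed.

Lemma fejerE M t s : (fejer M t s)%:C = M%:R^-1 * \sum_(j < M) \sum_(l < M)
  expik ((j : nat)%:Z - (l : nat)%:Z) t * expik ((l : nat)%:Z - (j : nat)%:Z) s.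
Proof.
rewrite /fejer rmorphM /= fmorphV rmorph_nat; congr (_ * _).
rewrite -sqnE conjc_sum mulr_suml; apply: eq_bigr => j _.
rewrite mulr_sumr; apply: eq_bigr => l _.
rewrite conjcM !expikJ opprK !expikD; ring.
Qed.

Lemma bdd_fejer M t : bdd_meas (fejer M t).
Proof.
apply: bddZ; apply: cbdd_sqn; apply: cbdd_sum => j _; apply: cbddM.
  exact: cbdd_cst.
exact: cbdd_expik.
Qed.

Lemma cinteg_expik f k : integ f -> cinteg (fun t => (f t)%:C * expik k t).
Proof. by move=> fi; apply: cintegM; [exact: cinteg_real|exact: cbdd_expik]. Qed.

Lemma fejer_meanE M f t : integ f -> (fejer_mean M f t)%:C =
  M%:R^-1 * \sum_(j < M) \sum_(l < M) fcoef f ((j : nat)%:Z - (l : nat)%:Z) *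
    expik ((j : nat)%:Z - (l : nat)%:Z) t.
Proof.
move=> fi; rewrite /fejer_mean -cmean_real.
have -> : (fun s => (f s * fejer M t s)%:C) = (fun s => M%:R^-1 *
   \sum_(j < M) \sum_(l < M) expik ((j : nat)%:Z - (l : nat)%:Z) t *
     ((f s)%:C * expik (- ((j : nat)%:Z - (l : nat)%:Z)) s)).
  apply/funext => s; rewrite rmorphM /= fejerE mulrCA; congr (_ * _).
  rewrite mulr_sumr; apply: eq_bigr => j _; rewrite mulr_sumr; apply: eq_bigr => l _.
  by rewrite opprB mulrCA.
have ci j l : cinteg (fun s => expik (j - l) t * ((f s)%:C * expik (- (j - l)) s)).
  by apply: cintegZ; exact: cinteg_expik.
rewrite cmeanZ; last by apply: cinteg_sum => j _; apply: cinteg_sum => l _.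
congr (_ * _); rewrite cmean_sum => [|j _]; last by apply: cinteg_sum => l _.
apply: eq_bigr => j _; rewrite cmean_sum //.
by apply: eq_bigr => l _; rewrite cmeanZ; [rewrite mulrC|exact: cinteg_expik].
Qed.

Lemma bdd_fejer_mean M f : integ f -> bdd_meas (fejer_mean M f).
Proof.
move=> fi.
suff [+ _] : cbdd (fun t => (fejer_mean M f t)%:C) by [].
under [X in cbdd X]funext do rewrite fejer_meanE //.
apply: cbddM; first exact: cbdd_cst.
apply: cbdd_sum => j _; apply: cbdd_sum => l _.
by apply: cbddM; [exact: cbdd_cst|exact: cbdd_expik].
Qed.

Lemma mean_fejer_meanE M f g : integ f -> integ g ->
  (mean (fun t => f t * fejer_mean M g t))%:C = M%:R^-1 *
    \sum_(j < M) \sum_(l < M) fcoef g ((j : nat)%:Z - (l : nat)%:Z) *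
      fcoef f ((l : nat)%:Z - (j : nat)%:Z).
Proof.
move=> fi gi; rewrite -cmean_real.
have -> : (fun s => (f s * fejer_mean M g s)%:C) = (fun s => M%:R^-1 *
   \sum_(j < M) \sum_(l < M) fcoef g ((j : nat)%:Z - (l : nat)%:Z) *
     ((f s)%:C * expik (- ((l : nat)%:Z - (j : nat)%:Z)) s)).
  apply/funext => s; rewrite rmorphM /= fejer_meanE // mulrCA; congr (_ * _).
  rewrite mulr_sumr; apply: eq_bigr => j _; rewrite mulr_sumr; apply: eq_bigr => l _.
  by rewrite opprB mulrCA.
have ci j l : cinteg (fun s => fcoef g (j - l) * ((f s)%:C * expik (- (l - j)) s)).
  by apply: cintegZ; exact: cinteg_expik.
rewrite cmeanZ; last by apply: cinteg_sum => j _; apply: cinteg_sum => l _.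
congr (_ * _); rewrite cmean_sum => [|j _]; last by apply: cinteg_sum => l _.
apply: eq_bigr => j _; rewrite cmean_sum //.
by apply: eq_bigr => l _; rewrite cmeanZ; [|exact: cinteg_expik].
Qed.

(** The Fejer operator is self-adjoint: the double sum for one side becomes that for the other on
    exchanging [j] and [l]. This lets a Fejer mean be moved from a merely integrable factor to a
    bounded one. *)
Lemma mean_fejer_meanC M f g : integ f -> integ g ->
  mean (fun t => f t * fejer_mean M g t) = mean (fun t => g t * fejer_mean M f t).
Proof.
move=> fi gi; apply: complexI.
transitivity (M%:R^-1 * \sum_(j < M) \sum_(l < M) fcoef g ((j : nat)%:Z - (l : nat)%:Z) *
      fcoef f ((l : nat)%:Z - (j : nat)%:Z)); first exact: mean_fejer_meanE.
apply: etrans (esym (mean_fejer_meanE M gi fi)); congr (_ * _).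
by rewrite exchange_big; apply: eq_bigr => j _; apply: eq_bigr => l _; rewrite mulrC.
Qed.

Lemma cmean_fejer_expik M k t : cmean (fun s => (fejer M t s)%:C * expik k s) =
  M%:R^-1 * \sum_(j < M) \sum_(l < M)
   expik ((j : nat)%:Z - (l : nat)%:Z) t * ((l : nat)%:Z - (j : nat)%:Z + k == 0)%:R.
Proof.
have -> : (fun s => (fejer M t s)%:C * expik k s) = (fun s => M%:R^-1 *
   \sum_(j < M) \sum_(l < M) expik ((j : nat)%:Z - (l : nat)%:Z) t *
     (expik ((l : nat)%:Z - (j : nat)%:Z + k) s)).
  apply/funext => s; rewrite fejerE -mulrA; congr (_ * _).
  rewrite mulr_suml; apply: eq_bigr => j _; rewrite mulr_suml; apply: eq_bigr => l _.
  by rewrite (expikD _ k) mulrA.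
have ci j l : cinteg (fun s => expik (j - l) t * expik (l - j + k) s).
  by apply: cintegZ; apply: cbdd_cinteg; exact: cbdd_expik.
rewrite cmeanZ; last by apply: cinteg_sum => j _; apply: cinteg_sum => l _.
congr (_ * _); rewrite cmean_sum => [|j _]; last by apply: cinteg_sum => l _.
apply: eq_bigr => j _; rewrite cmean_sum //.
apply: eq_bigr => l _; rewrite cmeanZ ?cmean_expik //.
by apply: cbdd_cinteg; exact: cbdd_expik.
Qed.

Lemma mean_fejer M t : (0 < M)%N -> mean (fejer M t) = 1.
Proof.
move=> M0; apply: complexI; rewrite -cmean_real.
have M0' : M%:R != 0 :> C by rewrite pnatr_eq0 -lt0n.
transitivity (cmean (fun s => (fejer M t s)%:C * expik 0 s)).
  by congr cmean; apply/funext => s; rewrite expik0 mulr1.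
rewrite cmean_fejer_expik (eq_bigr (fun=> 1)) => [|j _].
  by rewrite sumr_const card_ord mulVf.
rewrite (bigD1 j) //= subrr addr0 eqxx expik0 mulr1 big1 ?addr0 // => l lj.
by rewrite addr0 subr_eq0 eqz_nat -val_eqE in lj *; rewrite (negbTE lj) mulr0.
Qed.

(** The quantity $1-\cos(t-s)$ measures the distance of $s$ and $t$ on the circle, so this exact
    value expresses the concentration of the kernel near the diagonal and replaces pointwise bounds
    on it. *)
Lemma mean_fejer_cos M t : mean (fun s => fejer M.+1 t s * (1 - cos (t - s))) = M.+1%:R^-1.
Proof.
have H : cmean (fun s => (fejer M.+1 t s)%:C * expik (-1) s) =
   (1 - M.+1%:R^-1)%:C * expik (-1) t.
  rewrite cmean_fejer_expik.
  (* For given [j] only [l = j + 1] contributes, and it is in range unless [j = M]; hence [M] of the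
     [M + 1] rows survive. *)
  rewrite (eq_bigr (fun j : 'I_M.+1 => (j < M)%:R * expik (-1) t)) => [|j _].
    rewrite -mulr_suml mulrA; congr (_ * _).
    rewrite big_ord_recr /= ltnn addr0 (eq_bigr (fun=> 1)) => [|j _]; last by rewrite ltn_ord.
    rewrite sumr_const card_ord rmorphB rmorph1 fmorphV rmorph_nat.
    have n0 : M.+1%:R != 0 :> C by rewrite pnatr_eq0.
    by apply: (mulfI n0); rewrite mulrA divff // mulrBr divff // mul1r mulr1 -natr1 addrK.
  have [jM|jM] := ltnP j M.
    have jM1 : (j.+1 < M.+1)%N by [].
    rewrite (bigD1 (Ordinal jM1)) //= big1 ?addr0 => [|l].
      have -> : (j.+1%:Z - j%:Z + -1 == 0) by rewrite intS; apply/eqP; ring.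
      by rewrite mulr1 mul1r; congr expik; rewrite intS; ring.
    rewrite -val_eqE /= => lj; rewrite [_ == 0](_ : _ = false) ?mulr0 //.
    by apply/negbTE; apply: contra lj => /eqP; lia.
  rewrite mul0r big1 // => l _; rewrite [_ == 0](_ : _ = false) ?mulr0 //.
  by apply/negbTE/eqP; have := ltn_ord l; lia.
have -> : (fun s => fejer M.+1 t s * (1 - cos (t - s))) = (fun s => fejer M.+1 t s -
    complex.Re (expik 1 t * ((fejer M.+1 t s)%:C * expik (-1) s))).
  apply/funext => s; rewrite /expik /expi /= cosB !mul1r mulN1r cosN sinN; ring.
have ci : cinteg (fun s => (fejer M.+1 t s)%:C * expik (- 1) s).
  by apply: cbdd_cinteg; apply: cbddM; [exact/cbdd_real/bdd_fejer|exact: cbdd_expik].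
rewrite meanB; first last.
- by case: (cintegZ (expik 1 t) ci).
- exact/bdd_integ/bdd_fejer.
rewrite mean_fejer //.
have -> : mean (fun s => complex.Re (expik 1 t * ((fejer M.+1 t s)%:C * expik (-1) s))) =
  complex.Re (cmean (fun s => expik 1 t * ((fejer M.+1 t s)%:C * expik (-1) s))) by [].
rewrite cmeanZ // H mulrCA -expikD subrr expik0 mulr1 /=; ring.
Qed.

Lemma fejer_mean_cst M c t : (0 < M)%N -> fejer_mean M (fun=> c) t = c.
Proof.
move=> M0; rewrite /fejer_mean meanZ ?mean_fejer ?mulr1 //.
exact/bdd_integ/bdd_fejer.
Qed.

Lemma integ_fejer M f t : integ f -> integ (fun s => f s * fejer M t s).
Proof. by move=> fi; apply: integM => //; exact: bdd_fejer. Qed.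

Lemma normr_fejer_mean M f t B : (0 < M)%N -> integ f -> (forall s, `|f s| <= B) ->
  `|fejer_mean M f t| <= B.
Proof.
move=> M0 fi fB; apply: (le_trans (normr_mean (integ_fejer _ _ fi))).
rewrite -[leRHS](fejer_mean_cst B t M0); apply: ler_mean.
- exact/integ_abs/integ_fejer.
- exact/integ_fejer/integ_cst.
by move=> s _; rewrite normrM (ger0_norm (fejer_ge0 _ _ _)) ler_wpM2r ?fejer_ge0.
Qed.

(* Jensen's inequality for the probability density [fejer M t]: integrate
   e^x >= e^c (1 + x - c) with c = fejer_mean M f t. *)
Lemma expR_fejer_mean_le M f g t : (0 < M)%N -> integ f -> integ g ->
  {ae mu, forall s, T s -> expR (f s) <= g s} ->
  expR (fejer_mean M f t) <= fejer_mean M g t.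
Proof.
move=> M0 fi gi fg; set c := fejer_mean M f t.
have bf := bdd_integ (bdd_fejer M t).
suff <- : mean (fun s => (expR c * (1 - c) + expR c * f s) * fejer M t s) = expR c.
  apply: ae_ler_mean; [|exact: integ_fejer|].
    apply: integ_fejer; apply: integD; [exact: integ_cst|exact: integZ].
  move: fg; apply: ae_imp => s h Ts; rewrite ler_wpM2r ?fejer_ge0 //.
  apply: le_trans (h Ts); rewrite -mulrDr -[f s in leRHS](subrK c) expRD mulrC.
  rewrite ler_wpM2r ?expR_ge0 //; apply: le_trans (expR_ge1Dx _); lra.
under [X in mean X]funext do rewrite mulrDl -mulrA -mulrA.
rewrite meanD; first last.
- by apply: integZ; exact: integ_fejer.
- by apply: integZ; apply: integZ.
rewrite (meanZ _ (integZ (1 - c) bf)) (meanZ _ bf) (meanZ _ (integ_fejer M t fi)).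
rewrite mean_fejer // -[mean _]/c; ring.
Qed.

End FejerKernel.

(** * Convergence of Fejer means against integrable functions *)

Section FejerDensity.
Context {R : realType}.
Local Notation T := (`[- pi, pi]%classic : set R).
Local Notation mu := (@lebesgue_measure R).
Implicit Types (f g : R -> R).

Lemma mean_dominated (u : nat -> R -> R) g :
  (forall n, measurable_fun T (u n)) -> integ g ->
  {ae mu, forall t, T t -> u n t @[n --> \oo] --> (0 : R)} ->
  (forall n t, T t -> `|u n t| <= g t) ->
  mean (fun t => `|u n t|) @[n --> \oo] --> (0 : R).
Proof.
move=> mu_ gi u0 ug.
have [] := @dominated_convergence _ _ _ mu T measurable_circle
  (fun n t => (u n t)%:E) (cst 0%E) (fun t => (g t)%:E).
- by move=> n; apply/measurable_EFinP; exact: mu_.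
- exact: measurable_cst.
- move: u0; apply: ae_imp => t h /h ut0.
  by apply: cvg_EFin => //; near=> n.
- exact: gi.
- by apply: aeW => t n Tt /=; rewrite lee_fin; exact: ug.
move=> _ + _ => /fine_cvg h.
rewrite -(mulr0 (2 * pi)^-1); apply: cvgM; first exact: cvg_cst.
apply: cvg_trans h; apply: near_eq_cvg; near=> n => /=.
by congr fine; apply: eq_integral => t _; rewrite subr0.
Unshelve. all: by end_near. Qed.

Lemma ae_not2 (P : R -> Prop) a b : (forall t, t != a -> t != b -> P t) ->
  {ae mu, forall t, P t}.
Proof.
move=> h; exists [set a; b]; split.
- exact: measurableU.
- exact/countable_lebesgue_measure0/finite_set_countable/finite_set2.
- move=> t /= nP; apply: contrapT => /not_orP[/eqP ta /eqP tb].
  by apply: nP; exact: h.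
Qed.

Lemma circle_itv t : T t = (- pi <= t <= pi) :> Prop.
Proof. by rewrite /= in_itv. Qed.

Lemma cos_gtN1 (t : R) : - pi < t < pi -> -1 < cos t.
Proof.
move=> /andP[t1 t2]; rewrite lt_neqAle cos_geN1 andbT eq_sym; apply/eqP => ct.
have : cos (t / 2) = 0.
  have tE : (t / 2) *+ 2 = t by rewrite -mulr_natr mulfVK // pnatr_eq0.
  have := cos_mulr2n (t / 2); rewrite tE ct -mulr_natr => h.
  by apply/eqP; rewrite -sqrf_eq0; apply/eqP; lra.
by apply/eqP; rewrite gt_eqF // cos_gt0_pihalf //; apply/andP; split; lra.
Qed.

Lemma cos_eq1 (t : R) : - (2 * pi) <= t <= 2 * pi -> cos t = 1 ->
  [\/ t = 0, t = 2 * pi | t = - (2 * pi)].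
Proof.
move=> /andP[t1 t2] ct.
have st : sin (t / 2) = 0.
  have tE : (t / 2) *+ 2 = t by rewrite -mulr_natr mulfVK // pnatr_eq0.
  have := cos_mulr2n (t / 2); rewrite tE ct -mulr_natr => h.
  have := cos2Dsin2 (t / 2); move=> h2.
  by apply/eqP; rewrite -sqrf_eq0; apply/eqP; lra.
have [t0|t0|->] := ltgtP t 0; last by constructor 1.
  have [->|tp] := eqVneq t (- (2 * pi)); first by constructor 3.
  have : 0 < sin (- (t / 2)).
    have : - (2 * pi) < t by rewrite lt_neqAle eq_sym tp.
    by move=> ?; apply: sin_gt0_pi; apply/andP; split; lra.
  by rewrite sinN st oppr0 ltxx.
have [->|tp] := eqVneq t (2 * pi); first by constructor 2.
have : 0 < sin (t / 2).
  have : t < 2 * pi by rewrite lt_neqAle tp.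
  by move=> ?; apply: sin_gt0_pi; apply/andP; split; lra.
by rewrite st ltxx.
Qed.

(* 1 - ((1 - cos t) / 2)^n is a continuous cutoff vanishing at the endpoints. *)
Lemma integ_periodic_approx f (e : R) : integ f -> 0 < e ->
  exists g : R -> R, [/\ continuous g, g pi = 0, g (- pi) = 0 &
    mean (fun t => `|f t - g t|) <= e].
Proof.
move=> fi e0.
have Tfin : (mu T < +oo)%E by rewrite [X in (X < _)%E]lebesgue_circle ltry.
have [h_ [ch hi /fine_cvg hf]] := approximation_continuous_integrable measurable_circle Tfin fi.
have [h [{}ch {}hi {}hf]] : exists h, [/\ continuous h, integ h &
    mean (fun t => `|f t - h t|) <= e / 2].
  have e2 : 0 < e / 2 * (2 * pi) by rewrite mulr_gt0 ?pi2_gt0 // divr_gt0.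
  have /cvgrPdist_lt/(_ _ e2) [N _ /(_ N (leqnn N))] := hf.
  rewrite /= sub0r normrN => hN; exists (h_ N); split => //; first exact: hi.
  rewrite /mean mulrC ler_pdivrMr ?pi2_gt0 // ltW //.
  by apply: le_lt_trans hN; exact: ler_norm.
(* On the circle interval [q] lies in $[0,1]$ and equals 1 only at $\pm\pi$, so $h q^n$ tends to 0
   almost everywhere, dominated by $|h|$. *)
pose q (t : R) : R := (1 - cos t) / 2.
have q0 t : 0 <= q t by rewrite divr_ge0 // subr_ge0 cos_le1.
have q1 t : q t <= 1 by rewrite ler_pdivrMr // mul1r; have := cos_geN1 t; lra.
have cq : continuous q.
  move=> t; apply: cvgM; last exact: cvg_cst.
  by apply: cvgB; [exact: cvg_cst|exact: continuous_cos].
have cqn n : continuous (fun t => q t ^+ n).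
  move=> t; elim: n => [|n ih].
    by under [X in continuous_at _ X]funext do rewrite expr0; exact: cvg_cst.
  under [X in continuous_at _ X]funext do rewrite exprS.
  by apply: cvgM; [exact: cq|exact: ih].
have chq n : continuous (fun t => h t * q t ^+ n).
  by move=> t; apply: cvgM; [exact: ch|exact: cqn].
have lim0 : mean (fun t => `|h t * q t ^+ n|) @[n --> \oo] --> (0 : R).
  apply: (@mean_dominated (fun n t => h t * q t ^+ n) (fun t => `|h t|)).
  - by move=> n; apply: measurable_funTS; apply: continuous_measurable_fun.
  - exact: integ_abs.
  - apply: (@ae_not2 _ pi (- pi)) => t tp tn; rewrite circle_itv => /andP[t1 t2].
    have t1' : - pi < t by rewrite lt_neqAle eq_sym tn.
    have t2' : t < pi by rewrite lt_neqAle tp.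
    rewrite -(mulr0 (h t)); apply: cvgM; first exact: cvg_cst.
    apply: cvg_expr; rewrite ger0_norm // ltr_pdivrMr // mul1r.
    suff : -1 < cos t by lra.
    by apply: cos_gtN1; rewrite t1' t2'.
  - move=> n t _; rewrite normrM ler_piMr // ger0_norm ?exprn_ge0 //.
    by rewrite exprn_ile1.
have e2 : 0 < e / 2 by rewrite divr_gt0.
have /cvgrPdist_lt/(_ _ e2) [N _ /(_ N.+1 (leqnSn N))] := lim0.
rewrite /= sub0r normrN => hN.
exists (fun t => h t * (1 - q t ^+ N.+1)); split.
- move=> t; apply: cvgM; first exact: ch.
  by apply: cvgB; [exact: cvg_cst|exact: cqn].
- by rewrite /q cospi opprK -[1 + 1]/(2%:R) divff // expr1n subrr mulr0.
- by rewrite /q cosN cospi opprK -[1 + 1]/(2%:R) divff // expr1n subrr mulr0.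
have hqi : integ (fun t => h t * q t ^+ N.+1).
  apply: integM => //; apply: (@continuous_bdd _ _ 1) => // t.
  by rewrite ger0_norm ?exprn_ge0 // exprn_ile1.
have fhi := integ_abs (integB fi hi).
apply: (@le_trans _ _ (mean (fun t => `|f t - h t| + `|h t * q t ^+ N.+1|))).
  apply: ler_mean.
  - apply: integ_abs; apply: integB => //; have := integB hi hqi.
    by congr integ; apply/funext => t; ring.
  - by apply: integD => //; exact: integ_abs.
  move=> t _; have -> : f t - h t * (1 - q t ^+ N.+1) = f t - h t + h t * q t ^+ N.+1 by ring.
  exact: ler_normD.
rewrite meanD //; last exact: integ_abs.
rewrite (splitr e) lerD // ltW //; apply: le_lt_trans hN; exact: ler_norm.
Qed.

(** Uniform continuity on the circle, in a form that can be integrated against the Fejer kernel by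
    [mean_fejer_cos]. By compactness of the square it suffices to find [K] near each pair of points,
    and there the only delicate case is $\cos(t-s) = 1$. *)
Lemma continuous_periodic_modulus g (e : R) : continuous g -> g pi = 0 -> g (- pi) = 0 ->
  0 < e -> exists2 K, 0 <= K & forall s t, T s -> T t ->
    `|g s - g t| <= e + K * (1 - cos (t - s)).
Proof.
move=> cg gp gn e0.
have cK : compact (T `*` T) by apply: compact_setX; exact: segment_compact.
move/compact_near_coveringP: cK => /(_ R (pinfty_nbhs R) (fun K (p : R * R) =>
   `|g p.1 - g p.2| <= e + K * (1 - cos (p.2 - p.1)))) [].
  move=> [s t] [/= Ts Tt].
  have cfst : (fun p : R * R => g p.1) p @[p --> (s, t)] --> g s.
    by apply: (cvg_comp (fun p : R * R => p.1) g _ (cg s)); exact: cvg_fst.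
  have csnd : (fun p : R * R => g p.2) p @[p --> (s, t)] --> g t.
    by apply: (cvg_comp (fun p : R * R => p.2) g _ (cg t)); exact: cvg_snd.
  have cgd : (fun p : R * R => g p.1 - g p.2) p @[p --> (s, t)] --> g s - g t.
    exact: cvgB.
  have ccd : (fun p : R * R => 1 - cos (p.2 - p.1)) p @[p --> (s, t)] --> 1 - cos (t - s).
    apply: cvgB; first exact: cvg_cst.
    apply: (cvg_comp (fun p : R * R => p.2 - p.1) cos _ (@continuous_cos R (t - s))).
    by apply: cvgB; [exact: cvg_snd|exact: cvg_fst].
  have [c1|c1] := eqVneq (cos (t - s)) 1.
    (* Either the points coincide or they are opposite endpoints, and [g] vanishes at both
       endpoints. *)
    have gst : g s = g t.
      move: Ts Tt; rewrite !in_itv /= => /andP[s1 s2] /andP[t1 t2].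
      have [|h|h|h] := @cos_eq1 (t - s) _ c1.
      - by apply/andP; split; lra.
      - by have -> : t = s; [lra|].
      - by have -> : t = pi; [lra|]; have -> : s = - pi; [lra|]; rewrite gp gn.
      - by have -> : t = - pi; [lra|]; have -> : s = pi; [lra|]; rewrite gp gn.
    move: cgd; rewrite gst subrr => /cvgrPdist_lt/(_ _ e0) cgd.
    exists ([set p : R * R | `|g p.1 - g p.2| < e], [set K : R | 0 <= K]) => /=.
      split; last exact: nbhs_pinfty_ge.
      by apply: filterS cgd => p /=; rewrite sub0r normrN.
    move=> [[s' t'] K] [/= h1 h2]; apply: (le_trans (ltW h1)).
    by rewrite lerDl mulr_ge0 // subr_ge0 cos_le1.
  have c0 : 0 < 1 - cos (t - s) by rewrite subr_gt0 lt_neqAle c1 cos_le1.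
  set c := 1 - cos (t - s) in c0 ccd *.
  (* Near this pair the difference of values of [g] is at most [B] while $1-\cos$ stays above
     [c / 2], so every [K] beyond [B / (c / 2)] suffices. *)
  pose B := `|g s - g t| + 1.
  have B0 : 0 < B by rewrite ltr_pwDr.
  exists ([set p : R * R | `|g p.1 - g p.2| <= B /\ c / 2 <= 1 - cos (p.2 - p.1)],
          [set K : R | B / (c / 2) <= K]) => /=.
    split; last by apply: nbhs_pinfty_ge; exact: num_real.
    have /cvgrPdist_lt/(_ _ ltr01) n1 := cgd.
    have c20 : 0 < c / 2 by rewrite divr_gt0.
    have /cvgrPdist_lt/(_ _ c20) n2 := ccd.
    near=> p; split.
      have : `|g s - g t - (g p.1 - g p.2)| < 1 by near: p; exact: n1.
      rewrite /B distrC => h; rewrite -lerBlDl ltW //; apply: le_lt_trans h.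
      exact: lerB_dist.
    have : `|c - (1 - cos (p.2 - p.1))| < c / 2 by near: p; exact: n2.
    by rewrite ltr_norml => /andP[_]; lra.
  move=> [[s' t'] K] [/= [h1 h2] h3]; apply: (le_trans h1).
  have c20 : 0 < c / 2 by rewrite divr_gt0.
  have K0 : 0 <= K by apply: le_trans h3; rewrite divr_ge0 // ltW.
  apply: (@le_trans _ _ (K * (c / 2))); first by rewrite -ler_pdivrMr.
  by apply: (le_trans (ler_wpM2l K0 h2)); rewrite lerDr ltW.
move=> K0 [_ h].
exists (Num.max K0 0 + 1); first by rewrite addr_ge0 // le_max lexx orbT.
move=> s t Ts Tt; apply: (h (Num.max K0 0 + 1) _ (s, t)) => //.
by rewrite ltr_pwDr // le_max lexx.
Unshelve. all: by end_near. Qed.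

Lemma fejer_mean_dist g (e K : R) M t : (forall s, T s -> `|g s - g t| <= e + K * (1 - cos (t - s))) ->
  integ g -> `|fejer_mean M.+1 g t - g t| <= e + K * M.+1%:R^-1.
Proof.
move=> h gi.
have bf := bdd_integ (bdd_fejer M.+1 t).
have cb : bdd_meas (fun s : R => 1 - cos (t - s)).
  apply: (@continuous_bdd _ _ 2) => s.
    apply: cvgB; first exact: cvg_cst.
    apply: (cvg_comp (fun s : R => t - s) cos _ (@continuous_cos R (t - s))).
    by apply: cvgB; [exact: cvg_cst|exact: cvg_id].
  by rewrite ler_norml; have := cos_le1 (t - s); have := cos_geN1 (t - s) => ? ?; apply/andP; split; lra.
have -> : fejer_mean M.+1 g t - g t = mean (fun s => (g s - g t) * fejer M.+1 t s).
  have -> : (fun s => (g s - g t) * fejer M.+1 t s) = (fun s => g s * fejer M.+1 t s - g t * fejer M.+1 t s).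
    by apply/funext => s; rewrite mulrBl.
  rewrite meanB; [|exact: integ_fejer|exact: integZ].
  by rewrite (meanZ _ bf) mean_fejer // mulr1.
have di : integ (fun s => (g s - g t) * fejer M.+1 t s).
  by apply: integ_fejer; apply: integB => //; exact: integ_cst.
apply: (le_trans (normr_mean di)).
have fci : integ (fun s => fejer M.+1 t s * (1 - cos (t - s))) by exact: integM.
have -> : e + K * M.+1%:R^-1 = mean (fun s => e * fejer M.+1 t s + K * (fejer M.+1 t s * (1 - cos (t - s)))).
  rewrite meanD; [|exact: integZ|exact: integZ].
  by rewrite (meanZ _ bf) (meanZ _ fci) mean_fejer // mulr1 mean_fejer_cos.
apply: ler_mean; [exact: integ_abs|by apply: integD; exact: integZ|].
move=> s Ts; rewrite normrM (ger0_norm (fejer_ge0 _ _ _)).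
apply: (le_trans (ler_wpM2r (fejer_ge0 _ _ _) (h s Ts))).
by rewrite le_eqVlt; apply/orP; left; apply/eqP; ring.
Qed.

(** The approximation is applied to [f] and not to [g]: [f] is replaced by a continuous periodic
    [h], at a cost controlled by the bound on [g]. For [h] the Fejer mean is moved over by symmetry,
    and the Fejer means of [h] converge uniformly. *)
Lemma cvg_mean_fejer_mean f g : integ f -> bdd_meas g ->
  mean (fun t => f t * fejer_mean M.+1 g t) @[M --> \oo] --> mean (fun t => f t * g t).
Proof.
move=> fi gb; have [mg [B gB]] := gb.
have gi := bdd_integ gb.
have B0 : 0 <= B by apply: le_trans (gB 0).
apply/cvgrPdist_le => e e0.
(* The three errors below add up to at most [4 * B * d]. *)
pose d := e / (4 * (B + 1)).
have B1 : 0 < B + 1 by rewrite ltr_wpDl.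
have d0 : 0 < d by rewrite divr_gt0 // mulr_gt0.
have [h [ch hp hn fh]] := integ_periodic_approx fi d0.
have hi : integ h.
  apply: continuous_compact_integrable; first exact: segment_compact.
  exact: continuous_subspaceT.
have [K K0 hK] := continuous_periodic_modulus ch hp hn d0.
near=> M.
have KM : K * M.+1%:R^-1 <= d.
  have : `|0 - M.+1%:R^-1| < d / (K + 1) :> R.
    near: M; have := @cvg_harmonic R; move/cvgrPdist_lt; apply.
    by rewrite divr_gt0 // ltr_wpDl.
  rewrite sub0r normrN ger0_norm ?invr_ge0 // ltr_pdivlMr ?ltr_wpDl // => hM.
  by apply: le_trans (ltW hM); rewrite mulrC ler_wpM2l ?invr_ge0 // lerDl.
have fhi := integB fi hi.
have bm := bdd_fejer_mean M.+1 gi.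
have bmh := bdd_integ (bdd_fejer_mean M.+1 hi).
have hmhi := integB bmh hi.
have -> : mean (fun t => f t * g t) - mean (fun t => f t * fejer_mean M.+1 g t) =
   mean (fun t => (f t - h t) * g t) - mean (fun t => (f t - h t) * fejer_mean M.+1 g t)
   - mean (fun t => (fejer_mean M.+1 h t - h t) * g t).
  have mB u v w : integ u -> integ v -> bdd_meas w ->
      mean (fun t => (u t - v t) * w t) = mean (fun t => u t * w t) - mean (fun t => v t * w t).
    move=> ui vi wb; rewrite -meanB; [|exact: integM|exact: integM].
    by congr mean; apply/funext => t; rewrite mulrBl.
  rewrite !mB //.
  have -> : mean (fun t => fejer_mean M.+1 h t * g t) = mean (fun t => h t * fejer_mean M.+1 g t).
    rewrite (mean_fejer_meanC M.+1 hi gi); congr mean; apply/funext => t; exact: mulrC.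
  ring.
have mb u w b c : integ u -> bdd_meas w -> (forall t, `|w t| <= b) -> 0 <= b ->
    mean (fun t => `|u t|) <= c -> `|mean (fun t => u t * w t)| <= b * c.
  move=> ui wb wB b0 uc; have uwi := integM ui wb.
  apply: (le_trans (normr_mean uwi)); apply: le_trans (ler_wpM2l b0 uc).
  rewrite -meanZ; last exact: integ_abs.
  apply: ler_mean; [exact: integ_abs|by apply: integZ; exact: integ_abs|].
  by move=> t _; rewrite normrM mulrC ler_wpM2r.
have n1 : `|mean (fun t => (f t - h t) * g t)| <= B * d by exact: mb.
have n2 : `|mean (fun t => (f t - h t) * fejer_mean M.+1 g t)| <= B * d.
  by apply: mb => // t; exact: normr_fejer_mean.
have n3 : `|mean (fun t => (fejer_mean M.+1 h t - h t) * g t)| <= B * (d + d).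
  apply: mb => //; rewrite -[leRHS]mean_cst; apply: ler_mean; [exact: integ_abs|exact: integ_cst|].
  move=> t Tt; apply: (@le_trans _ _ (d + K * M.+1%:R^-1)); last by rewrite lerD2l.
  by apply: fejer_mean_dist => // s Ts; exact: hK.
apply: (le_trans (ler_normB _ _)); apply: (le_trans (lerD (ler_normB _ _) (lexx _))).
apply: (le_trans (lerD (lerD n1 n2) n3)).
have -> : B * d + B * d + B * (d + d) = B * (4 * d) by ring.
have -> : 4 * d = e / (B + 1) by rewrite /d; field; rewrite gt_eqF.
by rewrite mulrA ler_pdivrMr // mulrC ler_wpM2l ?ltW // ltrDl.
Unshelve. all: by end_near. Qed.

End FejerDensity.

(** * Szego's extremal problem *)

Section Szego.
Context {R : realType}.
Local Notation C := R[i].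
Local Notation T := (`[- pi, pi]%classic : set R).
Local Notation mu := (@lebesgue_measure R).
Implicit Types (f g w : R -> R).

Lemma sqn_normc (z : C) : sqn z = Normc.normc z ^+ 2.
Proof. by case: z => x y; rewrite /sqn /= sqr_sqrtr // addr_ge0 // sqr_ge0. Qed.

Lemma normc_le (z : C) : Normc.normc z <= `|complex.Re z| + `|complex.Im z|.
Proof. by rewrite -lecR; have := normC_le z; rewrite normc_def; case: z. Qed.

Lemma normc_sum I (r : seq I) (P : pred I) (F : I -> C) :
  Normc.normc (\sum_(i <- r | P i) F i) <= \sum_(i <- r | P i) Normc.normc (F i).
Proof.
elim/big_ind2: _ => [|z x w y zx wy|i _]; rewrite ?Normc.normc0 //.
by apply: (le_trans (le_normcD _ _)); exact: lerD.
Qed.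

Lemma fcoef0 f : fcoef f 0 = (mean f)%:C.
Proof.
rewrite -cmean_real; congr cmean; apply/funext => t.
by rewrite oppr0 expik0 mulr1.
Qed.

Lemma fcoefJ f k : integ f -> (fcoef f k)^* = fcoef f (- k).
Proof.
move=> fi; have [_ ii] := cinteg_expik (- k) fi.
rewrite /fcoef /cmean; apply/eqP; rewrite eq_complex /= -meanN //.
apply/andP; split; apply/eqP; congr mean; apply/funext => t.
  by rewrite !mul0r !mulrNz !mulNr opprK cosN.
by rewrite !mul0r !addr0 !mulrNz !mulNr opprK sinN mulrN opprK.
Qed.

Lemma normc_fcoef f k : integ f -> Normc.normc (fcoef f k) <= 2 * mean (fun t => `|f t|).
Proof.
move=> fi; apply: (le_trans (normc_le _)).
have [ri ii] := cinteg_expik (- k) fi.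
rewrite mulrDl mul1r lerD //.
  apply: (le_trans (normr_mean ri)); apply: ler_mean; try exact: integ_abs.
  by move=> t _ /=; rewrite mul0r subr0 normrM ler_piMr // cos_max.
apply: (le_trans (normr_mean ii)); apply: ler_mean; try exact: integ_abs.
by move=> t _ /=; rewrite mul0r addr0 normrM ler_piMr // sin_max.
Qed.

Lemma fcoefN f k : integ f -> fcoef (fun t => - f t) k = - fcoef f k.
Proof.
move=> fi; rewrite -mulN1r /fcoef -cmeanZ; last exact: cinteg_expik.
by congr cmean; apply/funext => t; rewrite rmorphN mulN1r mulNr.
Qed.

(** Each difference $d$ with $|d| \le n$ occurs $n+1-|d|$ times; the sum on the right groups $d =
    k+1$ with $d = -(k+1)$. *)
Lemma sum_differences (g : int -> C) n :
  \sum_(j < n.+1) \sum_(l < n.+1) g ((j : nat)%:Z - (l : nat)%:Z) =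
  n.+1%:R * g 0 + \sum_(k < n) (n - k)%:R * (g k.+1%:Z + g (- k.+1%:Z)).
Proof.
elim: n => [|n ih]; first by rewrite !big_ord1 big_ord0 subrr mul1r addr0.
rewrite big_ord_recr /=.
under eq_bigr do rewrite big_ord_recr /=.
rewrite big_split /= ih [\sum_(l < n.+2) _]big_ord_recr /= subrr.
have -> : \sum_(j < n.+1) g (j%:Z - n.+1%:Z) = \sum_(k < n.+1) g (- k.+1%:Z).
  rewrite (reindex_inj rev_ord_inj); apply: eq_bigr => k _ /=.
  by congr g; have := ltn_ord k; lia.
have -> : \sum_(j < n.+1) g (n.+1%:Z - j%:Z) = \sum_(k < n.+1) g k.+1%:Z.
  rewrite (reindex_inj rev_ord_inj); apply: eq_bigr => k _ /=.
  by congr g; have := ltn_ord k; lia.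
have -> : \sum_(k < n.+1) (n.+1 - k)%:R * (g k.+1%:Z + g (- k.+1%:Z)) =
   \sum_(k < n) (n - k)%:R * (g k.+1%:Z + g (- k.+1%:Z)) +
   (\sum_(k < n.+1) g k.+1%:Z + \sum_(k < n.+1) g (- k.+1%:Z)).
  rewrite (eq_bigr (fun k : 'I_n.+1 => (n - k)%:R * (g k.+1%:Z + g (- k.+1%:Z)) +
      (g k.+1%:Z + g (- k.+1%:Z)))) => [|k _].
    by rewrite !big_split /= [\sum_(k < n.+1) _ * _]big_ord_recr /= subnn mul0r addr0.
  have kn : (k <= n)%N by rewrite -ltnS ltn_ord.
  by rewrite (subSn kn) -natr1 mulrDl mul1r.
rewrite -[n.+2%:R]natr1; ring.
Qed.

(* The analytic half of the Fejer mean of f, without its constant term. *)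
Definition fejer_poly f (n : nat) : {poly C} :=
  \poly_(k < n.+1) (if k is k'.+1 then (n - k')%:R / n.+1%:R * fcoef f k else 0).

Lemma fejer_poly_coef0 f n : (fejer_poly f n)`_0 = 0.
Proof. by rewrite coef_poly. Qed.

Lemma horner_fejer_poly f n t : (fejer_poly f n).[expik 1 t] =
  \sum_(k < n) (n - k)%:R / n.+1%:R * fcoef f k.+1 * expik k.+1 t.
Proof.
rewrite horner_poly big_ord_recl mul0r add0r; apply: eq_bigr => k _ /=.
by rewrite -expikX.
Qed.

Lemma fejer_meanE_poly f n t : integ f ->
  fejer_mean n.+1 f t = mean f + 2 * complex.Re (fejer_poly f n).[expik 1 t].
Proof.
move=> fi; set p := _.[_].
suff : (fejer_mean n.+1 f t)%:C = (mean f)%:C + (p + conjc p).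
  case: p => x y /eqP; rewrite eq_complex /= => /andP[/eqP -> _]; ring.
rewrite fejer_meanE // (sum_differences (fun k => fcoef f k * expik k t)).
have n0 : n.+1%:R != 0 :> C by rewrite pnatr_eq0.
rewrite fcoef0 expik0 mulr1 mulrDr mulrA mulVf // mul1r; congr (_ + _).
rewrite /p horner_fejer_poly conjc_sum -big_split mulr_sumr; apply: eq_bigr => k _ /=.
have -> : (n - k)%:R / n.+1%:R = ((n - k)%:R / n.+1%:R)%:C :> C.
  by rewrite rmorphM fmorphV !rmorph_nat.
rewrite !conjcM fcoefJ // expikJ conjc_real.
have -> : ((n - k)%:R / n.+1%:R : R)%:C = n.+1%:R^-1 * (n - k)%:R.
  by rewrite rmorphM fmorphV !rmorph_nat mulrC.
ring.
Qed.

Lemma ccvg_fejer_poly_coef f k :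
  ccvg (fun n => (fejer_poly f n)`_k) (if k is 0%N then 0 else fcoef f k).
Proof.
case: k => [|k]; first by under [X in ccvg X]funext do rewrite fejer_poly_coef0; exact: ccvg_cst.
apply: (@ccvg_eq _ (fun n => (1 - k.+1%:R * n.+1%:R^-1) * fcoef f k.+1)).
  near=> n; have kn : (k < n)%N by near: n; exact: nbhs_infty_gt.
  rewrite coef_poly ltnS kn; congr (_ * _).
  have n0 : n.+1%:R != 0 :> C by rewrite pnatr_eq0.
  apply: (mulIf n0); rewrite mulrBl mul1r !mulfVK //.
  by rewrite -natrB ?subSS // ltnS ltnW.
suff : ccvg (fun n => (1 - k.+1%:R * n.+1%:R^-1) * fcoef f k.+1) ((1 - k.+1%:R * 0) * fcoef f k.+1).
  by rewrite mulr0 subr0 mul1r.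
apply: ccvgM; last exact: ccvg_cst.
apply: ccvgD; first exact: ccvg_cst.
apply: ccvgN; apply: ccvgM; [exact: ccvg_cst|exact: ccvg_invn].
Unshelve. all: by end_near. Qed.

(* Approximates exp P for the analytic half P of f - mean f; on the circle
   |exp P|^2 = exp (2 Re P) = exp (f - mean f). *)
Definition outer_poly f (n : nat) : {poly C} :=
  (1 + (n.+1 ^ 3)%:R^-1 *: fejer_poly f n) ^+ (n.+1 ^ 3).

Lemma fexp_ext (l l' : nat -> C) : (forall k, l k.+1 = l' k.+1) -> fexp l =1 fexp l'.
Proof.
move=> ll'; apply: fexp_unique => // n; rewrite fexpS.
by apply: eq_bigr => i _; rewrite ll'.
Qed.

Lemma ccvg_outer_poly_coef f k :
  ccvg (fun n => (outer_poly f n)`_k) (fexp (fun j => fcoef f j) k).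
Proof.
rewrite (@fexp_ext _ (fun j => if j is 0%N then 0 else fcoef f j)) //.
apply: ccvg_euler_coef.
- by move=> n; rewrite expn_gt0.
- suff : ccvg (fun n => n.+1%:R^-1 * (n.+1%:R^-1 * n.+1%:R^-1)) (0 * (0 * 0) : C).
    rewrite !mulr0; congr ccvg; apply/funext => n.
    by rewrite natrX exprS expr2 !invfM.
  by apply: ccvgM; [|apply: ccvgM]; exact: ccvg_invn.
- exact: fejer_poly_coef0.
- exact: ccvg_fejer_poly_coef.
Qed.

(** From $|1+P/N|^2 = 1 + 2\,\mathrm{Re}\,P/N + |P|^2/N^2$ and $1+x \le e^x$, the left side is at
    most $\exp(2\,\mathrm{Re}\,P + |P|^2/N)$, and $2\,\mathrm{Re}\,P$ is the Fejer mean minus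
    [mean f]. As $|P| \le 2mn$, with $m$ the mean of $|f|$, the cubic choice $N = (n+1)^3$ makes the
    error at most $4m^2/(n+1)$. *)
Lemma sqn_outer_poly_le f : integ f -> exists2 K, 0 <= K & forall n t,
  sqn (outer_poly f n).[expik 1 t] <= expR (fejer_mean n.+1 f t - mean f + K / n.+1%:R).
Proof.
move=> fi; pose m := mean (fun t => `|f t|).
have m0 : 0 <= m by apply: mean_ge0.
exists (4 * m ^+ 2); first by rewrite mulr_ge0 // sqr_ge0.
move=> n t; rewrite horner_exp hornerD hornerZ hornerC sqnX.
set N := (n.+1 ^ 3)%N; set p := (fejer_poly f n).[_].
have N0 : 0 < N%:R :> R by rewrite ltr0n expn_gt0.
have np : Normc.normc p <= n%:R * (2 * m).
  rewrite /p horner_fejer_poly; apply: (le_trans (normc_sum _ _ _)).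
  apply: (@le_trans _ _ (\sum_(k < n) 2 * m)); last by rewrite sumr_const card_ord -[leLHS]mulr_natl.
  apply: ler_sum => k _; rewrite !Normc.normcM.
  have -> : Normc.normc (expik k.+1 t) = 1 by rewrite /= cos2Dsin2 sqrtr1.
  rewrite mulr1; apply: le_trans (normc_fcoef k.+1 fi).
  rewrite -Normc.normcM ler_piMl //.
    by case: (fcoef _ _) => x y; exact: sqrtr_ge0.
  have -> : (n - k)%:R / n.+1%:R = ((n - k)%:R / n.+1%:R)%:C :> C.
    by rewrite rmorphM fmorphV !rmorph_nat.
  have q0 : 0 <= (n - k)%:R / n.+1%:R :> R by rewrite divr_ge0.
  rewrite /= expr0n addr0 sqrtr_sqr ger0_norm // ler_pdivrMr ?ltr0n // mul1r ler_nat.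
  by rewrite (leq_trans (leq_subr _ _)).
have nc0 (z : C) : 0 <= Normc.normc z by case: z => x y; exact: sqrtr_ge0.
have sp : sqn p <= (n%:R * (2 * m)) ^+ 2.
  have b0 : 0 <= n%:R * (2 * m) by apply: mulr_ge0 => //; apply: mulr_ge0.
  by rewrite sqn_normc lerXn2r ?nnegrE.
have sE : sqn (1 + N%:R^-1 * p) = 1 + (2 * complex.Re p / N%:R + sqn p / N%:R ^+ 2).
  have -> : (N%:R^-1 : C) = (N%:R^-1)%:C by rewrite fmorphV rmorph_nat.
  by case: (p) => x y; rewrite /sqn /=; field; rewrite gt_eqF.
have s0 := sqn_ge0 (1 + N%:R^-1 * p).
rewrite sE; rewrite sE in s0; set x := (X in 1 + X) in s0 *.
apply: (@le_trans _ _ (expR x ^+ N)).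
  by rewrite lerXn2r ?nnegrE ?expR_ge0 ?expR_ge1Dx.
rewrite -expRM_natl ler_expR fejer_meanE_poly // -/p /x.
have -> : N%:R * (2 * complex.Re p / N%:R + sqn p / N%:R ^+ 2) =
    2 * complex.Re p + sqn p / N%:R by field; rewrite gt_eqF.
rewrite (addrC (mean f)) addrK lerD2l.
have n0 : 0 < n.+1%:R :> R by rewrite ltr0n.
rewrite ler_pdivrMr //; apply: (le_trans sp).
have -> : 4 * m ^+ 2 / n.+1%:R * N%:R = (n.+1%:R * (2 * m)) ^+ 2.
  by rewrite natrX; field; rewrite gt_eqF.
have b0 k : 0 <= k%:R * (2 * m) by apply: mulr_ge0 => //; apply: mulr_ge0.
rewrite lerXn2r ?nnegrE ?b0 // ler_wpM2r ?ler_nat //.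
exact: mulr_ge0.
Qed.

Lemma cbdd_horner (p : {poly C}) : cbdd (fun t => p.[expik 1 t]).
Proof.
under [X in cbdd X]funext do rewrite horner_coef.
apply: cbdd_sum => j _; apply: cbddM; first exact: cbdd_cst.
by under [X in cbdd X]funext do rewrite -expikX; exact: cbdd_expik.
Qed.

Lemma bdd_sqn_horner (p : {poly C}) : bdd_meas (fun t => sqn p.[expik 1 t]).
Proof. exact: cbdd_sqn (cbdd_horner p). Qed.

(* |outer_poly f n|^2 is at most exp (fejer_mean f - mean f) up to a factor
   tending to 1, and Jensen's inequality bounds exp (fejer_mean f). *)
Lemma mean_outer_poly_le f g w : integ f -> integ g -> integ w ->
  {ae mu, forall t, T t -> 0 <= w t} -> {ae mu, forall t, T t -> expR (f t) <= g t} ->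
  exists2 K, 0 <= K & forall n,
  mean (fun t => w t * sqn (outer_poly f n).[expik 1 t]) <=
  expR (K / n.+1%:R - mean f) * mean (fun t => w t * fejer_mean n.+1 g t).
Proof.
move=> fi gi wi w0 fg; have [K K0 hK] := sqn_outer_poly_le fi.
exists K => // n.
have wk : integ (fun t => w t * fejer_mean n.+1 g t).
  by apply: integM => //; exact: bdd_fejer_mean.
rewrite -meanZ //; apply: ae_ler_mean; first by apply: integM => //; exact: bdd_sqn_horner.
  exact: integZ.
move: w0; apply: ae_imp => t w0 Tt; rewrite mulrCA; apply: ler_wpM2l; first exact: w0.
apply: (le_trans (hK n t)).
have -> : fejer_mean n.+1 f t - mean f + K / n.+1%:R =
  (K / n.+1%:R - mean f) + fejer_mean n.+1 f t by ring.
rewrite expRD ler_wpM2l ?expR_ge0 //.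
exact: expR_fejer_mean_le.
Qed.

Lemma mean_sqn_horner (p : {poly C}) f n : (size p <= n)%N -> integ f ->
  (mean (fun t => f t * sqn p.[expik 1 t]))%:C =
  \sum_(j < n) \sum_(k < n) conjc p`_j * fcoef f ((j : nat)%:Z - (k : nat)%:Z) * p`_k.
Proof.
move=> pn fi; rewrite -cmean_real.
have -> : (fun t => (f t * sqn p.[expik 1 t])%:C) = (fun t => \sum_(j < n) \sum_(k < n)
    (conjc p`_j * p`_k) * ((f t)%:C * expik (- ((j : nat)%:Z - (k : nat)%:Z)) t)).
  apply/funext => t; rewrite rmorphM /= -sqnE (horner_coef_wide _ pn) conjc_sum.
  rewrite mulrCA mulr_suml exchange_big /=; apply: eq_bigr => j _.
  rewrite !mulr_sumr; apply: eq_bigr => k _.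
  by rewrite -!expikX conjcM expikJ opprB expikD; ring.
have ci (j k : 'I_n) : cinteg (fun t => (conjc p`_j * p`_k) * ((f t)%:C * expik (- ((j : nat)%:Z - (k : nat)%:Z)) t)).
  by apply: cintegZ; exact: cinteg_expik.
rewrite cmean_sum => [|j _]; last by apply: cinteg_sum.
apply: eq_bigr => j _; rewrite cmean_sum //; apply: eq_bigr => k _.
rewrite cmeanZ; last exact: cinteg_expik.
by rewrite mulrAC.
Qed.

Lemma parseval (p : {poly C}) n : (size p <= n)%N ->
  mean (fun t => sqn p.[expik 1 t]) = \sum_(k < n) sqn p`_k.
Proof.
move=> pn; apply: complexI.
have -> : (fun t => sqn p.[expik 1 t]) = (fun t => 1 * sqn p.[expik 1 t]).
  by apply/funext => t; rewrite mul1r.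
rewrite (mean_sqn_horner pn (integ_cst 1)) rmorph_sum; apply: eq_bigr => j _ /=.
have f1 k : fcoef (fun=> 1) k = (k == 0)%:R.
  rewrite -oppr_eq0 -cmean_expik; congr cmean; apply/funext => t.
  by rewrite mul1r.
rewrite (bigD1 j) //= big1 => [|k kj].
  by rewrite f1 subrr eqxx mulr1 addr0 mulrC sqnE.
by rewrite f1 subr_eq0 eqz_nat eq_sym val_eqE (negbTE kj) mulr0 mul0r.
Qed.

Lemma cvgr_sum I (r : seq I) (P : pred I) (F : I -> nat -> R) (l : I -> R) :
  (forall i, P i -> F i n @[n --> \oo] --> l i) ->
  \sum_(i <- r | P i) F i n @[n --> \oo] --> \sum_(i <- r | P i) l i.
Proof.
move=> h; elim: r => [|i r ih].
  by under eq_fun do rewrite big_nil; rewrite big_nil; exact: cvg_cst.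
under eq_fun do rewrite big_cons; rewrite big_cons.
by case: (boolP (P i)) => Pi //; apply: cvgD => //; exact: h.
Qed.

Lemma cvg_sum_sqn m (u : nat -> nat -> C) (l : nat -> C) :
  (forall k, ccvg (fun n => u n k) (l k)) ->
  \sum_(k < m) sqn (u n k - l k) @[n --> \oo] --> (0 : R).
Proof.
move=> h.
suff : \sum_(k < m) sqn (u n k - l k) @[n --> \oo] --> \sum_(k < m) sqn (l k - l k).
  by under [X in _ `=>` nbhs X]eq_bigr do rewrite subrr sqn0; rewrite big1.
apply: cvgr_sum => k _; apply: ccvg_sqn; apply: ccvgD; [exact: h|exact: ccvg_cst].
Qed.

Lemma cvg_expR_div (K c : R) : expR (K / n.+1%:R - c) @[n --> \oo] --> expR (- c).
Proof.
apply: (cvg_comp (fun n : nat => K / n.+1%:R - c) expR _ (@continuous_expR R (- c))).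
suff : (fun n : nat => K / n.+1%:R - c) @ \oo --> K * 0 - c by rewrite mulr0 add0r.
by apply: cvgB; [apply: cvgM; [exact: cvg_cst|exact: cvg_harmonic]|exact: cvg_cst].
Qed.

(** * Lower and upper bounds for a weight [A] equal to the exponential of [lam] *)

Section Weight.
Variables (A lam : R -> R).
Hypotheses (Ai : integ A) (lami : integ lam).
Hypothesis A_exp : {ae mu, forall t, T t -> A t = expR (lam t)}.

(* Bessel's inequality for p times the outer polynomials of lam. *)
Lemma szego_lower (p : {poly C}) m :
  \sum_(k < m) sqn (\sum_(i < k.+1) p`_i * fexp (fun j => fcoef lam j) (k - i)) <=
  expR (- mean lam) * mean (fun t => A t * sqn p.[expik 1 t]).
Proof.
pose w t := sqn p.[expik 1 t].
have wb : bdd_meas w by exact: bdd_sqn_horner.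
have wi := bdd_integ wb.
have A_ge : {ae mu, forall t, T t -> expR (lam t) <= A t}.
  by move: A_exp; apply: ae_imp => t h /h ->.
have w0 : {ae mu, forall t, T t -> 0 <= w t} by apply: aeW => t _; exact: sqn_ge0.
have [K K0 hK] := mean_outer_poly_le lami Ai wi w0 A_ge.
apply: (@ler_cvg_to _ (nbhs \oo) _ _ (fun n => \sum_(k < m) sqn (p * outer_poly lam n)`_k)
  (fun n => expR (K / n.+1%:R - mean lam) * mean (fun t => w t * fejer_mean n.+1 A t))).
- apply: cvgr_sum => k _; apply: ccvg_sqn.
  under [X in ccvg X]funext do rewrite coefM.
  apply: ccvg_sum => i _; apply: ccvgM; first exact: ccvg_cst.
  exact: ccvg_outer_poly_coef.
(* The Fejer mean falls on [A], which is only integrable; symmetry moves it to the bounded function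
   [w], where convergence is known. *)
- apply: cvgM; first exact: cvg_expR_div.
  have := cvg_mean_fejer_mean Ai wb; apply: cvg_trans; apply: near_eq_cvg.
  by near=> n; exact: mean_fejer_meanC.
near=> n; apply: le_trans (hK n).
set P := p * _; pose M := maxn m (size P).
have -> : (fun t => w t * sqn (outer_poly lam n).[expik 1 t]) = (fun t => sqn P.[expik 1 t]).
  by apply/funext => t; rewrite hornerM sqnM.
rewrite (@parseval _ M) ?leq_maxr // (big_ord_widen M (fun k => sqn P`_k)) ?leq_maxl //.
by rewrite [leLHS]big_mkcond /=; apply: ler_sum => k _; case: ifP => // _; exact: sqn_ge0.
Unshelve. all: by end_near. Qed.

(* With b a truncation of lam bounded below, exp (- b) is bounded and
   A exp (- b) <= 1. *)
Lemma szego_upper_bounded (b : R -> R) (B : R) (q : {poly C}) m (e : R) :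
  integ b -> (forall t, lam t <= b t) -> (forall t, B <= b t) -> 0 < e ->
  exists p : {poly C},
    mean (fun t => A t * sqn p.[expik 1 t]) <=
      expR (mean b) * mean (fun t => sqn q.[expik 1 t]) + e /\
    forall k, (k < m)%N ->
      sqn (p`_k - \sum_(i < k.+1) q`_i * fexp (fun j => - fcoef b j) (k - i)) <= e.
Proof.
move=> bi lb Bb e0.
pose w t := A t * sqn q.[expik 1 t].
have qb := bdd_sqn_horner q.
have wi : integ w by exact: integM.
pose g t := expR (- b t).
have gb : bdd_meas g.
  split; last by exists (expR (- B)) => t; rewrite ger0_norm ?expR_ge0 // ler_expR lerN2.
  exact: (measurableT_comp (@measurable_expR R) (integ_measurable (integN bi))).
have Nbi := integN bi.
have w0 : {ae mu, forall t, T t -> 0 <= w t}.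
  by move: A_exp; apply: ae_imp => t h /h At; rewrite /w At mulr_ge0 ?expR_ge0 ?sqn_ge0.
have g_ge : {ae mu, forall t, T t -> expR (- b t) <= g t} by apply: aeW.
(* With exponent [- b] and weight $A|q|^2$, the factor in front tends to [expR (mean b)]. *)
have [K K0 hK] := mean_outer_poly_le Nbi (bdd_integ gb) wi w0 g_ge.
have wg : mean (fun t => w t * g t) <= mean (fun t => sqn q.[expik 1 t]).
  apply: ae_ler_mean; [exact: integM|exact: bdd_integ|].
  move: A_exp; apply: ae_imp => t h /h At.
  rewrite /w /g At mulrAC -expRD ler_piMl ?sqn_ge0 // -expR0 ler_expR.
  by rewrite subr_le0.
have lim1 : expR (K / n.+1%:R - mean (fun t => - b t)) * mean (fun t => w t * fejer_mean n.+1 g t)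
    @[n --> \oo] --> expR (mean b) * mean (fun t => w t * g t).
  have -> : mean b = - mean (fun t => - b t) by rewrite meanN // opprK.
  by apply: cvgM; [exact: cvg_expR_div|exact: cvg_mean_fejer_mean].
pose c k := \sum_(i < k.+1) q`_i * fexp (fun j => - fcoef b j) (k - i).
have lim2 : \sum_(k < m) sqn ((q * outer_poly (fun t => - b t) n)`_k - c k)
    @[n --> \oo] --> (0 : R).
  apply: (@cvg_sum_sqn _ (fun n k => (q * outer_poly (fun t => - b t) n)`_k)) => k.
  under [X in ccvg X]funext do rewrite coefM.
  apply: ccvg_sum => i _; apply: ccvgM; first exact: ccvg_cst.
  have -> : (fun j : nat => - fcoef b j) = (fun j : nat => fcoef (fun t => - b t) j).
    by apply/funext => j; rewrite fcoefN.
  exact: ccvg_outer_poly_coef.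
have [n [h1 h2]] : exists n,
    expR (K / n.+1%:R - mean (fun t => - b t)) * mean (fun t => w t * fejer_mean n.+1 g t) <=
      expR (mean b) * mean (fun t => w t * g t) + e /\
    \sum_(k < m) sqn ((q * outer_poly (fun t => - b t) n)`_k - c k) <= e.
  apply: (@filter_ex _ \oo); near=> n; split.
    rewrite -lerBlDl; apply: le_trans (ler_norm _) _; rewrite distrC; near: n.
    by move/cvgrPdist_le : lim1; apply.
  apply: le_trans (ler_norm _) _; rewrite -normrN -sub0r; near: n.
  by move/cvgrPdist_le : lim2; apply.
exists (q * outer_poly (fun t => - b t) n); split.
  have -> : (fun t => A t * sqn (q * outer_poly (fun t => - b t) n).[expik 1 t]) =
      (fun t => w t * sqn (outer_poly (fun t => - b t) n).[expik 1 t]).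
    by apply/funext => t; rewrite hornerM sqnM mulrA.
  apply: (le_trans (hK n)); apply: (le_trans h1); rewrite lerD2r.
  by rewrite ler_wpM2l ?expR_ge0.
move=> k km; apply: le_trans h2.
rewrite (bigD1 (Ordinal km)) //= lerDl sumr_ge0 // => l _; exact: sqn_ge0.
Unshelve. all: by end_near. Qed.

Lemma ccvg_normc (u : nat -> C) (l : C) (r : nat -> R) :
  (forall n, Normc.normc (u n - l) <= r n) -> r @ \oo --> (0 : R) -> ccvg u l.
Proof.
move=> ur r0; apply/ccvgP.
have reim (z : C) : `|complex.Re z| <= Normc.normc z /\ `|complex.Im z| <= Normc.normc z.
  by rewrite -!lecR; have := ler_normRe z; have := ler_normIm z; rewrite normc_def; case: z.
split; apply/cvgrPdist_le => e e0; near=> n; apply: (@le_trans _ _ (r n)).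
- apply: le_trans (ur n); rewrite distrC; have [+ _] := reim (u n - l).
  by case: (u n) (l) => ? ? [? ?].
- apply: (le_trans (ler_norm _)); rewrite -normrN -sub0r; near: n.
  by move/cvgrPdist_le : r0; apply.
- apply: le_trans (ur n); rewrite distrC; have [_ +] := reim (u n - l).
  by case: (u n) (l) => ? ? [? ?].
- apply: (le_trans (ler_norm _)); rewrite -normrN -sub0r; near: n.
  by move/cvgrPdist_le : r0; apply.
Unshelve. all: by end_near. Qed.

Lemma ccvg_fcoef (u : nat -> R -> R) f : integ f -> (forall n, integ (u n)) ->
  mean (fun t => `|u n t - f t|) @[n --> \oo] --> (0 : R) ->
  forall k, ccvg (fun n => fcoef (u n) k) (fcoef f k).
Proof.
move=> fi ui u0 k; apply: (@ccvg_normc _ _ (fun n => 2 * mean (fun t => `|u n t - f t|))).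
  move=> n; have -> : fcoef (u n) k - fcoef f k = fcoef (fun t => u n t - f t) k.
    have ci := cinteg_expik (- k) fi; have cu := cinteg_expik (- k) (ui n).
    have := cmeanD cu (cintegZ (-1) ci); rewrite (cmeanZ (-1) ci) mulN1r /fcoef => <-.
    by congr cmean; apply/funext => t; rewrite rmorphB mulrBl mulN1r.
  exact/normc_fcoef/integB.
by rewrite -(mulr0 2); apply: cvgM; [exact: cvg_cst|exact: u0].
Qed.

Lemma sqnD_le (z y : C) : sqn (z + y) <= 2 * (sqn z + sqn y).
Proof.
case: z y => a b [c d]; rewrite /sqn /=.
have := sqr_ge0 (a - c); have := sqr_ge0 (b - d); rewrite !sqrrB !sqrrD.
by move=> ? ?; lra.
Qed.

(** The truncations $\max(\mathrm{lam}, -N)$ tend to [lam] in $L^1$, dominated by $|\mathrm{lam}|$.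
    Hence their means and Fourier coefficients converge, and with them the coefficients of the
    formal exponential, so the bounded case applies for large $N$. *)
Lemma szego_upper (q : {poly C}) m (e : R) : 0 < e ->
  exists p : {poly C},
    mean (fun t => A t * sqn p.[expik 1 t]) <=
      expR (mean lam) * mean (fun t => sqn q.[expik 1 t]) + e /\
    forall k, (k < m)%N ->
      sqn (p`_k - \sum_(i < k.+1) q`_i * fexp (fun j => - fcoef lam j) (k - i)) <= e.
Proof.
move=> e0; pose b N t := Num.max (lam t) (- N%:R).
have b_dist N t : `|b N t - lam t| <= `|lam t|.
  rewrite /b; case: (leP (lam t) (- N%:R)) => h; last by rewrite subrr normr0.
  have h0 : - N%:R <= 0 :> R by rewrite oppr_le0.
  rewrite ger0_norm ?subr_ge0 // ler0_norm ?(le_trans h) //; lra.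
have mb N : measurable_fun T (b N).
  by apply: measurable_maxr; [exact: integ_measurable|exact: measurable_cst].
have bl_i N : integ (fun t => b N t - lam t).
  apply: (@le_integrable _ _ _ _ _ measurable_circle _ (EFin \o lam)) => //.
    by apply/measurable_EFinP; exact: (measurable_funB (mb N) (integ_measurable lami)).
  by move=> t _; rewrite /= lee_fin.
have bi N : integ (b N).
  by have := integD lami (bl_i N); congr integ; apply/funext => t; rewrite addrC subrK.
have bl0 : mean (fun t => `|b n t - lam t|) @[n --> \oo] --> (0 : R).
  apply: (@mean_dominated _ (fun n t => b n t - lam t) (fun t => `|lam t|)).
  - by move=> n; exact: integ_measurable.
  - exact: integ_abs.
  - apply: aeW => t _; apply/cvgrPdist_le => d d0.
    near=> n; suff -> : b n t - lam t = 0 by rewrite subrr normr0 ltW.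
    rewrite /b max_l ?subrr // lerNl ltW //.
    by near: n; exact: nbhs_infty_gtr.
  - by move=> n t _.
have cb := ccvg_fcoef lami bi bl0.
pose Q := mean (fun t => sqn q.[expik 1 t]).
have mb0 : mean (b n) @[n --> \oo] --> mean lam.
  have ReE : (fun n => complex.Re (fcoef (b n) 0)) = (fun n => mean (b n)).
    by apply/funext => n; rewrite fcoef0.
  by have := ccvg_Re (cb 0); rewrite ReE fcoef0.
have lim1 : expR (mean (b n)) * Q @[n --> \oo] --> expR (mean lam) * Q.
  apply: cvgM; last exact: cvg_cst.
  exact: (cvg_comp _ expR mb0 (@continuous_expR R _)).
pose c (l : nat -> C) k := \sum_(i < k.+1) q`_i * fexp (fun j => - l j) (k - i).
have lim2 : \sum_(k < m) sqn (c (fcoef (b n)) k - c (fcoef lam) k) @[n --> \oo] --> (0 : R).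
  apply: (@cvg_sum_sqn _ (fun n k => c (fcoef (b n)) k)) => k.
  apply: ccvg_sum => i _; apply: ccvgM; first exact: ccvg_cst.
  by apply: ccvg_fexp => j; apply: ccvgN; exact: cb.
(* Quarters, because [sqnD_le] doubles the sum of the two squared errors. *)
have e4 : 0 < e / 4 by rewrite divr_gt0.
have [N [h1 h2]] : exists N, expR (mean (b N)) * Q <= expR (mean lam) * Q + e / 4 /\
    \sum_(k < m) sqn (c (fcoef (b N)) k - c (fcoef lam) k) <= e / 4.
  apply: (@filter_ex _ \oo); near=> n; split.
    rewrite -lerBlDl; apply: le_trans (ler_norm _) _; rewrite distrC; near: n.
    by move/cvgrPdist_le : lim1; apply.
  apply: le_trans (ler_norm _) _; rewrite -normrN -sub0r; near: n.
  by move/cvgrPdist_le : lim2; apply.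
have lb t : lam t <= b N t by rewrite le_max lexx.
have Bb t : - N%:R <= b N t by rewrite le_max lexx orbT.
have [p [p1 p2]] := szego_upper_bounded q m (bi N) lb Bb e4.
exists p; split.
  apply: (le_trans p1); apply: (le_trans (lerD h1 (lexx _))).
  rewrite -addrA lerD2l; lra.
move=> k km; rewrite -/(c (fcoef lam) k).
have -> : p`_k - c (fcoef lam) k =
    (p`_k - c (fcoef (b N)) k) + (c (fcoef (b N)) k - c (fcoef lam) k).
  by rewrite addrA subrK.
apply: (le_trans (sqnD_le _ _)); apply: (@le_trans _ _ (2 * (e / 4 + e / 4))); last lra.
rewrite ler_pM2l // lerD //; first exact: p2.
apply: le_trans h2; rewrite (bigD1 (Ordinal km)) //= lerDl sumr_ge0 // => l _.
exact: sqn_ge0.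
Unshelve. all: by end_near. Qed.

End Weight.
End Szego.

(** * Complex power series *)

Section ComplexDerivative.
Context {R : realType}.
Local Notation C := R[i].
Local Notation normc := Normc.normc.

Lemma normc_ge0 (z : C) : 0 <= normc z.
Proof. by case: z => x y; exact: sqrtr_ge0. Qed.

Lemma normrE (z : C) : `|z| = (normc z)%:C.
Proof. by rewrite normc_def; case: z. Qed.

Lemma normc_Re (z : C) : `|complex.Re z| <= normc z.
Proof. by rewrite -lecR -normrE; exact: ler_normRe. Qed.

Lemma normc_Im (z : C) : `|complex.Im z| <= normc z.
Proof. by rewrite -lecR -normrE; exact: ler_normIm. Qed.

Lemma normc_real (x : R) : normc x%:C = `|x|.
Proof. by rewrite /= expr0n addr0 sqrtr_sqr. Qed.

Lemma normc_nat (n : nat) : normc (n%:R : C) = n%:R.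
Proof. by rewrite -(rmorph_nat (real_complex R)) normc_real ger0_norm. Qed.

(** Differentiability with a quadratic remainder. Stronger than having derivative [d], it reduces
    the rules for power series and exponentials to inequalities with explicit constants. *)
Definition qderiv (f : C -> C) (z d : C) : Prop :=
  exists K e : R, [/\ 0 <= K, 0 < e & forall h, normc h < e ->
    normc (f (z + h) - f z - h * d) <= K * normc h ^+ 2].

Lemma qderiv_is_derive (f : C -> C) z d : qderiv f z d ->
  is_derive (z : C^o) (1 : C^o) (f : C^o -> C^o) (d : C^o).
Proof.
move=> [K [e [K0 e0 h]]].
have lim : ((k : C)^-1 *: ((f : C^o -> C^o) ((k : C) *: (1 : C^o) + z) - f z) : C^o) @[k --> (0 : C^o)^'] --> (d : C^o).
  apply/cvgrPdist_le => -[r r'] r0.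
  have r'0 : r' = 0 by move: r0; rewrite ltcE /= => /andP[/eqP].
  have {}r0 : 0 < r by move: r0; rewrite ltcE /= => /andP[].
  pose s := Num.min e (r / (K + 1)).
  have K1 : 0 < K + 1 by rewrite ltr_wpDl.
  have s0 : 0 < s by rewrite lt_min e0 divr_gt0.
  have sC : (0 : C) < s%:C by rewrite ltcR.
  have n0 : \forall k \near (0 : C^o)^', k != 0 by exact: nbhs_dnbhs_neq.
  have n1 : \forall k \near (0 : C^o)^', `|k| < s%:C by exact: (@dnbhs0_lt C C^o _ sC).
  apply: filterS2 n0 n1 => k k0 kn.
  have ks : normc k < s by rewrite -ltcR -normrE; exact: kn.
  rewrite r'0 normrE lecR.
  have nk : 0 < normc k.
    rewrite lt_neqAle normc_ge0 andbT eq_sym; apply/eqP => /Normc.eq0_normc k0'.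
    by rewrite k0' eqxx in k0.
  have -> : (d : C) - k^-1 *: ((f : C^o -> C^o) (k *: (1 : C^o) + z) - f z) =
      - k^-1 * (f (z + k) - f z - k * d).
    have alg (c x y : C) : c != 0 -> d - c^-1 * (x - y) = - c^-1 * (x - y - c * d).
      by move=> c0; field.
    rewrite /GRing.scale /= mulr1 [k + z]addrC; exact: alg.
  rewrite Normc.normcM normcN Normc.normcV ler_pdivrMl //.
  apply: (le_trans (h k (lt_le_trans ks _))); first by rewrite ge_min lexx.
  rewrite expr2 mulrA mulrC ler_pM2l //.
  have : normc k <= r / (K + 1) by apply: (le_trans (ltW ks)); rewrite ge_min lexx orbT.
  rewrite ler_pdivlMr // => hh; apply: le_trans hh; rewrite mulrC.
  by rewrite ler_wpM2l ?normc_ge0 // lerDl.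
split; first by apply/cvg_ex; exists (d : C^o).
exact: (cvg_lim _ lim).
Qed.

Lemma expCD (z w : C) : expC (z + w) = expC z * expC w.
Proof.
case: z w => x y [u v]; rewrite /expC /= expRD cosD sinD; simpc.
by congr Complex; ring.
Qed.

Lemma normr_sin_le (x : R) : `|sin x| <= `|x|.
Proof.
have d (t : R) : is_derive t 1 sin (cos t) by exact: is_derive_sin.
have cs : continuous (@sin R) by exact: continuous_sin.
have [x0|x0|->] := ltgtP x 0; last by rewrite sin0 normr0.
  have [c _ /eqP] := @MVT R sin cos x 0 x0 (fun t _ => d t) (continuous_subspaceT cs).
  rewrite sin0 !sub0r eqr_oppLR => /eqP ->.
  by rewrite mulrN opprK normrM ler_piMl // cos_max.
have [c _] := @MVT R sin cos 0 x x0 (fun t _ => d t) (continuous_subspaceT cs).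
by rewrite sin0 !subr0 => ->; rewrite normrM ler_piMl // cos_max.
Qed.

Lemma cos_sub1_le (x : R) : `|cos x - 1| <= x ^+ 2.
Proof.
have xE : (x / 2) *+ 2 = x by rewrite -mulr_natr mulfVK // pnatr_eq0.
have := cos_mulr2n (x / 2); rewrite xE => ->.
have := cos2Dsin2 (x / 2) => h.
have -> : cos (x / 2) ^+ 2 *+ 2 - 1 - 1 = - (2 * sin (x / 2) ^+ 2).
  by lra.
rewrite normrN normrM ger0_norm // normrX.
have := normr_sin_le (x / 2); rewrite normrM [`|2^-1|]ger0_norm // => s.
have s2 : `|sin (x / 2)| ^+ 2 <= (`|x| / 2) ^+ 2 by rewrite lerXn2r ?nnegrE ?divr_ge0.
apply: (@le_trans _ _ (2 * (`|x| / 2) ^+ 2)); first by rewrite ler_pM2l.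
rewrite exprMn real_normK ?num_real //; have := sqr_ge0 x.
rewrite exprVn; lra.
Qed.

Lemma sin_sub_le (x : R) : `|x| <= 1 -> `|sin x - x| <= x ^+ 2.
Proof.
move=> x1.
have d (t : R) : is_derive t 1 (fun t => sin t - t) (cos t - 1).
  exact: is_deriveB.
have cs : continuous (fun t : R => sin t - t).
  by move=> t; apply: cvgB; [exact: continuous_sin|exact: cvg_id].
have key (c : R) : `|c| <= `|x| -> `|(cos c - 1) * x| <= x ^+ 2.
  move=> cx; rewrite normrM; apply: (@le_trans _ _ (`|x| ^+ 2 * `|x|)).
    apply: ler_wpM2r => //; apply: (le_trans (cos_sub1_le c)).
    by rewrite -(real_normK (num_real c)) lerXn2r ?nnegrE.
  by rewrite real_normK ?num_real // ler_piMr // sqr_ge0.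
have [x0|x0|->] := ltgtP x 0; last by rewrite sin0 subrr normr0 expr0n.
  have [c] := @MVT R (fun t => sin t - t) (fun t => cos t - 1) x 0 x0 (fun t _ => d t) (continuous_subspaceT cs).
  rewrite in_itv /= => /andP[c1 c2]; rewrite sin0 subr0 !sub0r => E.
  have -> : sin x - x = (cos c - 1) * x by apply: oppr_inj; rewrite E mulrN.
  by apply: key; rewrite !ler0_norm ?(ltW x0) ?(ltW c2) // lerN2 ltW.
have [c] := @MVT R (fun t => sin t - t) (fun t => cos t - 1) 0 x x0 (fun t _ => d t) (continuous_subspaceT cs).
rewrite in_itv /= => /andP[c1 c2]; rewrite sin0 !subr0 => ->.
by apply: key; rewrite !ger0_norm ?(ltW x0) ?(ltW c1) // ltW.
Qed.

(** Both sides come from $1+x \le e^x$: at $-x$ it gives $e^x(1-x) \le 1$, which bounds $e^x$ from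
    above. *)
Lemma expR_sub1_le (x : R) : `|x| <= 2^-1 -> `|expR x - 1 - x| <= 2 * x ^+ 2.
Proof.
rewrite ler_norml => /andP[x1 x2].
have h1 := expR_ge1Dx x; have h2 := expR_ge1Dx (- x).
rewrite ger0_norm; last lra.
have e0 := expR_gt0 x.
have : expR x * (1 - x) <= 1.
  by apply: (le_trans (ler_wpM2l (ltW e0) h2)); rewrite -expRD subrr expR0.
nra.
Qed.

Lemma qderiv_expC0 : exists K e : R, [/\ 0 <= K, 0 < e & forall h : C, normc h < e ->
    normc (expC h - 1 - h) <= K * normc h ^+ 2].
Proof.
(* The estimates below add up to at most $4x^2+5y^2$ on this disc, so 20 leaves ample room. *)
exists 20, 2^-1; split => // -[x y] hxy.
have hx : `|x| <= 2^-1 by apply: ltW; apply: le_lt_trans hxy; exact: (normc_Re (x +i* y)).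
have hy : `|y| <= 2^-1 by apply: ltW; apply: le_lt_trans hxy; exact: (normc_Im (x +i* y)).
have -> : normc (x +i* y) ^+ 2 = x ^+ 2 + y ^+ 2 by rewrite -sqn_normc.
apply: (le_trans (normc_le _)); rewrite /expC /=; simpc => /=.
have b1 := expR_sub1_le hx; have b2 := cos_sub1_le y.
have b3 : `|sin y - y| <= y ^+ 2 by apply: sin_sub_le; apply: (le_trans hy); lra.
have e0 := expR_gt0 x.
have x2 := sqr_ge0 x; have y2 := sqr_ge0 y.
have xx : x ^+ 2 <= 4^-1.
  rewrite -(real_normK (num_real x)) (_ : 4^-1 = 2^-1 ^+ 2) ?lerXn2r ?nnegrE //.
  by field.
have e2 : expR x <= 2.
  by move: b1 hx; rewrite !ler_norml => /andP[? ?] /andP[? ?]; lra.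
have r1 : `|expR x * cos y - 1 - x| <= 2 * x ^+ 2 + 2 * y ^+ 2.
  have -> : expR x * cos y - 1 - x = (expR x - 1 - x) + expR x * (cos y - 1) by ring.
  apply: (le_trans (ler_normD _ _)); rewrite lerD // normrM (ger0_norm (ltW e0)).
  by rewrite ler_pM // ltW.
have r2 : `|expR x * sin y - y| <= 2 * y ^+ 2 + (`|x| + 2 * x ^+ 2) * `|y|.
  have -> : expR x * sin y - y = expR x * (sin y - y) + (x + (expR x - 1 - x)) * y by ring.
  apply: (le_trans (ler_normD _ _)); rewrite !normrM (ger0_norm (ltW e0)); apply: lerD.
    by rewrite ler_pM // ltW.
  apply: ler_wpM2r => //; apply: (le_trans (ler_normD _ _)); exact: lerD.
apply: (le_trans (lerD r1 r2)).
have xy : `|x| * `|y| <= x ^+ 2 + y ^+ 2.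
  rewrite -(real_normK (num_real x)) -(real_normK (num_real y)).
  by have := sqr_ge0 (`|x| - `|y|); have := sqr_ge0 (`|x| + `|y|); rewrite sqrrB sqrrD; lra.
have xy2 : 2 * x ^+ 2 * `|y| <= x ^+ 2 by rewrite -mulrA mulrCA ler_piMr //; lra.
rewrite mulrDl; lra.
Qed.

Lemma qderiv_expCN (F : C -> C) z d : qderiv F z d ->
  qderiv (fun w => expC (- F w)) z (- d * expC (- F z)).
Proof.
move=> [K [e [K0 e0 hF]]]; have [K' [e' [K'0 e'0 hE]]] := qderiv_expC0.
pose D := normc d; have D0 : 0 <= D by exact: normc_ge0.
(* [L] is a Lipschitz constant of [F] at [z]: for $|h| < 1$ the remainder $K|h|^2$ is at most
   $K|h|$. The radius also keeps the increment of [F] below [e']. *)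
pose L := D + K; have L0 : 0 <= L by rewrite addr_ge0.
have L1 : 0 < L + 1 by rewrite ltr_wpDl.
exists (normc (expC (- F z)) * (K' * L ^+ 2 + K)), (Num.min e (Num.min 1 (e' / (L + 1)))).
split.
- by rewrite mulr_ge0 ?normc_ge0 // addr_ge0 // mulr_ge0 // sqr_ge0.
- by rewrite !lt_min e0 ltr01 divr_gt0.
move=> h; rewrite !lt_min => /and3P[he h1 he'].
have h0 := normc_ge0 h.
pose k := - (F (z + h) - F z).
have kh : normc (k + h * d) <= K * normc h ^+ 2.
  have -> : k + h * d = - (F (z + h) - F z - h * d) by rewrite /k; ring.
  by rewrite normcN; exact: hF.
have kL : normc k <= L * normc h.
  have -> : k = (k + h * d) + - (h * d) by ring.
  apply: (le_trans (le_normcD _ _)); rewrite normcN Normc.normcM -/D.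
  rewrite /L mulrDl addrC [normc h * D]mulrC lerD2l; apply: (le_trans kh).
  by rewrite ler_wpM2l // expr2 ler_piMl // ltW.
have ke : normc k < e'.
  apply: (le_lt_trans kL); move: he'; rewrite ltr_pdivlMr // mulrC; apply: le_lt_trans.
  by rewrite ler_wpM2r // lerDl.
have -> : - F (z + h) = - F z + k by rewrite /k; ring.
rewrite expCD.
have -> : expC (- F z) * expC k - expC (- F z) - h * (- d * expC (- F z)) =
   expC (- F z) * ((expC k - 1 - k) + (k + h * d)) by ring.
rewrite Normc.normcM -mulrA ler_wpM2l ?normc_ge0 //.
apply: (le_trans (le_normcD _ _)); rewrite mulrDl lerD //.
apply: (le_trans (hE k ke)); rewrite -mulrA ler_wpM2l // -exprMn.
by rewrite lerXn2r ?nnegrE ?normc_ge0 // mulr_ge0.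
Qed.

Definition has_psum (c : nat -> C) (z s : C) : Prop :=
  ccvg (fun n => \sum_(k < n) c k * z ^+ k) s.

(* Coefficients of power series converging on the unit disc. *)
Definition disc_coef (c : nat -> C) : Prop :=
  forall r : R, 0 < r -> r < 1 -> exists B : R, forall k, normc (c k) * r ^+ k <= B.

Definition dcoef (c : nat -> C) (k : nat) : C := k.+1%:R * c k.+1.

Lemma geom_bound (r : R) n : 0 <= r -> r < 1 -> \sum_(k < n) r ^+ k <= (1 - r)^-1.
Proof.
move=> r0 r1; have s1 : 0 < 1 - r by rewrite subr_gt0.
rewrite -[leRHS]mul1r ler_pdivlMr //.
have -> : (\sum_(j < n) r ^+ j) * (1 - r) = 1 - r ^+ n.
  by rewrite -(opprB (r ^+ n) 1) subrX1 -mulNr opprB mulrC.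
by rewrite gerBl exprn_ge0.
Qed.

(** Each of the terms $r^j$ with $j < k$ is at least $r^k$, so $k r^k$ is at most the partial
    geometric sum. *)
Lemma expr_lin_bound (r : R) : 0 < r -> r < 1 -> exists B, forall k, k%:R * r ^+ k <= B.
Proof.
move=> r0 r1; exists (1 - r)^-1 => k.
apply: le_trans (geom_bound k (ltW r0) r1).
rewrite -[k in k%:R]card_ord mulr_natl -sumr_const.
by apply: ler_sum => j _; apply: ler_wiXn2l; rewrite ?(ltW r0) ?(ltW r1) // ltnW.
Qed.

Lemma disc_dcoef c : disc_coef c -> disc_coef (dcoef c).
Proof.
move=> hc r r0 r1.
pose s := (r + 1) / 2.
have s0 : 0 < s by rewrite divr_gt0 // addr_gt0.
have s1 : s < 1 by rewrite ltr_pdivrMr // mul1r; lra.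
have rs : r < s by rewrite ltr_pdivlMr //; lra.
have [B hB] := hc s s0 s1.
have q0 : 0 < r / s by rewrite divr_gt0.
have q1 : r / s < 1 by rewrite ltr_pdivrMr // mul1r.
have [M hM] := expr_lin_bound q0 q1.
exists (M * B / r) => k; rewrite ler_pdivlMr // -mulrA -exprSr Normc.normcM.
rewrite normc_nat.
have -> : k.+1%:R * normc (c k.+1) * r ^+ k.+1 =
    (k.+1%:R * (r / s) ^+ k.+1) * (normc (c k.+1) * s ^+ k.+1).
  by rewrite exprMn exprVn; field; rewrite gt_eqF // exprn_gt0.
by apply: ler_pM => //; rewrite mulr_ge0 ?normc_ge0 // exprn_ge0 // ltW.
Qed.

Lemma cvg_series_geom_dom (u : nat -> R) (B r : R) : 0 <= r -> r < 1 ->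
  (forall k, `|u k| <= B * r ^+ k) ->
  exists s : R, \sum_(k < n) u k @[n --> \oo] --> s.
Proof.
move=> r0 r1 h.
have cg : cvgn (series (geometric B r)) by apply: is_cvg_geometric_series; rewrite ger0_norm.
have cn : cvgn [normed series u].
  by apply: (series_le_cvg _ _ _ cg) => k /=; rewrite ?(le_trans _ (h k)).
have /cvg_ex[s hs] := normed_cvg cn.
exists s; have -> : (fun n => \sum_(k < n) u k) = series u.
  by apply/funext => n; rewrite /series /= big_mkord.
exact: hs.
Qed.

Lemma ccvg_series_dom (u : nat -> C) (B r : R) : 0 <= r -> r < 1 ->
  (forall k, normc (u k) <= B * r ^+ k) -> exists s, ccvg (fun n => \sum_(k < n) u k) s.
Proof.
move=> r0 r1 h.
have [a ha] := cvg_series_geom_dom r0 r1 (fun k => le_trans (normc_Re (u k)) (h k)).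
have [b hb] := cvg_series_geom_dom r0 r1 (fun k => le_trans (normc_Im (u k)) (h k)).
exists (a +i* b); apply/ccvgP; split => /=.
  by under eq_fun do rewrite Re_sum.
by under eq_fun do rewrite Im_sum.
Qed.

Lemma normc_series_le (u : nat -> C) (s : C) (B r : R) : 0 <= r -> r < 1 ->
  (forall k, normc (u k) <= B * r ^+ k) -> ccvg (fun n => \sum_(k < n) u k) s ->
  normc s <= B / (1 - r).
Proof.
move=> r0 r1 h hs.
have B0 : 0 <= B by have := h 0%N; rewrite expr0 mulr1; apply: le_trans; exact: normc_ge0.
have C0 : 0 <= B / (1 - r) by rewrite divr_ge0 // subr_ge0 ltW.
rewrite -(@ler_pXn2r _ 2) ?nnegrE ?normc_ge0 // -sqn_normc.
apply: (@ler_cvg_to _ (nbhs \oo) _ _ (fun n => sqn (\sum_(k < n) u k))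
  (fun=> (B / (1 - r)) ^+ 2)).
- exact: ccvg_sqn.
- exact: cvg_cst.
near=> n; rewrite sqn_normc lerXn2r ?nnegrE ?normc_ge0 //.
apply: (le_trans (normc_sum _ _ _)).
apply: (@le_trans _ _ (\sum_(k < n) B * r ^+ k)); first by apply: ler_sum.
by rewrite -mulr_sumr ler_wpM2l // geom_bound.
Unshelve. all: by end_near. Qed.

Lemma sqrt_itv (r : R) : 0 < r -> r < 1 -> 0 < Num.sqrt r /\ Num.sqrt r < 1.
Proof.
by move=> r0 r1; rewrite sqrtr_gt0 r0 -[X in _ < X]sqrtr1 ltr_sqrt.
Qed.

Lemma normcX (z : C) k : normc (z ^+ k) = normc z ^+ k.
Proof. by elim: k => [|k ih]; rewrite ?expr0 ?Normc.normc1 // !exprS Normc.normcM ih. Qed.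

Lemma has_psum_exists c z : disc_coef c -> normc z < 1 -> exists s, has_psum c z s.
Proof.
move=> hc z1; pose r := (normc z + 1) / 2; have z0 := normc_ge0 z.
have r0 : 0 < r by rewrite divr_gt0 // ltr_wpDl.
have r1 : r < 1 by rewrite ltr_pdivrMr // mul1r; lra.
have zr : normc z <= r by rewrite ler_pdivlMr //; lra.
(* Writing $r = q^2$, one factor $q^k$ bounds the coefficient and the other remains as the ratio of
   a convergent geometric majorant. *)
have [q0 q1] := sqrt_itv r0 r1; set q := Num.sqrt r in q0 q1.
have [B hB] := hc q q0 q1.
suff h : forall k, normc (c k * z ^+ k) <= B * q ^+ k.
  exact: (ccvg_series_dom (ltW q0) q1 h).
move=> k.
rewrite Normc.normcM normcX; apply: (@le_trans _ _ (normc (c k) * r ^+ k)).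
  by rewrite ler_wpM2l ?normc_ge0 // lerXn2r ?nnegrE // ltW.
have -> : r = q * q by rewrite -expr2 sqr_sqrtr // ltW.
rewrite exprMn mulrA ler_wpM2r ?hB //.
by rewrite exprn_ge0 // ltW.
Qed.

(** The factor $r^2$ on the left avoids the exponent $k-2$. With $E_k$ the remainder, $E_{k+1} =
    (z+h)E_k + k z^{k-1}h^2$, and the induction closes by $k^2+k \le (k+1)^2$. *)
Lemma normc_expr_taylor (z h : C) (r : R) k : 0 < r -> normc z <= r -> normc (z + h) <= r ->
  r ^+ 2 * normc ((z + h) ^+ k - z ^+ k - h * (k%:R * z ^+ k.-1)) <=
  k%:R ^+ 2 * r ^+ k * normc h ^+ 2.
Proof.
move=> r0 zr zhr; elim: k => [|k ih].
  by rewrite !expr0 subrr mul0r mulr0 subr0 Normc.normc0 mulr0 expr0n !mul0r.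
set E := (X in normc X) in ih.
have -> : (z + h) ^+ k.+1 - z ^+ k.+1 - h * (k.+1%:R * z ^+ k.+1.-1) =
    (z + h) * E + k%:R * z ^+ k.-1 * h ^+ 2.
  rewrite /E /=; case: k {ih E} => [|k]; first by rewrite !expr0 !expr1; ring.
  by rewrite /= -[k.+2%:R]natr1 !exprS; ring.
apply: (le_trans (ler_wpM2l (exprn_ge0 2 (ltW r0)) (le_normcD _ _))).
rewrite mulrDr !Normc.normcM !normcX normc_nat.
apply: (@le_trans _ _ ((k%:R ^+ 2 + k%:R) * r ^+ k.+1 * normc h ^+ 2)); last first.
  apply: ler_wpM2r; first exact: sqr_ge0.
  apply: ler_wpM2r; first by rewrite exprn_ge0 // ltW.
  by rewrite -natr1 sqrrD1 mulr2n; have : 0 <= k%:R :> R by []; lra.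
rewrite !mulrDl lerD //.
  rewrite mulrCA; apply: (@le_trans _ _ (r * (k%:R ^+ 2 * r ^+ k * normc h ^+ 2))).
    apply: ler_pM => //; first exact: normc_ge0.
    by rewrite mulr_ge0 ?normc_ge0 // exprn_ge0 // ltW.
  by rewrite (exprS r k) le_eqVlt; apply/orP; left; apply/eqP; ring.
rewrite -expr2; case: k {ih E} => [|k]; first by rewrite !mul0r mulr0.
rewrite mulrA; apply: ler_wpM2r; first exact: sqr_ge0.
rewrite mulrCA; apply: ler_wpM2l => //=.
rewrite -[k.+2]/(2 + k)%N exprD; apply: ler_wpM2l; first exact: sqr_ge0.
by rewrite lerXn2r ?nnegrE ?normc_ge0 // ltW.
Qed.

Lemma ccvg_shiftS (u : nat -> C) l : ccvg (fun n => u n.+1) l <-> ccvg u l.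
Proof.
by split=> /ccvgP[hr hi]; apply/ccvgP; split;
  [rewrite -cvg_shiftS|rewrite -cvg_shiftS
  |rewrite (cvg_shiftS (fun n => complex.Re (u n)))
  |rewrite (cvg_shiftS (fun n => complex.Im (u n)))].
Qed.

Lemma psum_qderiv c (F F1 : C -> C) : disc_coef c ->
  (forall z, normc z < 1 -> has_psum c z (F z)) ->
  (forall z, normc z < 1 -> has_psum (dcoef c) z (F1 z)) ->
  forall z, normc z < 1 -> qderiv F z (F1 z).
Proof.
move=> hc hF hF1 z z1; pose r := (normc z + 1) / 2; have z0 := normc_ge0 z.
have r0 : 0 < r by rewrite divr_gt0 // ltr_wpDl.
have r1 : r < 1 by rewrite ltr_pdivrMr // mul1r; lra.
have zr : normc z < r by rewrite ltr_pdivlMr //; lra.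
have [s0 s1] := sqrt_itv r0 r1; have [q0 q1] := sqrt_itv s0 s1.
set s := Num.sqrt r in s0 s1 q0 q1; set q := Num.sqrt s in q0 q1.
(* The four factors of $r^k = q^{4k}$ are shared out: one bounds the coefficient by [B], two bound
   $k^2$ by $M^2$, and the last gives a geometric series. *)
have rq : r = q ^+ 4.
  have <- : s ^+ 2 = r by rewrite sqr_sqrtr // ltW.
  have <- : q ^+ 2 = s by rewrite sqr_sqrtr // ltW.
  by rewrite -exprM.
have [B hB] := hc q q0 q1; have [M hM] := expr_lin_bound q0 q1.
have B0 : 0 <= B by have := hB 0%N; rewrite expr0 mulr1; apply: le_trans; exact: normc_ge0.
have M0 : 0 <= M by have := hM 0%N; rewrite mul0r.
pose K := B * M ^+ 2 / r ^+ 2.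
exists (K / (1 - q)), (r - normc z); split.
- by rewrite !mulr_ge0 ?invr_ge0 ?subr_ge0 ?exprn_ge0 ?(ltW q1) ?(ltW r0).
- by rewrite subr_gt0.
move=> h hr.
have zhr : normc (z + h) < r by apply: (le_lt_trans (le_normcD _ _)); rewrite addrC -ltrBrDr.
have zh1 := lt_trans zhr r1.
pose E k := (z + h) ^+ k - z ^+ k - h * (k%:R * z ^+ k.-1).
have hs : ccvg (fun n => \sum_(k < n) c k * E k) (F (z + h) - F z - h * F1 z).
  (* Differentiation lowers degrees by one, so [n + 1] terms of the series are matched with [n]
     terms of its derivative. *)
  have step (n : nat) : \sum_(k < n.+1) c k * E k = \sum_(k < n.+1) c k * (z + h) ^+ k -
      \sum_(k < n.+1) c k * z ^+ k - h * \sum_(k < n) dcoef c k * z ^+ k.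
    have -> : h * \sum_(k < n) dcoef c k * z ^+ k = \sum_(k < n.+1) c k * (h * (k%:R * z ^+ k.-1)).
      rewrite [RHS]big_ord_recl mul0r !mulr0 add0r mulr_sumr; apply: eq_bigr => k _.
      by rewrite lift0 /dcoef /=; ring.
    rewrite -!sumrB; apply: eq_bigr => k _; rewrite /E; ring.
  apply/ccvg_shiftS; under [X in ccvg X]funext do rewrite step.
  apply: ccvgD; last by apply: ccvgN; apply: ccvgM; [exact: ccvg_cst|exact: hF1].
  have hFS w : normc w < 1 -> ccvg (fun n => \sum_(k < n.+1) c k * w ^+ k) (F w).
    by move=> w1; apply/(ccvg_shiftS (fun n => \sum_(k < n) c k * w ^+ k)); exact: hF.
  by apply: ccvgD; [exact: hFS|apply: ccvgN; exact: hFS].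
rewrite mulrAC; suff hk : forall k, normc (c k * E k) <= K * normc h ^+ 2 * q ^+ k.
  exact: (normc_series_le (ltW q0) q1 hk hs).
move=> k.
rewrite Normc.normcM.
have r20 : 0 < r ^+ 2 by rewrite exprn_gt0.
have := normc_expr_taylor k r0 (ltW zr) (ltW zhr); rewrite -/(E k) mulrC -ler_pdivlMr // => hE.
apply: (le_trans (ler_wpM2l (normc_ge0 _) hE)).
have -> : normc (c k) * (k%:R ^+ 2 * r ^+ k * normc h ^+ 2 / r ^+ 2) =
  (normc (c k) * q ^+ k) * (k%:R * q ^+ k) ^+ 2 * (normc h ^+ 2 / r ^+ 2 * q ^+ k).
  by rewrite {1}rq -exprM mulnC exprM !exprS expr0; ring.
have -> : K * normc h ^+ 2 * q ^+ k = B * M ^+ 2 * (normc h ^+ 2 / r ^+ 2 * q ^+ k).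
  by rewrite /K; ring.
apply: ler_wpM2r.
  by rewrite mulr_ge0 ?(exprn_ge0 _ (ltW q0)) // divr_ge0 ?sqr_ge0.
have qk : 0 <= q ^+ k by rewrite exprn_ge0 // ltW.
apply: ler_pM => //.
- by rewrite mulr_ge0 ?normc_ge0.
- exact: sqr_ge0.
by rewrite lerXn2r ?nnegrE // mulr_ge0.
Qed.

End ComplexDerivative.

(** * Taylor coefficients of the exponential of a power series *)

Section TaylorExp.
Context {R : realType}.
Local Notation C := R[i].
Local Notation normc := Normc.normc.

(** The value is 0 by default where the series diverges; the statements below evaluate it inside the
    unit disc. *)
Definition psum (c : nat -> C) (z : C) : C := xget 0 (has_psum c z).

Lemma psumP c z : disc_coef c -> normc z < 1 -> has_psum c z (psum c z).
Proof. by move=> hc z1; have [s hs] := has_psum_exists hc z1; apply: xgetPex; exists s. Qed.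

Lemma psum0 c : disc_coef c -> psum c 0 = c 0%N.
Proof.
move=> hc; have z1 : normc (0 : C) < 1 by rewrite Normc.normc0.
apply: (ccvg_unique (psumP hc z1)); apply/ccvg_shiftS.
apply: (@ccvg_eq _ (fun=> c 0%N)); last exact: ccvg_cst.
near=> n; rewrite big_ord_recl big1 ?expr0 ?mulr1 ?addr0 // => i _.
by rewrite lift0 expr0n mulr0.
Unshelve. all: by end_near. Qed.

Lemma disc_iter_dcoef (c : nat -> C) k : disc_coef c -> disc_coef (iter k dcoef c).
Proof. by move=> hc; elim: k => [|k ih] //; exact: disc_dcoef. Qed.

Lemma iter_dcoefE (c : nat -> C) k j : iter k dcoef c j * j`!%:R = (j + k)`!%:R * c (j + k)%N.
Proof.
elim: k j => [|k ih] j; first by rewrite addn0 mulrC.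
rewrite iterS /dcoef addnS -addSn -ih factS natrM; ring.
Qed.

Lemma disc_nbhs (z : C) : normc z < 1 -> \forall w \near (z : C^o), normc w < 1.
Proof.
move=> z1; have e0 : (0 : C) < (1 - normc z)%:C by rewrite ltcR subr_gt0.
have := @nbhsx_ballx _ _ (z : C^o) _ e0; apply: filterS => w /=.
rewrite -ball_normE /= => h.
have {}h : normc (z - w) < 1 - normc z by rewrite -ltcR -normrE; exact: h.
have -> : w = z + - (z - w) by ring.
apply: (le_lt_trans (le_normcD _ _)); rewrite normcN; lra.
Qed.

Lemma psum_is_derive c (z : C) : disc_coef c -> normc z < 1 ->
  is_derive (z : C^o) (1 : C^o) (psum c : C^o -> C^o) (psum (dcoef c) z : C^o).
Proof.
move=> hc z1; apply: qderiv_is_derive.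
by apply: (psum_qderiv hc) => // w w1; apply: psumP => //; exact: disc_dcoef.
Qed.

Lemma exp_psum_is_derive c (f : C -> C) (z : C) : disc_coef c ->
  (forall w, normc w < 1 -> f w = expC (- psum c w)) -> normc z < 1 ->
  is_derive (z : C^o) (1 : C^o) (f : C^o -> C^o) (- psum (dcoef c) z * f z : C^o).
Proof.
move=> hc hf z1.
have h : is_derive (z : C^o) (1 : C^o) ((fun w => expC (- psum c w)) : C^o -> C^o)
    (- psum (dcoef c) z * f z : C^o).
  rewrite hf //; apply/qderiv_is_derive/qderiv_expCN.
  by apply: (psum_qderiv hc) => // w w1; apply: psumP => //; exact: disc_dcoef.
apply: near_eq_is_derive h.
by apply: filterS (disc_nbhs z1) => w w1; rewrite hf.
Qed.

Lemma is_derive_eq_imp (f : C^o -> C^o) (z d d' : C^o) : d = d' ->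
  is_derive z (1 : C^o) f d -> is_derive z (1 : C^o) f d'.
Proof. by move=> ->. Qed.

(** The induction step of Leibniz' rule, from Pascal's rule for binomial coefficients. *)
Lemma pascal_sum (A B : nat -> C) n :
  \sum_(k < n.+1) 'C(n, k)%:R * (A k.+1 * B (n - k)%N + A k * B (n - k).+1) =
  \sum_(k < n.+2) 'C(n.+1, k)%:R * (A k * B (n.+1 - k)%N).
Proof.
rewrite [RHS]big_ord_recl bin0 subn0 mul1r.
under [in RHS]eq_bigr do rewrite lift0 /= binS subSS natrD mulrDl.
rewrite big_split /= addrA.
under eq_bigr do rewrite mulrDr.
rewrite big_split /= addrC; congr (_ + _).
rewrite [in RHS]big_ord_recr /= bin_small // mul0r addr0.
rewrite big_ord_recl bin0 subn0 mul1r; congr (_ + _); apply: eq_bigr => k _.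
by rewrite lift0 subnSK.
Qed.

(** Leibniz' rule applied to $f' = -F'f$. The formula is proved on the whole disc, since
    differentiating it once more requires it in a neighbourhood of the point; strong induction
    supplies the derivatives of all lower orders occurring in the sum. *)
Lemma derive1n_exp_psum c (f : C -> C^o) : disc_coef c ->
  (forall w, normc w < 1 -> f w = expC (- psum c w)) ->
  forall n z, normc z < 1 -> is_derive (z : C^o) (1 : C^o) ((f^`(n))%classic : C^o -> C^o)
   (- \sum_(k < n.+1) 'C(n, k)%:R * (psum (iter k.+1 dcoef c) z * (f^`(n - k))%classic z) : C^o).
Proof.
move=> hc hf; elim/ltn_ind => n ih z z1.
case: n ih => [|n] ih.
  rewrite big_ord1 bin0 mul1r subn0 /= -mulNr.
  exact: exp_psum_is_derive.
have hD m w : (m <= n)%N -> normc w < 1 -> (f^`(m.+1))%classic w =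
  - \sum_(k < m.+1) 'C(m, k)%:R * (psum (iter k.+1 dcoef c) w * (f^`(m - k))%classic w).
  move=> mn w1; rewrite derive1nS derive1E.
  by have h := ih m mn w w1; rewrite derive_val.
pose G (w : C^o) : C^o := - \sum_(k < n.+1) 'C(n, k)%:R * (psum (iter k.+1 dcoef c) w * (f^`(n - k))%classic w).
suff h : is_derive (z : C^o) (1 : C^o) G (- \sum_(k < n.+2) 'C(n.+1, k)%:R *
    (psum (iter k.+1 dcoef c) z * (f^`(n.+1 - k))%classic z) : C^o).
  apply: near_eq_is_derive h.
  by apply: filterS (disc_nbhs z1) => w w1; rewrite hD.
have -> : \sum_(k < n.+2) 'C(n.+1, k)%:R *
    (psum (iter k.+1 dcoef c) z * (f^`(n.+1 - k))%classic z) =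
  \sum_(k < n.+1) 'C(n, k)%:R * (psum (iter k.+2 dcoef c) z * (f^`(n - k))%classic z +
    psum (iter k.+1 dcoef c) z * (f^`((n - k).+1))%classic z).
  exact: (esym (pascal_sum (fun k => psum (iter k.+1 dcoef c) z)
     (fun k => (f^`(k))%classic z) n)).
have term (k : 'I_n.+1) : is_derive (z : C^o) (1 : C^o)
    ((fun w => 'C(n, k)%:R * (psum (iter k.+1 dcoef c) w * (f^`(n - k))%classic w)) : C^o -> C^o)
    ('C(n, k)%:R * (psum (iter k.+2 dcoef c) z * (f^`(n - k))%classic z +
    psum (iter k.+1 dcoef c) z * (f^`((n - k).+1))%classic z) : C^o).
  have nk : (n - k <= n)%N by exact: leq_subr.
  have d1 := psum_is_derive (disc_iter_dcoef k.+1 hc) z1.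
  have d2 := ih (n - k)%N nk z z1; rewrite -(hD _ _ nk z1) in d2.
  have d0 : is_derive (z : C^o) (1 : C^o) ((fun=> 'C(n, k)%:R) : C^o -> C^o) (0 : C^o).
    exact: is_derive_cst.
  have := is_deriveM d0 (is_deriveM d1 d2).
  apply: is_derive_eq_imp.
  rewrite /GRing.scale /= mulr0 addr0; congr (_ * _).
  by rewrite addrC mulrC.
have := is_deriveN (is_derive_sum term).
by congr is_derive; apply/funext => w; rewrite /G /= fctE /= fct_sumE.
Qed.

(** At 0 the [k]-th derivative of the series is $k!\,c_k$, and the factorials turn Leibniz' rule
    into the recursion characterizing [fexp]. The condition on [c 0] makes the constant coefficient
    equal to 1. *)
Lemma taylor_coef_exp_psum c (f : C -> C^o) : disc_coef c -> c 0%N = 0 ->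
  (forall w, normc w < 1 -> f w = expC (- psum c w)) ->
  forall n, taylor_coef f n = fexp (fun k => - c k) n.
Proof.
move=> hc c0 hf; have z1 : normc (0 : C) < 1 by rewrite Normc.normc0.
have factn0 (n : nat) : n`!%:R != 0 :> C by rewrite pnatr_eq0 -lt0n fact_gt0.
apply: fexp_unique.
  rewrite /taylor_coef derive1n0 hf // psum0 // c0 oppr0 fact0 divr1.
  by rewrite /expC /= expR0 cos0 sin0 mul1r.
move=> n; rewrite /taylor_coef derive1nS derive1E.
have h := derive1n_exp_psum hc hf n z1; rewrite derive_val.
have n0 : n.+1%:R != 0 :> C by rewrite pnatr_eq0.
have it k : iter k dcoef c 0%N = k`!%:R * c k.
  by have := iter_dcoefE c k 0; rewrite fact0 mulr1 add0n.
rewrite factS natrM invfM mulrCA [X in _ * X]mulrA divff // mul1r mulNr mulr_suml -sumrN.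
apply: eq_bigr => k _; have kn : (k <= n)%N by rewrite -ltnS.
rewrite psum0; last exact: disc_iter_dcoef.
rewrite it factS natrM -[in LHS](bin_fact kn) !natrM.
have := factn0 k; have := factn0 (n - k)%N.
have : 'C(n, k)%:R != 0 :> C by rewrite pnatr_eq0 -lt0n bin_gt0.
move: (k`!%:R : C) ((n - k)`!%:R : C) ('C(n, k)%:R : C) ((f^`(n - k))%classic 0) (k.+1%:R : C) (c k.+1).
by move=> x y b d e g b0 y0 x0; field; rewrite x0 y0 b0.
Qed.

End TaylorExp.

(** * The function on the circle as a weight, and the coefficients [c_seq] *)

Section Weight.
Context {R : realType}.
Local Notation C := R[i].
Local Notation T := (`[- pi, pi]%classic : set R).
Local Notation mu := (@lebesgue_measure R).
Variable a : C -> R.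
Hypothesis a_L1 : L1_circle (EFin \o a).
Hypothesis loga_L1 : L1_circle (log_circle a).

Definition weight (t : R) : R := a (expi t).
(** Real-valued: [ln] is 0 at nonpositive arguments, where [lne] is infinite. The two differ on a
    null set only, by [ae_log_weight]. *)
Definition log_weight (t : R) : R := ln (weight t).

Lemma integ_weight : integ weight.
Proof. exact: a_L1. Qed.

Lemma measurable_log_weight : measurable_fun T log_weight.
Proof.
exact: (measurableT_comp (@measurable_ln R) (integ_measurable integ_weight)).
Qed.

Lemma integ_log_weight : integ log_weight.
Proof.
apply: (@le_integrable _ _ _ _ _ measurable_circle _ (log_circle a \o expi)) => //.
  by apply/measurable_EFinP; exact: measurable_log_weight.
move=> t _; rewrite /log_weight /weight /log_circle /=.
by case: ifP => // h; rewrite ln0 // normr0 /= leey.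
Qed.

(** An integrable function is finite almost everywhere, whereas [lne] is $-\infty$ at nonpositive
    arguments. *)
Lemma ae_log_weight :
  {ae mu, forall t, T t -> 0 < weight t /\ log_circle a (expi t) = (log_weight t)%:E}.
Proof.
have := integrable_ae measurable_circle loga_L1; apply: ae_imp => t h /h.
rewrite /= /log_circle /log_weight /weight /=.
by case: leP.
Qed.

Lemma weight_exp : {ae mu, forall t, T t -> weight t = expR (log_weight t)}.
Proof.
by move: ae_log_weight; apply: ae_imp => t h /h[w0 _]; rewrite lnK.
Qed.

Lemma circle_mean_log (w : R -> R) : measurable_fun T w ->
  circle_mean (log_circle a) w = mean (fun t => log_weight t * w t).
Proof.
move=> mw; congr (_ * fine _); apply: ae_eq_integral => //.
- apply: emeasurable_funM; last exact/measurable_EFinP.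
  exact: measurable_int loga_L1.
- apply/measurable_EFinP; apply: measurable_funM => //; exact: measurable_log_weight.
- by move: ae_log_weight; apply: ae_imp => t h Tt; have [_ ->] := h Tt; rewrite EFinM.
Qed.

Lemma fcoef_parts (f : R -> R) (k : int) : integ f -> fcoef f k =
  mean (fun t => f t * cos (k%:~R * t)) -i* mean (fun t => f t * sin (k%:~R * t)).
Proof.
move=> fi; have [bc bs] := cbdd_expik (R := R) k.
apply/eqP; rewrite eq_complex /= -meanN; last exact: integM.
apply/andP; split; apply/eqP; congr mean; apply/funext => t.
  by rewrite mul0r subr0 mulrNz mulNr cosN.
by rewrite mul0r addr0 mulrNz mulNr sinN mulrN.
Qed.

Lemma fourier_coef_weight (k : int) : fourier_coef (EFin \o a) k = fcoef weight k.
Proof. by rewrite (fcoef_parts k integ_weight). Qed.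

Lemma fourier_coef_log (k : int) : fourier_coef (log_circle a) k = fcoef log_weight k.
Proof.
have [[mc _] [ms _]] := cbdd_expik (R := R) k.
rewrite (fcoef_parts k integ_log_weight) /fourier_coef.
by rewrite (circle_mean_log mc) (circle_mean_log ms).
Qed.

Lemma geom_meanE : geom_mean a = expR (mean log_weight).
Proof.
congr expR; rewrite circle_mean_log; last exact: measurable_cst.
by congr mean; apply/funext => t; rewrite mulr1.
Qed.

Definition log_coef (k : nat) : C := if k is 0%N then 0 else fcoef log_weight k.

Lemma disc_log_coef : disc_coef log_coef.
Proof.
move=> r r0 r1; exists (2 * mean (fun t => `|log_weight t|)) => k.
apply: (@le_trans _ _ (Normc.normc (log_coef k))).
  by rewrite ler_piMr ?normc_ge0 // exprn_ile1 // ltW.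
case: k => [|k]; last exact: normc_fcoef integ_log_weight.
by rewrite Normc.normc0 mulr_ge0 // mean_ge0.
Qed.

Lemma a_plus_invE (z : C) : Normc.normc z < 1 -> a_plus_inv a z = expC (- psum log_coef z).
Proof.
move=> z1; rewrite /a_plus_inv; congr (expC (- _)); apply: ccvg_lim.
have : ccvg (fun n => \sum_(k < n.+1) log_coef k * z ^+ k) (psum log_coef z).
  apply/(ccvg_shiftS (fun n => \sum_(k < n) log_coef k * z ^+ k)).
  exact: psumP disc_log_coef z1.
congr ccvg; apply/funext => n.
rewrite big_ord_recl mul0r add0r /series /= big_mkord; apply: eq_bigr => k _.
by rewrite /bump leq0n add1n fourier_coef_log.
Qed.

Lemma c_seqE (j : nat) :
  c_seq a j = (expR (- mean log_weight))%:C * fexp (fun k => - fcoef log_weight k) j.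
Proof.
rewrite /c_seq geom_meanE expRN (taylor_coef_exp_psum disc_log_coef _ a_plus_invE) //.
congr (_ * _); exact: fexp_ext.
Qed.

End Weight.

(** * Inverses of Toeplitz matrices *)

Section InverseToeplitz.
Context {R : realType}.
Local Notation C := R[i].
Local Notation T := (`[- pi, pi]%classic : set R).
Local Notation mu := (@lebesgue_measure R).

(** By Lagrange's identity: the double sum of squares $(x_iy_j-x_jy_i)^2$ is twice the difference of
    the two sides. *)
Lemma cauchy_schwarz_sum n (x y : 'I_n -> R) :
  (\sum_i x i * y i) ^+ 2 <= (\sum_i x i ^+ 2) * (\sum_i y i ^+ 2).
Proof.
suff : 0 <= \sum_i \sum_j (x i * y j - x j * y i) ^+ 2.
  have -> : \sum_i \sum_j (x i * y j - x j * y i) ^+ 2 =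
     2 * ((\sum_i x i ^+ 2) * (\sum_i y i ^+ 2) - (\sum_i x i * y i) ^+ 2).
    transitivity (\sum_i \sum_j (x i ^+ 2 * y j ^+ 2 + x j ^+ 2 * y i ^+ 2 -
        2 * ((x i * y i) * (x j * y j)))).
      by apply: eq_bigr => i _; apply: eq_bigr => j _; ring.
    have e1 : \sum_i \sum_j x i ^+ 2 * y j ^+ 2 = (\sum_i x i ^+ 2) * (\sum_i y i ^+ 2).
      by rewrite mulr_suml; apply: eq_bigr => i _; rewrite mulr_sumr.
    have e2 : \sum_i \sum_j x j ^+ 2 * y i ^+ 2 = (\sum_i x i ^+ 2) * (\sum_i y i ^+ 2).
      by rewrite exchange_big /= -e1.
    have e3 : \sum_i \sum_j 2 * ((x i * y i) * (x j * y j)) = 2 * (\sum_i x i * y i) ^+ 2.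
      rewrite expr2 mulr_suml mulr_sumr; apply: eq_bigr => i _.
      by rewrite mulr_sumr mulr_sumr.
    under eq_bigr do rewrite sumrB big_split /=.
    rewrite sumrB big_split /= e1 e2 e3; ring.
  by rewrite pmulr_rge0 // subr_ge0.
by apply: sumr_ge0 => i _; apply: sumr_ge0 => j _; exact: sqr_ge0.
Qed.

Lemma sqn_sum_le n (x y : 'I_n -> C) :
  sqn (\sum_i x i * y i) <= (\sum_i sqn (x i)) * (\sum_i sqn (y i)).
Proof.
have E (z : 'I_n -> C) : \sum_i sqn (z i) = \sum_i Normc.normc (z i) ^+ 2.
  by apply: eq_bigr => i _; rewrite sqn_normc.
rewrite sqn_normc !E.
apply: le_trans (cauchy_schwarz_sum _ _).
rewrite lerXn2r ?nnegrE ?normc_ge0 ?sumr_ge0 // => [i _|].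
  by rewrite mulr_ge0 ?normc_ge0.
apply: (le_trans (normc_sum _ _ _)); apply: ler_sum => i _.
by rewrite Normc.normcM.
Qed.

Variables (A lam : R -> R).
Hypotheses (Ai : integ A) (lami : integ lam).
Hypothesis A_exp : {ae mu, forall t, T t -> A t = expR (lam t)}.

Local Notation G := (expR (mean lam)).
(** The coefficients of $1/h$, where $h$ is the formal exponential of $\sum_{k\ge1} l_kz^k$ with
    $l_k$ the Fourier coefficients of [lam]. *)
Let alpha := fexp (fun k => - fcoef lam k).

Definition wnorm (p : {poly C}) : R := mean (fun t => A t * sqn p.[expik 1 t]).

(* The entry (i, j) of the limit of the upper left corners of the inverses. *)
Definition inv_lim (i j : nat) : C :=
  \sum_(t < i.+1) (\poly_(s < j.+1) (G^-1%:C * conjc (alpha (j - s))))`_t * alpha (i - t).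

Definition inv_lim_diag (j : nat) : R := G^-1 * \sum_(t < j.+1) sqn (alpha (j - t)).

Lemma inv_lim_diagE j : inv_lim j j = (inv_lim_diag j)%:C.
Proof.
rewrite /inv_lim /inv_lim_diag rmorphM rmorph_sum mulr_sumr; apply: eq_bigr => t _.
by rewrite coef_poly ltn_ord /= -sqnE [alpha _ * _]mulrC mulrA.
Qed.

Lemma inv_lim_diag_ge0 j : 0 <= inv_lim_diag j.
Proof.
by rewrite mulr_ge0 ?invr_ge0 ?expR_ge0 // sumr_ge0 // => t _; exact: sqn_ge0.
Qed.

(** Since $p = (ph)\cdot(1/h)$, the coefficient $p_k$ pairs the first $k+1$ coefficients of $ph$
    with those of $1/h$. Cauchy-Schwarz separates the two, and [szego_lower] bounds the first
    factor. *)
Lemma coef_le_wnorm (p : {poly C}) k : sqn p`_k <= inv_lim_diag k * wnorm p.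
Proof.
pose h := fexp (fun j => fcoef lam j).
pose r i := \sum_(t < i.+1) p`_t * h (i - t)%N.
have -> : p`_k = \sum_(i < k.+1) r i * alpha (k - i).
  (* Truncations beyond degree [k] do not affect the coefficient in question and turn the formal
     series into polynomials. *)
  pose H := \poly_(i < k.+1) h i; pose L := \poly_(i < k.+1) alpha i.
  have HL i : (i < k.+1)%N -> (H * L)`_i = (i == 0%N)%:R.
    move=> ik; rewrite coefM -(fexpVM (fun j => fcoef lam j) i); apply: eq_bigr => t _.
    rewrite !coef_poly (leq_ltn_trans _ ik) ?(leq_ltn_trans _ ik) ?leq_subr //.
    by rewrite -ltnS.
  transitivity ((p * (H * L))`_k).
    rewrite coefM big_ord_recr /= subnn HL // mulr1 big1 ?add0r // => i _.
    rewrite HL; last by rewrite ltnS leq_subr.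
    by rewrite subn_eq0 leqNgt ltn_ord mulr0.
  rewrite mulrA coefM; apply: eq_bigr => i _; congr (_ * _).
    rewrite /r coefM; apply: eq_bigr => t _; congr (_ * _); rewrite coef_poly.
    by rewrite (leq_ltn_trans (leq_subr _ _) (ltn_ord i)).
  by rewrite coef_poly ltnS leq_subr.
apply: (le_trans (sqn_sum_le _ _)); rewrite mulrC /inv_lim_diag -mulrA mulrCA.
rewrite ler_wpM2l ?sumr_ge0 // => [t _|]; first exact: sqn_ge0.
by rewrite -expRN; exact: szego_lower.
Qed.

(** The polynomial [q] is chosen so that $q/h$ has column [j] of the limit as its coefficients, and
    $G$ times the sum of the squared moduli of the coefficients of [q] is exactly the diagonal
    entry. *)
Lemma inv_lim_approx j m (d : R) : 0 < d -> exists p : {poly C},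
  wnorm p <= inv_lim_diag j + d /\
  forall i, (i < m)%N -> sqn (p`_i - inv_lim i j) <= d.
Proof.
move=> d0; pose q := \poly_(s < j.+1) (G^-1%:C * conjc (alpha (j - s))).
have [p [p1 p2]] := szego_upper Ai lami A_exp q m d0.
exists p; split => //; apply: (le_trans p1); rewrite lerD2r.
rewrite (@parseval _ _ j.+1) ?size_poly // mulr_sumr /inv_lim_diag mulr_sumr.
apply: ler_sum => t _; rewrite coef_poly ltn_ord sqnM sqnJ.
have -> : sqn G^-1%:C = G^-1 ^+ 2 by rewrite /sqn /= expr0n addr0.
by rewrite expr2 !mulrA mulfV ?mul1r // gt_eqF // expR_gt0.
Qed.

Definition toepl n : 'M[C]_n := \matrix_(j, k) fcoef A ((j : nat)%:Z - (k : nat)%:Z).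

Lemma form_toepl n (u : 'cV[C]_n) :
  \sum_j \sum_k conjc (u j 0) * toepl n j k * u k 0 = (wnorm (rVpoly u^T))%:C.
Proof.
rewrite /wnorm (@mean_sqn_horner _ _ _ n) //; last exact: size_poly.
apply: eq_bigr => j _; apply: eq_bigr => k _.
by rewrite !coef_rVpoly_ord !mxE.
Qed.

Lemma wnorm_ge0 p : 0 <= wnorm p.
Proof.
rewrite -(mean_cst 0); apply: ae_ler_mean; first exact: integ_cst.
  by apply: integM => //; exact: bdd_sqn_horner.
by move: A_exp; apply: ae_imp => t h /h ->; rewrite mulr_ge0 ?expR_ge0 ?sqn_ge0.
Qed.

Lemma toepl_conj n (j k : 'I_n) : conjc (toepl n j k) = toepl n k j.
Proof. by rewrite !mxE fcoefJ // opprB. Qed.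

Lemma toepl_rev n (j k : 'I_n) : toepl n (rev_ord j) (rev_ord k) = toepl n k j.
Proof.
rewrite !mxE; congr fcoef; rewrite /=.
by have := ltn_ord j; have := ltn_ord k; lia.
Qed.

(** Reversing and conjugating the coefficients preserves the quadratic form, by [toepl_rev]; it
    carries estimates at the head of a vector over to its tail. *)
Lemma wnorm_rev n (u : 'cV[C]_n) :
  wnorm (rVpoly (\col_i conjc (u (rev_ord i) 0))^T) = wnorm (rVpoly u^T).
Proof.
apply: complexI; rewrite -!form_toepl exchange_big /= (reindex_inj rev_ord_inj).
apply: eq_bigr => j _; rewrite (reindex_inj rev_ord_inj); apply: eq_bigr => k _.
have E l : (\col_i conjc (u (rev_ord i) 0)) (rev_ord l) 0 = conjc (u l 0).
  by rewrite mxE rev_ordK.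
by rewrite toepl_rev !E conjcK mulrC mulrA mulrAC.
Qed.

Lemma head_le_wnorm n (u : 'cV[C]_n) (i : 'I_n) :
  sqn (u i 0) <= inv_lim_diag i * wnorm (rVpoly u^T).
Proof. by have := coef_le_wnorm (rVpoly u^T) i; rewrite coef_rVpoly_ord mxE. Qed.

Lemma tail_le_wnorm n (u : 'cV[C]_n) (i : 'I_n) :
  sqn (u i 0) <= inv_lim_diag (rev_ord i) * wnorm (rVpoly u^T).
Proof.
by rewrite -wnorm_rev; have := head_le_wnorm (\col_k conjc (u (rev_ord k) 0)) (rev_ord i);
  rewrite mxE rev_ordK sqnJ.
Qed.

Lemma toepl_unit n : toepl n \in unitmx.
Proof.
rewrite unitmxE unitfE; apply/negP => /det0P[v v0 vT].
(* [det0P] yields a row vector annihilated from the left; its conjugate transpose has zero quadratic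
   form, so all its entries vanish by [head_le_wnorm]. *)
pose u : 'cV[C]_n := \col_i conjc (v 0 i).
have w0 : wnorm (rVpoly u^T) = 0.
  apply: complexI; rewrite -form_toepl exchange_big big1 //= => k _.
  rewrite -mulr_suml; have /matrixP/(_ 0 k) := vT; rewrite !mxE => vk.
  by under eq_bigr do rewrite mxE conjcK; rewrite vk mul0r.
case/negP: v0; apply/eqP/rowP => i; rewrite mxE.
have := head_le_wnorm u i; rewrite w0 mulr0 mxE sqnJ => h.
by apply/eqP; rewrite -sqn_eq0 eq_le h sqn_ge0.
Qed.

Lemma inv_toepl_conj n (j k : 'I_n) : conjc (invmx (toepl n) j k) = invmx (toepl n) k j.
Proof.
pose Y := \matrix_(i, l) conjc (invmx (toepl n) l i).
have TY : toepl n *m Y = 1%:M.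
  apply/matrixP => i l; rewrite mxE.
  have /matrixP/(_ l i) := mulVmx (toepl_unit n); rewrite !mxE => E.
  rewrite eq_sym -[RHS]conjcK conjc_nat -E conjc_sum; apply: eq_bigr => s _.
  by rewrite conjcM toepl_conj mulrC [Y s l]mxE.
have E : invmx (toepl n) = Y by rewrite -[Y](mulKmx (toepl_unit n)) TY mulmx1.
by rewrite [in RHS]E mxE.
Qed.

Lemma inv_toepl_rev n (j k : 'I_n) :
  invmx (toepl n) (rev_ord j) (rev_ord k) = invmx (toepl n) k j.
Proof.
pose Y := \matrix_(i, l) invmx (toepl n) (rev_ord l) (rev_ord i).
have TY : toepl n *m Y = 1%:M.
  apply/matrixP => i l; rewrite mxE.
  have /matrixP/(_ (rev_ord l) (rev_ord i)) := mulVmx (toepl_unit n); rewrite !mxE => E.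
  rewrite eq_sym -(inj_eq rev_ord_inj) -E [in RHS](reindex_inj rev_ord_inj); apply: eq_bigr => s _.
  by rewrite toepl_rev mulrC [Y s l]mxE.
have E : invmx (toepl n) = Y by rewrite -[Y](mulKmx (toepl_unit n)) TY mulmx1.
by rewrite [in RHS]E mxE.
Qed.

Lemma wnorm_inv_col n (j : 'I_n) :
  invmx (toepl n) j j = (wnorm (rVpoly (col j (invmx (toepl n)))^T))%:C.
Proof.
rewrite -form_toepl.
have TX i : \sum_k toepl n i k * invmx (toepl n) k j = (i == j)%:R.
  by have /matrixP/(_ i j) := mulmxV (toepl_unit n); rewrite !mxE.
have colE k : col j (invmx (toepl n)) k 0 = invmx (toepl n) k j by rewrite mxE.
under eq_bigr => i _ do under eq_bigr => k _ do rewrite !colE -mulrA.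
under eq_bigr => i _ do rewrite -mulr_sumr TX.
rewrite (bigD1 j) //= eqxx mulr1 big1 ?addr0 => [|i /negbTE->]; last by rewrite mulr0.
by rewrite inv_toepl_conj.
Qed.

(** The norm [w] of the column is also its diagonal entry, so the coefficient bound reads $w^2 \le
    S_{jj}w$. *)
Lemma wnorm_inv_col_le n (j : 'I_n) :
  wnorm (rVpoly (col j (invmx (toepl n)))^T) <= inv_lim_diag j.
Proof.
set w := wnorm _; have w0 : 0 <= w by exact: wnorm_ge0.
have := head_le_wnorm (col j (invmx (toepl n))) j.
rewrite mxE wnorm_inv_col -/w /sqn /= expr0n addr0 expr2.
have [->|wn0] := eqVneq w 0; first by rewrite inv_lim_diag_ge0.
by rewrite ler_pM2r // lt_neqAle eq_sym wn0.
Qed.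

(** The form is expanded; because [toepl n] maps column [j] of its inverse to the [j]-th unit
    vector, the mixed terms reduce to $p_j$ and its conjugate. *)
Lemma wnorm_inv_col_sub n (j : 'I_n) (p : {poly C}) : (size p <= n)%N ->
  wnorm (rVpoly (col j (invmx (toepl n)) - (poly_rV p)^T)^T) <=
  inv_lim_diag j - 2 * complex.Re p`_j + wnorm p.
Proof.
move=> pn; set X := invmx (toepl n).
suff -> : wnorm (rVpoly (col j X - (poly_rV p)^T)^T) =
    wnorm (rVpoly (col j X)^T) - 2 * complex.Re p`_j + wnorm p.
  by rewrite !lerD2r; exact: wnorm_inv_col_le.
have TX i : \sum_k toepl n i k * X k j = (i == j)%:R.
  by have /matrixP/(_ i j) := mulmxV (toepl_unit n); rewrite !mxE.
have pickj (c : 'I_n -> C) : \sum_i c i * (i == j)%:R = c j.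
  by rewrite (bigD1 j) //= eqxx mulr1 big1 ?addr0 // => i /negbTE->; rewrite mulr0.
have colE k : col j X k 0 = X k j by rewrite mxE.
have uE i : (col j X - (poly_rV p)^T) i 0 = X i j - p`_i by rewrite !mxE.
suff : (wnorm (rVpoly (col j X - (poly_rV p)^T)^T))%:C =
    (wnorm (rVpoly (col j X)^T))%:C - (p`_j + conjc p`_j) + (wnorm p)%:C.
  case: (p`_j) => x y /eqP; rewrite eq_complex /= => /andP[/eqP -> _]; ring.
rewrite -(form_toepl (col j X - (poly_rV p)^T)).
transitivity (\sum_(i < n) \sum_(k < n) (conjc (X i j) * toepl n i k * X k j
   - conjc p`_i * (toepl n i k * X k j) - conjc (X i j) * toepl n i k * p`_k
   + conjc p`_i * toepl n i k * p`_k)).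
  apply: eq_bigr => i _; apply: eq_bigr => k _; rewrite !uE.
  have -> : conjc (X i j - p`_i) = conjc (X i j) - conjc p`_i by exact: rmorphB.
  ring.
have s1 : \sum_i \sum_k conjc (X i j) * toepl n i k * X k j = (wnorm (rVpoly (col j X)^T))%:C.
  by rewrite -form_toepl; apply: eq_bigr => i _; apply: eq_bigr => k _; rewrite !colE.
have s2 : \sum_(i < n) \sum_(k < n) conjc p`_i * (toepl n i k * X k j) = conjc p`_j.
  by under eq_bigr => i _ do rewrite -mulr_sumr TX; exact: (pickj (fun i => conjc p`_i)).
have s3 : \sum_(i < n) \sum_(k < n) conjc (X i j) * toepl n i k * p`_k = p`_j.
  rewrite exchange_big -[RHS](pickj (fun k => p`_k)); apply: eq_bigr => k _ /=.
  rewrite -mulr_suml mulrC; congr (_ * _).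
  rewrite -[RHS]conjc_nat -TX conjc_sum; apply: eq_bigr => i _.
  by rewrite conjcM toepl_conj mulrC.
have s4 : \sum_(i < n) \sum_(k < n) conjc p`_i * toepl n i k * p`_k = (wnorm p)%:C.
  have pE i : (poly_rV p : 'rV[C]_n)^T i 0 = p`_i by rewrite !mxE.
  have := form_toepl (poly_rV p : 'rV[C]_n)^T; rewrite trmxK (poly_rV_K pn) => <-.
  by apply: eq_bigr => i _; apply: eq_bigr => k _; rewrite !pE.
under eq_bigr do rewrite big_split sumrB sumrB /=.
rewrite big_split sumrB sumrB /= s1 s2 s3 s4; ring.
Qed.

Lemma inv_toepl_near j m (d : R) : 0 < d -> (j < m)%N -> exists n0, forall n (jj : 'I_n), (n0 <= n)%N ->
  jj = j :> nat -> forall i : 'I_n,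
  ((i < m)%N -> sqn (invmx (toepl n) i jj - inv_lim i j) <= d) /\
  ((rev_ord i < m)%N -> sqn (invmx (toepl n) i jj) <= d).
Proof.
move=> d0 jm.
pose K := \sum_(i < m) inv_lim_diag i.
have K0 : 0 <= K by apply: sumr_ge0 => i _; exact: inv_lim_diag_ge0.
have Km i : (i < m)%N -> inv_lim_diag i <= K.
  move=> im; rewrite /K (bigD1 (Ordinal im)) //= lerDl sumr_ge0 // => l _.
  exact: inv_lim_diag_ge0.
have K1 : 0 < K + 1 by rewrite ltr_wpDl.
(* Chosen so that $3eK$ is below [d / 4]; [K] bounds every diagonal entry of the limit with index
   below [m]. *)
pose e := d / (20 * (K + 1)).
have e0 : 0 < e by rewrite divr_gt0 // mulr_gt0.
(* Three demands on [p]: [e ^+ 2] puts $p_j$ within [e] of the diagonal entry, [e] controls the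
   excess of the norm, and [d / 4] controls the other coefficients. *)
have e2 : 0 < Num.min (e ^+ 2) (Num.min e (d / 4)).
  by rewrite !lt_min exprn_gt0 // e0 divr_gt0.
have [p [p1 p2]] := inv_lim_approx j m e2.
have le_e : Num.min (e ^+ 2) (Num.min e (d / 4)) <= e by rewrite !ge_min lexx orbT.
have le_e2 : Num.min (e ^+ 2) (Num.min e (d / 4)) <= e ^+ 2 by rewrite ge_min lexx.
have le_d : Num.min (e ^+ 2) (Num.min e (d / 4)) <= d / 4 by rewrite !ge_min lexx !orbT.
have rep : inv_lim_diag j - e <= complex.Re p`_j.
  have := le_trans (p2 j jm) le_e2; rewrite inv_lim_diagE sqn_normc.
  rewrite ler_pXn2r ?nnegrE ?normc_ge0 ?(ltW e0) // => h.
  have := le_trans (normc_Re _) h; rewrite ReD /= ler_norml => /andP[+ _]; lra.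
exists (size p + m)%N => n jj nn jE i.
have pn : (size p <= n)%N by apply: leq_trans nn; exact: leq_addr.
(* With $S$ the diagonal entry, $S - 2(S-e) + (S+e) = 3e$. *)
have W : wnorm (rVpoly (col jj (invmx (toepl n)) - (poly_rV p)^T)^T) <= 3 * e.
  apply: (le_trans (wnorm_inv_col_sub jj pn)); rewrite jE.
  by have := le_trans p1 (lerD (lexx _) le_e); lra.
have e5 : K * (3 * e) <= d / 4.
  apply: (@le_trans _ _ ((K + 1) * (3 * e))).
    have e30 : 0 <= 3 * e by apply: mulr_ge0 => //; exact: ltW.
    by apply: ler_wpM2r => //; rewrite lerDl.
  have -> : (K + 1) * (3 * e) = 3 * d / 20 by rewrite /e; field; rewrite gt_eqF.
  lra.
have Kd k : (k < m)%N -> inv_lim_diag k *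
    wnorm (rVpoly (col jj (invmx (toepl n)) - (poly_rV p)^T)^T) <= d / 4.
  move=> km; apply: le_trans e5; apply: ler_pM; rewrite ?inv_lim_diag_ge0 ?wnorm_ge0 ?Km //.
have uE : (col jj (invmx (toepl n)) - (poly_rV p)^T) i 0 = invmx (toepl n) i jj - p`_i by rewrite !mxE.
split=> im.
  have := head_le_wnorm (col jj (invmx (toepl n)) - (poly_rV p)^T) i; rewrite uE => h.
  have -> : invmx (toepl n) i jj - inv_lim i j = (invmx (toepl n) i jj - p`_i) + (p`_i - inv_lim i j).
    by rewrite addrA subrK.
  apply: (le_trans (sqnD_le _ _)).
  have := le_trans h (Kd i im); have := le_trans (p2 i im) le_d; lra.
have := tail_le_wnorm (col jj (invmx (toepl n)) - (poly_rV p)^T) i; rewrite uE.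
(* As [n] is at least [size p + m], the last [m] positions lie beyond the degree of [p]. *)
have -> : p`_i = 0.
  have aux (s l : nat) : (l < n)%N -> (n - l.+1 < m)%N -> (s + m <= n)%N -> (s <= l)%N.
    by clear; lia.
  exact: nth_default (aux _ _ (ltn_ord i) im nn).
rewrite subr0 => h; apply: (le_trans h); apply: (le_trans (Kd _ im)); lra.
Qed.

End InverseToeplitz.

(** * Determinants with perturbed corners *)

Section CornerDeterminants.
Context {R : realType}.
Local Notation C := R[i].

Lemma ccvg_of_sqn (u : nat -> C) (l : C) :
  (forall d : R, 0 < d -> exists n0, forall n, (n0 <= n)%N -> sqn (u n - l) <= d) -> ccvg u l.
Proof.
move=> h; apply/ccvgP; split; apply/cvgrPdist_le => e e0.
- have [n0 hn0] := h (e ^+ 2) (exprn_gt0 2 e0); exists n0 => // n /= n0n.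
  have := hn0 n n0n; rewrite sqn_normc ler_pXn2r ?nnegrE ?normc_ge0 ?(ltW e0) // => hn.
  apply: le_trans hn; rewrite distrC; apply: le_trans (normc_Re _).
  by case: (u n) (l) => ? ? [? ?].
- have [n0 hn0] := h (e ^+ 2) (exprn_gt0 2 e0); exists n0 => // n /= n0n.
  have := hn0 n n0n; rewrite sqn_normc ler_pXn2r ?nnegrE ?normc_ge0 ?(ltW e0) // => hn.
  apply: le_trans hn; rewrite distrC; apply: le_trans (normc_Im _).
  by case: (u n) (l) => ? ? [? ?].
Qed.

Lemma ccvg_det m (M : nat -> 'M[C]_m) (L : 'M[C]_m) :
  (forall i j, ccvg (fun n => M n i j) (L i j)) -> ccvg (fun n => \det (M n)) (\det L).
Proof.
move=> h; apply: ccvg_sum => s _; apply: ccvgM; first exact: ccvg_cst.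
by apply: ccvg_prod => i _; exact: h.
Qed.

(** Sylvester's identity, from two triangular factorizations of one block matrix. *)
Lemma det_add1_mulC (F : comNzRingType) n p (M : 'M[F]_(n, p)) (N : 'M[F]_(p, n)) :
  \det (1%:M + M *m N) = \det (1%:M + N *m M).
Proof.
transitivity (\det (block_mx 1%:M (- M) N 1%:M)).
  have -> : block_mx 1%:M (- M) N 1%:M =
      block_mx (1%:M + M *m N) (- M) 0 1%:M *m block_mx 1%:M 0 N 1%:M.
    rewrite mulmx_block !mulmx1 !mulmx0 ?mul0mx !mul1mx !add0r mulNmx addrK.
    by [].
  by rewrite det_mulmx det_ublock det_lblock !det1 !mulr1.
have -> : block_mx 1%:M (- M) N 1%:M =
    block_mx 1%:M 0 N 1%:M *m block_mx 1%:M (- M) 0 (1%:M + N *m M).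
  rewrite mulmx_block !mulmx1 !mulmx0 ?mul0mx !mul1mx !addr0 mulmxN.
  by rewrite addrCA addNr addr0.
by rewrite det_mulmx det_ublock det_lblock !det1 !mul1r.
Qed.

Definition corner_idx m k (i : 'I_(m + m)) : 'I_(m + (k + m)) :=
  match fintype.split i with inl i => lshift (k + m) i | inr i => rshift m (rshift k i) end.

(** A factorization $PEP^\top$, with $P$ the inclusion of the first and last [m] coordinates; it
    lets Sylvester's identity reduce the determinant to the fixed size $2m$. *)
Lemma corner_mxE m k (E11 E12 E21 E22 : 'M[C]_m) :
  corner_mx k E11 E12 E21 E22 =
  colsub (@corner_idx m k) 1%:M *m block_mx E11 E12 E21 E22 *m rowsub (@corner_idx m k) 1%:M.
Proof.
have PE : colsub (@corner_idx m k) 1%:M =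
    col_mx (row_mx 1%:M 0) (col_mx 0 (row_mx 0 1%:M)) :> 'M[C]_(_, _).
  apply/matrixP => i j; rewrite !mxE /corner_idx.
  case: (split_ordP i) => i' ->; case: (split_ordP j) => j' ->; rewrite !mxE.
  - by rewrite (unsplitK (inl _)) mxE eq_lshift.
  - by rewrite (unsplitK (inr _)) mxE eq_lrshift.
  - case: (split_ordP i') => i'' ->; rewrite !mxE eq_rlshift.
      by [].
    by rewrite (unsplitK (inl _)) mxE.
  - case: (split_ordP i') => i'' ->; rewrite !mxE eq_rshift ?eq_lrshift ?eq_rshift //.
    by rewrite (unsplitK (inr _)) mxE.
have -> : rowsub (@corner_idx m k) 1%:M = (colsub (@corner_idx m k) 1%:M)^T :> 'M[C]_(_, _).
  by apply/matrixP => i j; rewrite !mxE eq_sym.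
rewrite PE !tr_col_mx !tr_row_mx !trmx0 !trmx1.
rewrite !mul_col_mx !mul_row_block !mul1mx !mul0mx !addr0 !add0r.
rewrite !mul_mx_row !mul_row_col !mulmx1 !mulmx0 !addr0 !add0r.
by rewrite /corner_mx !row_mx0.
Qed.

Lemma flip_mxE m (B : 'M[C]_m) i j : flip_mx B i j = B (rev_ord i) (rev_ord j).
Proof.
rewrite /flip_mx mxE (bigD1 (rev_ord j)) //= big1 ?addr0 => [|k kj].
  rewrite !mxE rev_ordK eqxx mulr1 (bigD1 (rev_ord i)) //= big1 ?addr0 => [|k ki].
    by rewrite mxE eqxx mul1r.
  by rewrite mxE (negbTE ki) mul0r.
rewrite [counter_id _ _ _]mxE [_ == _](_ : _ = false) ?mulr0 //.
by apply/negbTE; apply: contra kj => /eqP ->; rewrite rev_ordK.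
Qed.

Section Weight.
Variable a : C -> R.
Hypothesis a_L1 : L1_circle (EFin \o a).
Hypothesis loga_L1 : L1_circle (log_circle a).

Let Ai := integ_weight a_L1.
Let lami := integ_log_weight a_L1 loga_L1.
Let A_exp := weight_exp loga_L1.

Local Notation S := (inv_lim (log_weight a)).
Local Notation X := (fun n => invmx (toepl (weight a) n)).

Lemma toeplitzE n : toeplitz (EFin \o a) n = toepl (weight a) n.
Proof. by apply/matrixP => i j; rewrite !mxE fourier_coef_weight. Qed.

(** Here $c_1 = g$, because the constant coefficient of the formal exponential is 1. Dividing by
    $c_1$ therefore removes one of the two factors $g = 1/G$ in the product, and the zero entries of
    the triangular matrices cut the sum down. *)
Lemma S11E m (i j : 'I_m) : S11 a m i j = S i j.
Proof.
rewrite /S11 mxE mxE /inv_lim.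
pose g : C := (expR (- mean (log_weight a)))%:C.
have g0 : g != 0 by rewrite -[0]/(0%:C) (inj_eq (@complexI R)) gt_eqF // expR_gt0.
have gE : (expR (mean (log_weight a)))^-1%:C = g by rewrite /g expRN.
rewrite (big_ord_widen m (fun t => (\poly_(s < j.+1) ((expR (mean (log_weight a)))^-1%:C *
   conjc (fexp (fun k => - fcoef (log_weight a) k) (j - s))))`_t *
   fexp (fun k => - fcoef (log_weight a) k) (i - t))) // [RHS]big_mkcond mulr_sumr.
apply: eq_bigr => t _; rewrite !mxE coef_poly !ltnS !(c_seqE a_L1 loga_L1) fexp0 gE -/g mulr1.
case: leqP => _; last by rewrite mul0r mulr0.
case: leqP => _; last by rewrite mulr0 mulr0 mul0r.
have -> : conjc (g * fexp (fun k => - fcoef (log_weight a) k) (j - t)) =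
    g * conjc (fexp (fun k => - fcoef (log_weight a) k) (j - t)).
  by rewrite conjcM conjc_real.
by rewrite -!mulrA (mulKf g0) mulrCA; congr (_ * _); exact: mulrC.
Qed.

Lemma ccvg_inv_head m (i j : 'I_m) :
  ccvg (fun k => X (m + (k + m))%N (lshift _ i) (lshift _ j)) (S i j).
Proof.
apply: ccvg_of_sqn => d d0.
have [n0 h] := inv_toepl_near Ai lami A_exp d0 (ltn_ord j).
exists n0 => k kn; have kn' : (n0 <= m + (k + m))%N by lia.
by have [+ _] := h _ (lshift (k + m) j) kn' erefl (lshift (k + m) i); apply; rewrite /= ltn_ord.
Qed.

Lemma ccvg_inv_cross m (i j : 'I_m) :
  ccvg (fun k => X (m + (k + m))%N (rshift m (rshift k i)) (lshift _ j)) 0.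
Proof.
apply: ccvg_of_sqn => d d0.
have [n0 h] := inv_toepl_near Ai lami A_exp d0 (ltn_ord j).
exists n0 => k kn; have kn' : (n0 <= m + (k + m))%N by lia.
have [_ +] := h _ (lshift (k + m) j) kn' erefl (rshift m (rshift k i)).
by rewrite subr0; apply; rewrite /=; have := ltn_ord i; lia.
Qed.

(** The previous limit transported by the Hermitian symmetry of the inverse. *)
Lemma ccvg_inv_cross' m (i j : 'I_m) :
  ccvg (fun k => X (m + (k + m))%N (lshift _ j) (rshift m (rshift k i))) 0.
Proof.
apply: ccvg_of_sqn => d d0.
have [n0 h] := inv_toepl_near Ai lami A_exp d0 (ltn_ord j).
exists n0 => k kn; have kn' : (n0 <= m + (k + m))%N by lia.
have [_ +] := h _ (lshift (k + m) j) kn' erefl (rshift m (rshift k i)).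
rewrite subr0 -(inv_toepl_conj Ai lami A_exp) sqnJ; apply.
by rewrite /=; have := ltn_ord i; lia.
Qed.

(** The symmetry of the inverse about its counter-diagonal maps the lower right corner to the upper
    left one with indices reversed and exchanged, which produces the flip and the transpose in the
    limit. *)
Lemma ccvg_inv_tail m (i j : 'I_m) :
  ccvg (fun k => X (m + (k + m))%N (rshift m (rshift k i)) (rshift m (rshift k j)))
    (S (rev_ord j) (rev_ord i)).
Proof.
have := @ccvg_inv_head m (rev_ord j) (rev_ord i); congr ccvg; apply/funext => k.
rewrite -(inv_toepl_rev Ai lami A_exp).
by congr (invmx _ _ _); apply: val_inj; rewrite /=; [have := ltn_ord i|have := ltn_ord j]; lia.
Qed.

Lemma ccvg_det_corner m (E11 E12 E21 E22 : 'M[C]_m) :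
  ccvg (fun k => \det (toeplitz (EFin \o a) (m + (k + m)) + corner_mx k E11 E12 E21 E22)
       / \det (toeplitz (EFin \o a) (m + (k + m))))
  (\det (block_mx 1%:M 0 0 1%:M + block_mx (S11 a m) 0 0 (flip_mx (S11 a m))^T *m
         block_mx E11 E12 E21 E22)).
Proof.
set E := block_mx E11 E12 E21 E22; set L := block_mx (S11 a m) _ _ _.
pose M k := mxsub (@corner_idx m k) (@corner_idx m k) (X (m + (k + m))%N).
have -> : (fun k => \det (toeplitz (EFin \o a) (m + (k + m)) + corner_mx k E11 E12 E21 E22)
       / \det (toeplitz (EFin \o a) (m + (k + m)))) = (fun k => \det (1%:M + M k *m E)).
  apply/funext => k; rewrite toeplitzE.
  have Tu := toepl_unit Ai lami A_exp (m + (k + m)).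
  set T := toepl _ _ in Tu *.
  have -> : T + corner_mx k E11 E12 E21 E22 = T *m (1%:M + invmx T *m corner_mx k E11 E12 E21 E22).
    by rewrite mulmxDr mulmx1 mulKVmx.
  rewrite det_mulmx mulrAC mulfV ?mul1r; last by rewrite -unitfE -unitmxE.
  (* Cycling the last factor to the front leaves the four corners of the inverse times [E]. *)
  rewrite corner_mxE -/E mulmxA mulmxA det_add1_mulC !mulmxA; congr (\det (_ + _ *m _)).
  by rewrite mul_rowsub_mx mul1mx mulmx_colsub mulmx1; apply/matrixP => i j; rewrite !mxE.
rewrite -scalar_mx_block; apply: ccvg_det => i j.
under [X in ccvg X]funext do rewrite mxE; rewrite mxE.
apply: ccvgD; first exact: ccvg_cst.
under [X in ccvg X]funext do rewrite mxE; rewrite mxE.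
apply: ccvg_sum => l _; apply: ccvgM; last exact: ccvg_cst.
under [X in ccvg X]funext do rewrite mxE.
rewrite /corner_idx /L.
case: (split_ordP i) => i' ->; case: (split_ordP l) => l' ->.
- by rewrite block_mxEul S11E; exact: ccvg_inv_head.
- by rewrite block_mxEur mxE; exact: ccvg_inv_cross'.
- by rewrite block_mxEdl mxE; exact: ccvg_inv_cross.
- by rewrite block_mxEdr mxE flip_mxE S11E; exact: ccvg_inv_tail.
Qed.

End Weight.
End CornerDeterminants.

Theorem corollary5p2 (R : realType) (a : R[i] -> R)
  (a_L1 : L1_circle (EFin \o a))
  (a_ge0 : {ae lebesgue_measure, forall t : R, t \in `[- pi, pi] -> 0 <= a (expi t)})
  (loga_L1 : L1_circle (log_circle a))
  (m0 : nat) (m0_ge1 : (1 <= m0)%N)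
  (E11 E12 E21 E22 : 'M[R[i]]_m0) :
  (fun k : nat =>
     \det (toeplitz (EFin \o a) (m0 + (k + m0)) + corner_mx k E11 E12 E21 E22)
       / \det (toeplitz (EFin \o a) (m0 + (k + m0))) : R[i]^o) @ \oo -->
  (\det (block_mx 1%:M 0 0 1%:M +
         block_mx (S11 a m0) 0 0 (flip_mx (S11 a m0))^T *m
         block_mx E11 E12 E21 E22) : R[i]^o).
Proof. exact/ccvg_cvg/(ccvg_det_corner a_L1 loga_L1). Qed.
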